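(* Let $\alpha>1$ and let $P\ll Q$ be probability measures on $\mathcal Z$. The index $K$ produced by PPR with parameter $\alpha$, proposal $Q$ and target $P$ satisfies $$\mathbb E[\log K]\le D(P\Vert Q)+\frac{\log(3.56)}{\min\{(\alpha-1)/2,\,1\}}.$$ Consequently, if $X\sim P_X$ is random, $P_{Z|X}$ is a Markov kernel, $Q=P_Z$ is the induced marginal of $Z$, and $K$ is obtained by applying PPR to $P=P_{Z|X}(\cdot|X)$, then $\mathbb E[\log K]\le I(X;Z)+\frac{\log(3.56)}{\min\{(\alpha-1)/2,1\}}$, where $I(X;Z)$ is the mutual information under the joint law $P_X P_{Z|X}$.
   Context: Poisson private representation (PPR). Let $Q$ be a probability measure on a measurable space $\mathcal Z$ and $P$ a probability measure with $P\ll Q$. Let $Z_1,Z_2,\ldots$ be i.i.d. with law $Q$, and independently let $T_1\le T_2\le\cdots$ be the points of a homogeneous Poisson process of rate $1$ on $[0,\infty)$. Put $\tilde T_i:=T_i\cdot\big(\frac{\mathrm dP}{\mathrm dQ}(Z_i)\big)^{-1}$ ($:=\infty$ when the derivative is $0$, with $\infty^{-\alpha}:=0$). For $\alpha\in(1,\infty)$, PPR draws $K\in\{1,2,\ldots\}$ with $\Pr(K=k\mid (Z_i,T_i)_{i})=\tilde T_k^{-\alpha}/\sum_{i=1}^\infty\tilde T_i^{-\alpha}$, and outputs $Z_K$. All logarithms, the KL divergence $D(\cdot\Vert\cdot)$ and mutual information are taken to the same base.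
   Formalization: In the second part, P_{Z|X}(·|x) is assumed to have, for P_X-almost every x, a density with respect to Q that is jointly measurable in (x,z); without this PPR or E[log K] may be undefined (e.g. Z=X uniform). It is automatic for countably generated Z when P_{Z|X}≪Q a.s. *)

(* Defs.v *)
From HB Require Import structures.
From mathcomp Require Import all_boot all_order all_algebra.
From mathcomp Require Import all_classical all_reals all_analysis.
Set Implicit Arguments.
Unset Strict Implicit.
Unset Printing Implicit Defensive.
Import Order.TTheory GRing.Theory Num.Theory.
Import numFieldNormedType.Exports.
Local Open Scope classical_set_scope.
Local Open Scope ring_scope.

Definition KL_div d (T : measurableType d) (R : realType)
    (P Q : probability T R) : \bar R :=
  if pselect (P `<< Q) then
    (\int[P]_x (ln (fine (Radon_Nikodym (charge_of_finite_measure P) Q x)))%:E)%E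
  else +oo%E.

(* Poisson process of rate 1: T_k = E_1 + ... + E_k with (E_j) i.i.d.  *)
(* Exp(1) inter-arrival times.  Index shift: the Rocq index k : nat     *)
(* stands for the paper's index k+1.                                   *)
Definition arrival (Omega : Type) (R : realType) (E : nat -> Omega -> R)
    (k : nat) (w : Omega) : R :=
  \sum_(j < k.+1) E j w.

(* PPR weight  \tilde T_k^{-alpha} = (f(Z_k) / T_k)^alpha,             *)
(* where f is (a version of) dP/dQ; it is 0 when f(Z_k) = 0.           *)
Definition ppr_weight (Omega : Type) (Z : Type) (R : realType) (alpha : R)
    (f : Omega -> Z -> R) (Zs : nat -> Omega -> Z) (E : nat -> Omega -> R)
    (k : nat) (w : Omega) : R :=
  powR (f w (Zs k w) / arrival E k w) alpha.

(* E[log K | (Z_i, T_i)_i] = \sum_k log k * tildeT_k^-a / \sum_i tildeT_i^-a *)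
Definition ppr_cond_log (Omega : Type) (Z : Type) (R : realType) (alpha : R)
    (f : Omega -> Z -> R) (Zs : nat -> Omega -> Z) (E : nat -> Omega -> R)
    (w : Omega) : \bar R :=
  let S := fine (\sum_(0 <= i <oo) (ppr_weight alpha f Zs E i w)%:E)%E in
  (\sum_(0 <= k <oo) (ln (k.+1)%:R * (ppr_weight alpha f Zs E k w / S))%:E)%E.

Definition ppr_Elog d (Omega : measurableType d) (Z : Type) (R : realType)
    (Pr : probability Omega R) (alpha : R)
    (f : Omega -> Z -> R) (Zs : nat -> Omega -> Z) (E : nat -> Omega -> R) : \bar R :=
  (\int[Pr]_w ppr_cond_log alpha f Zs E w)%E.

Definition iid_ppr_inputs d dZ (Omega : measurableType d) (Z : measurableType dZ)
    (R : realType) (Pr : probability Omega R) (Q : set Z -> \bar R)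
    (Zs : nat -> Omega -> Z) (E : nat -> Omega -> R) : Prop :=
  (forall i, measurable_fun setT (Zs i)) /\
  (forall i, measurable_fun setT (E i)) /\
  forall (n : nat) (A : nat -> set Z) (B : nat -> set R),
    (forall i, measurable (A i)) -> (forall i, measurable (B i)) ->
    Pr (\bigcap_(i in `I_n) (Zs i @^-1` A i `&` E i @^-1` B i)) =
    (\prod_(i < n) (Q (A i) * exponential_prob 1 (B i)))%E.

Definition iid_ppr_inputs_X d dX dZ (Omega : measurableType d)
    (Xs : measurableType dX) (Z : measurableType dZ)
    (R : realType) (Pr : probability Omega R) (PX : set Xs -> \bar R)
    (Q : set Z -> \bar R) (X : Omega -> Xs)
    (Zs : nat -> Omega -> Z) (E : nat -> Omega -> R) : Prop :=
  measurable_fun setT X /\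
  (forall i, measurable_fun setT (Zs i)) /\
  (forall i, measurable_fun setT (E i)) /\
  forall (A0 : set Xs) (n : nat) (A : nat -> set Z) (B : nat -> set R),
    measurable A0 ->
    (forall i, measurable (A i)) -> (forall i, measurable (B i)) ->
    Pr (X @^-1` A0 `&` \bigcap_(i in `I_n) (Zs i @^-1` A i `&` E i @^-1` B i)) =
    (PX A0 * \prod_(i < n) (Q (A i) * exponential_prob 1 (B i)))%E.

Definition ppr_const (R : realType) (alpha : R) : R :=
  ln (356%:R / 100%:R : R) / Num.min ((alpha - 1) / 2) 1.

(* Main.v *)
Require Import Defs.
From HB Require Import structures.
From mathcomp Require Import all_boot all_order all_algebra.
From mathcomp Require Import all_classical all_reals all_analysis.
From mathcomp Require Import ring lra measurable_realfun.
Set Implicit Arguments.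
Unset Strict Implicit.
Unset Printing Implicit Defensive.
Import Order.TTheory GRing.Theory Num.Theory.
Import numFieldNormedType.Exports.
Local Open Scope classical_set_scope.
Local Open Scope ring_scope.

(** Put [f = dP/dQ], [W(z,t) = (f(z)/t)^alpha], [w_k = W(Z_k,T_k)] and
    [S = \sum_k w_k].  Since [w_k / S = \int_0^oo w_k e^(-uS) du], it suffices
    to bound [\sum_k log(k) E[w_k e^(-uS)]] for each [u > 0].  Let
    [g(t) = E_Q e^(-u W(Z,t))] and [G(t) = \int_0^t g <= t].  Exploring the points
    in order of arrival, [k] points before [t] contribute [e^(-t) G(t)^k / k!]
    and the points after [t] contribute [exp(- \int_t^oo (1 - g))].  By Jensen's
    inequality for the Poisson law, the sum over [k] is at most
    [e^(- \int_0^oo (1 - g)) log(1 + t)], and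
    [\int_0^oo (1 - g) = c u^(1/alpha)] with [c = Gamma(1 - 1/alpha)].
    Integrating over [u] and rescaling [t = f(z) x] gives
    [E[log K] <= E_Q[f \int log(1 + f x) p(x) dx]] for an explicit probability
    density [p].  Here [log(1 + f x)] is [log f + log(1 + x)] up to an error
    whose expectation is [<= 0], and with [eta = min((alpha - 1)/2, 1)],
    [log(1 + x) <= log(1 + x^eta) / eta]; a Gamma function estimate bounds the
    [eta]-th moment of [p] by 2.56, and Jensen's inequality yields
    [log(3.56) / eta].  For a random target, [X] is independent of
    the inputs, so the bound is integrated over [X]. *)

(** * Integration on the half-line *)

(** Since [log k >= 0], every integrand can be kept nonnegative, so all exchanges are Tonelli and
    nothing has to be integrable beforehand. The divergence may be infinite; to avoid [oo - oo] it
    is split into the integrals of [f ln^+ f] and [f ln^- f], the latter at most 1, and the bound is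
    kept in the additive form [E[log K] + neg <= pos + C] until the end. This form can also be
    averaged over a random target before anything is subtracted. Only upper bounds on the point
    process are needed. The factor of the [k] earlier points comes from an induction that peels off
    the last pair, that of the later points from a supersolution of a one-step recursion followed by
    a limit; the product over infinitely many points is never computed exactly. The constant is
    [3.56 = 1 + 2.56], where 2.56 bounds [Gamma(1 - (1 + eta)/alpha) / Gamma(1 - 1/alpha)^(1 +
    eta)]. The numerator is finite only for [eta < alpha - 1]; [(alpha - 1)/2] is the middle of this
    range, and [eta <= 1] makes [t^eta] subadditive and [Gamma(1 + eta) <= 1]. *)

Definition posR {R : realType} : set R := `]0, +oo[%classic.

Lemma posRE (R : realType) (x : R) : posR x = (0 < x).
Proof. by rewrite /posR/= in_itv/= andbT. Qed.

Lemma measurable_posR (R : realType) : measurable (@posR R).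
Proof. exact: measurable_itv. Qed.
#[global] Hint Resolve measurable_posR : core.
#[global] Hint Extern 0 (measurable posR) => exact: measurable_posR : core.

Lemma measurable_invr (R : realType) : measurable_fun [set: R] (@GRing.inv R).
Proof.
rewrite -(setUv [set (0 : R)]); apply/measurable_funU => //.
  exact: measurableC.
split; first exact: measurable_fun_set1.
apply: open_continuous_measurable_fun.
  exact/closed_openC/accessible_closed_set1/hausdorff_accessible/Rhausdorff.
by move=> x; rewrite inE/= => /eqP x0; exact: inv_continuous.
Qed.

Lemma measurable_funV d (T : measurableType d) (R : realType) D (f : T -> R) :
  measurable_fun D f -> measurable_fun D (fun x => (f x)^-1).
Proof. by move=> mf; apply: (measurableT_comp (@measurable_invr R)). Qed.

Section tonelli_in.
Local Open Scope ereal_scope.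
Context d1 d2 (T1 : measurableType d1) (T2 : measurableType d2) (R : realType).
Variables (m1 : {sigma_finite_measure set T1 -> \bar R})
  (m2 : {sigma_finite_measure set T2 -> \bar R}).
Variables (A : set T1) (B : set T2) (f : T1 * T2 -> \bar R).
Hypotheses (mA : measurable A) (mB : measurable B).
Hypotheses (mf : measurable_fun setT f).
Hypothesis f0 : forall x y, A x -> B y -> 0 <= f (x, y).

Let g := f \_ (A `*` B).

Let mg : measurable_fun setT g.
Proof.
apply/(measurable_restrictT _ _).1; first exact: measurableX.
exact: measurable_funTS.
Qed.

Let g0 z : 0 <= g z.
Proof. by apply: erestrict_ge0 => -[x y] [/= Ax By]; exact: f0. Qed.

Let intFE x : A x -> \int[m2]_(y in B) f (x, y) = \int[m2]_y g (x, y).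
Proof.
move=> Ax; rewrite integral_mkcond; apply: eq_integral => y _.
by rewrite /g !patchE in_setX/= (mem_set Ax).
Qed.

Let intGE y : B y -> \int[m1]_(x in A) f (x, y) = \int[m1]_x g (x, y).
Proof.
move=> By; rewrite integral_mkcond; apply: eq_integral => x _.
by rewrite /g !patchE in_setX/= (mem_set By) andbT.
Qed.

Lemma measurable_integral_in :
  measurable_fun A (fun x => \int[m2]_(y in B) f (x, y)).
Proof.
apply: (eq_measurable_fun (fun x => \int[m2]_y g (x, y))).
  by move=> x /[!inE] Ax; rewrite intFE.
by apply: measurable_funTS; exact: (measurable_fun_fubini_tonelli_F g).
Qed.

(** Nonnegativity is asked on [A] times [B] only, because factors such as [ln (1 + t)] are negative
    for some [t] outside [posR]. *)
Lemma tonelli_in : \int[m1]_(x in A) \int[m2]_(y in B) f (x, y) =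
                   \int[m2]_(y in B) \int[m1]_(x in A) f (x, y).
Proof.
transitivity (\int[m1]_x \int[m2]_y g (x, y)).
  rewrite integral_mkcond; apply: eq_integral => x _; rewrite patchE.
  case: ifPn => [/[!inE] Ax|xA]; first exact: intFE.
  by rewrite integral0_eq// => y _; rewrite /g patchE in_setX/= (negbTE xA).
rewrite fubini_tonelli//.
rewrite [RHS]integral_mkcond; apply: eq_integral => y _; rewrite patchE.
case: ifPn => [/[!inE] By|yB]; first exact/esym/intGE.
by rewrite integral0_eq// => x _; rewrite /g patchE in_setX/= (negbTE yB) andbF.
Qed.

End tonelli_in.

(** * Affine changes of variable for nonnegative integrands *)

Section affine_change.
Local Open Scope ereal_scope.
Context {R : realType}.
Local Notation mu := (@lebesgue_measure R).

Let aff (a b x : R) : measurableTypeR R := (a * x + b)%R.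

Let measurable_aff a b : measurable_fun [set: R] (aff a b).
Proof. by apply: measurable_funD => //; exact: mulrl_measurable. Qed.

(** Uniqueness of Lebesgue measure: the rescaled pushforward gives every half-open interval its
    length. *)
Let lebesgue_measure_aff (a b : R) (A : set R) : (0 < a)%R -> measurable A ->
  mu A = a%:E * mu (aff a b @^-1` A).
Proof.
move=> a0 mA.
apply: (@lebesgue_measure_unique R
  (mscale (NngNum (ltW a0)) (pushforward mu (aff a b)))) => [|? _ [[u v]] _ <-|] //=.
  exact: measurable_aff.
rewrite /mscale/= /pushforward.
have -> : aff a b @^-1` `]u, v] = `]((u - b) / a)%R, ((v - b) / a)%R]%classic.
  apply/seteqP; split => x; rewrite /= !in_itv/= /aff => /andP[h1 h2].
    by apply/andP; rewrite ltr_pdivrMr// ler_pdivlMr// ltrBlDr lerBrDr mulrC.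
  by apply/andP; move: h1 h2; rewrite ltr_pdivrMr// ler_pdivlMr// ltrBlDr lerBrDr mulrC.
rewrite !lebesgue_measure_itv/= !lte_fin ltr_pM2r ?invr_gt0// ltrD2r.
case: ifPn => _; last by rewrite mule0.
rewrite -!EFinB -EFinM; congr EFin.
by rewrite -mulrBl opprB addrA subrK mulrC divfK ?gt_eqF.
Qed.

Lemma ge0_integral_affine (a b : R) (D : set R) (f : R -> \bar R) : (0 < a)%R ->
  measurable D -> measurable_fun D f -> (forall x, D x -> 0 <= f x) ->
  \int[mu]_(x in D) f x = a%:E * \int[mu]_(x in [set x | D (a * x + b)%R]) f (a * x + b)%R.
Proof.
move=> a0 mD mf f0.
rewrite (eq_measure_integral (mscale (NngNum (ltW a0)) (pushforward mu (aff a b)))).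
- exact: measurable_aff.
- move=> mphi; rewrite ge0_integral_mscale//=; congr (_ * _).
  rewrite ge0_integral_pushforward//.
  by move=> y /[!inE]; exact: f0.
- by move=> mphi A mA _; exact: lebesgue_measure_aff.
Qed.

Lemma ge0_integral_scale (a : R) (f : R -> \bar R) : (0 < a)%R ->
  measurable_fun posR f -> (forall x, (0 < x)%R -> 0 <= f x) ->
  \int[mu]_(x in posR) f x = a%:E * \int[mu]_(x in posR) f (a * x)%R.
Proof.
move=> a0 mf f0; rewrite (ge0_integral_affine 0 a0)//.
  congr (_ * _).
  rewrite (_ : [set x | _] = posR).
    by apply: eq_integral => x _; rewrite addr0.
  by apply/funext => x; rewrite /= !posRE addr0 pmulr_rgt0.
by move=> x; rewrite posRE; exact: f0.
Qed.

Lemma ge0_integral_shift (s : R) (f : R -> \bar R) :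
  measurable_fun `]s, +oo[ f -> (forall x, (s < x)%R -> 0 <= f x) ->
  \int[mu]_(x in `]s, +oo[) f x = \int[mu]_(x in posR) f (s + x)%R.
Proof.
move=> mf f0; rewrite (ge0_integral_affine s (@ltr01 R))//.
  rewrite mul1e (_ : [set x | _] = posR).
    by apply: eq_integral => x _; rewrite mul1r addrC.
  by apply/funext => x; rewrite posRE/= in_itv/= andbT mul1r ltrDr.
by move=> x; rewrite /= in_itv/= andbT; exact: f0.
Qed.

End affine_change.

(** Measurability by recursion on the head symbol. Abstract measurable functions are closed from the
    context, which is why later proofs introduce facts such as [mW] before calling [meas]. *)
Ltac meas_step := lazymatch goal with
  | |- measurable_fun _ (fun x => EFin (@?f x)) => apply/measurable_EFinP
  | |- measurable_fun _ (fun x => GRing.mul (@?f x) (@?g x)) => apply: (@measurable_funM _ _ _ _ f g)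
  | |- measurable_fun _ (fun x => GRing.add (@?f x) (GRing.opp (@?g x))) => apply: (@measurable_funB _ _ _ _ f g)
  | |- measurable_fun _ (fun x => GRing.add (@?f x) (@?g x)) => apply: (@measurable_funD _ _ _ _ f g)
  | |- measurable_fun _ (fun x => GRing.opp (@?f x)) => apply: (@measurable_funN _ _ _ _ f)
  | |- measurable_fun _ (fun x => GRing.inv (@?f x)) => apply: (@measurable_funV _ _ _ _ f)
  | |- measurable_fun _ (fun x => expR (@?f x)) => apply: (@measurableT_comp _ _ _ _ _ _ (@expR _) _ f); first exact: measurable_expR
  | |- measurable_fun _ (fun x => ln (@?f x)) => apply: (@measurableT_comp _ _ _ _ _ _ (@ln _) _ f); first exact: measurable_ln
  | |- measurable_fun _ (fun x => powR (@?f x) ?a) => apply: (@measurableT_comp _ _ _ _ _ _ (fun z => powR z a) _ f); first exact: measurable_powR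
  | |- measurable_fun _ (fun x => Order.max (@?f x) (@?g x)) => apply: (@measurable_maxr _ _ _ _ f g)
  | |- measurable_fun _ (fun x => Order.lt (@?f x) (@?g x)) => apply: (@measurable_fun_ltr _ _ _ _ f g)
  | |- measurable_fun _ (fun x => Order.le (@?f x) (@?g x)) => apply: (@measurable_fun_ler _ _ _ _ f g)
  | |- measurable_fun _ (fun x => fst x) => exact: measurable_fst
  | |- measurable_fun _ (fun x => snd x) => exact: measurable_snd
  | |- measurable_fun _ (fun x => x) => exact: measurable_id
  | |- measurable_fun _ (fun x => fst (@?f x)) => apply: (@measurableT_comp _ _ _ _ _ _ fst _ f); first exact: measurable_fst
  | |- measurable_fun _ (fun x => snd (@?f x)) => apply: (@measurableT_comp _ _ _ _ _ _ snd _ f); first exact: measurable_snd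
  | |- measurable_fun _ (fun x => pair (@?f x) (@?g x)) => apply: (@measurable_fun_pair _ _ _ _ _ _ f g)
  | |- measurable_fun _ (fun x => ?c) => exact: measurable_cst
  end.
Ltac meas := rewrite ?/comp; try apply: measurable_funTS; cbv beta;
  repeat (first [done | assumption | meas_step | eapply measurable_fun_ifT]; cbv beta).

(** * Gamma function *)

(** Exhaustion by compact intervals that avoid a possible singularity at 0. With [n.+2] the lower
    end is strictly below [t] already for [n = 0], as the fundamental theorem requires. *)
Lemma bigcup_itv_oc (R : realType) (t : R) : 0 < t ->
  \bigcup_n `[t / n.+2%:R, t]%classic = `]0, t]%classic.
Proof.
move=> t0; apply/seteqP; split => s.
  move=> [n _]; rewrite /= !in_itv/= => /andP[h1 ->]; rewrite andbT.
  by apply: lt_le_trans h1; rewrite divr_gt0.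
rewrite /= in_itv/= => /andP[s0 sy]; exists (Num.truncn (t / s)) => //.
rewrite /= in_itv/= sy andbT ler_pdivrMr//.
have := @truncnS_gt R (t / s); rewrite ltr_pdivrMr// => h.
by rewrite mulrC; apply/ltW/(lt_le_trans h); rewrite ler_pM2r// ler_nat.
Qed.

Lemma FTC2_is_derive (R : realType) (f F : R -> R) (a b : R) : a < b ->
  (forall x, a <= x <= b -> is_derive x 1 F (f x)) ->
  (forall x, a <= x <= b -> {for x, continuous f}) ->
  (\int[lebesgue_measure]_(x in `[a, b]) (f x)%:E = (F b)%:E - (F a)%:E)%E.
Proof.
move=> ab dF cf.
have cF x : a <= x <= b -> {for x, continuous F}.
  by move=> /dF[dFx _]; apply/differentiable_continuous/derivable1_diffP.
apply: continuous_FTC2 => //.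
- apply: continuous_in_subspaceT => x; rewrite inE/= in_itv/=; exact: cf.
- split.
  + by move=> x; rewrite in_itv/= => /andP[ax xb]; have [] : is_derive x 1 F (f x)
      by apply: dF; rewrite !ltW.
  + by apply: cvg_at_right_filter; apply: cF; rewrite lexx ltW.
  + by apply: cvg_at_left_filter; apply: cF; rewrite lexx ltW.
- move=> x; rewrite in_itv/= => /andP[ax xb].
  by rewrite derive1E; apply: derive_val; apply: dF; rewrite !ltW.
Qed.

(** * Tangent-line bounds for real powers at 1 *)

Section power_inequalities.
Context {R : realType}.
Implicit Types x y p : R.

(** Weighted arithmetic-geometric mean inequality: concavity of [ln] between [y] and 1. *)
Lemma powR_le_tangent p y : 0 <= p <= 1 -> 0 < y -> y `^ p <= 1 + p * (y - 1).
Proof.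
move=> p01 y0.
have A0 : 0 < 1 + p * (y - 1).
  case/andP: p01 => p0 p1; have [y1|y1] := leP 1 y.
    by rewrite ltr_wpDr// mulr_ge0// subr_ge0.
  rewrite (_ : 1 + _ = (1 - p) + p * y); last by ring.
  have [->|pn1] := eqVneq p 1; first by rewrite subrr add0r mul1r.
  by rewrite ltr_pwDl// ?mulr_ge0 ?(ltW y0)// subr_gt0 lt_neqAle pn1.
rewrite /powR gt_eqF// -[leRHS]lnK ?posrE// ler_expR.
have := @concave_ln R (Itv01 (proj1 (andP p01)) (proj2 (andP p01))) _ _ y0 (@ltr01 R).
rewrite !convRE/= ln1 mulr0 addr0 mulr1 => /le_trans; apply.
by rewrite le_eqVlt; apply/orP; left; apply/eqP; congr ln; rewrite /unstable.onem; ring.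
Qed.

(** The previous bound with exponent [1/p], applied to [y^p]. *)
Lemma powR_ge_tangent_ge1 p y : 1 <= p -> 0 < y -> 1 + p * (y - 1) <= y `^ p.
Proof.
move=> p1 y0; have p0 : 0 < p by rewrite (lt_le_trans _ p1).
have : (y `^ p) `^ p^-1 <= 1 + p^-1 * (y `^ p - 1).
  by apply: powR_le_tangent; rewrite ?powR_gt0// invr_ge0 ltW//= invf_le1.
rewrite -powRrM divff ?gt_eqF// (powRr1 (ltW y0)).
move=> h; have := ler_wpM2l (ltW p0) h.
rewrite mulrDr mulr1 mulVKf ?gt_eqF//; lra.
Qed.

(** [e^v >= 1 + v] at [v = p ln y], then [ln y <= y - 1] multiplied by the nonpositive [p]. *)
Lemma powR_ge_tangent_le0 p y : p <= 0 -> 0 < y -> 1 + p * (y - 1) <= y `^ p.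
Proof.
move=> p0 y0; rewrite /powR gt_eqF//; apply: le_trans (expR_ge1Dx _).
rewrite lerD2l ler_wnM2l//.
by have := @le_ln1Dx R (y - 1); rewrite addrCA subrr addr0; apply; lra.
Qed.

End power_inequalities.

(** * Gamma integrals: recursion and elementary bounds *)

Section gamma_integral.
Local Open Scope ereal_scope.
Context {R : realType}.
Local Notation mu := (@lebesgue_measure R).
Implicit Types a x : R.

(** Read off from the total mass one of the exponential density; the value [+oo] is excluded because
    it would make that mass infinite. *)
Lemma integral_expRN_posR (a : R) : (0 < a)%R ->
  \int[mu]_(y in posR) (expR (- (a * y)))%:E = (a^-1)%:E.
Proof.
move=> a0.
have mE D : measurable_fun D (fun y : R => (expR (- (a * y)))%:E).
  by meas.
have := @integral_exponential_pdf R a a0.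
have -> : \int[mu]_x (exponential_pdf a x)%:E =
    \int[mu]_(x in posR) (a%:E * (expR (- (a * x)))%:E).
  rewrite /posR integral_itv_obnd_cbnd; last by apply: emeasurable_funM => //; exact: mE.
  rewrite [RHS]integral_mkcond; apply: eq_integral => x _.
  by rewrite /exponential_pdf !patchE; case: ifP => // _; rewrite mulNr EFinM.
rewrite ge0_integralZl_EFin//;
  try solve [exact: mE|exact: ltW|by move=> x _; rewrite lee_fin expR_ge0].
have : \int[mu]_(y in posR) (expR (- (a * y)))%:E >= 0.
  by apply: integral_ge0 => y _; rewrite lee_fin expR_ge0.
case: (\int[mu]_(y in posR) _) => [r|_|//].
  by rewrite -EFinM => _ [ar]; rewrite -[a^-1%R]mulr1 -ar mulKf ?gt_eqF.
by rewrite gt0_muley ?lte_fin.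
Qed.

(* This is Gamma(a + 1). *)
Definition gam (a : R) : \bar R :=
  \int[mu]_(y in posR) (y `^ a * expR (- y))%:E.

Lemma gam_ge0 a : 0 <= gam a.
Proof. by apply: integral_ge0 => y _; rewrite lee_fin mulr_ge0// ?powR_ge0 ?expR_ge0. Qed.

(** For [a < 0] the integrand blows up at 0, so the fundamental theorem is used away from 0 and
    followed by monotone convergence; the boundary term vanishes because [a + 1 > 0]. *)
Lemma integral_powR_itv (a y : R) : (-1 < a)%R -> (0 < y)%R ->
  \int[mu]_(s in `]0%R, y[) ((a + 1) * s `^ a)%:E = (y `^ (a + 1))%:E.
Proof.
move=> a1 y0.
have mpow D : measurable_fun D (fun s : R => ((a + 1) * s `^ a)%:E).
  by meas.
have pos s : 0 <= ((a + 1) * s `^ a)%:E.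
  by rewrite lee_fin mulr_ge0 ?powR_ge0//; lra.
rewrite (@integral_itv_bndo_bndc R (BRight 0%R) y)//.
pose F (n : nat) : set R := `[(y / n.+2%:R)%R, y]%classic.
have FU : \bigcup_n F n = `]0%R, y]%classic by exact: bigcup_itv_oc.
rewrite -FU.
have cv : (\int[mu]_(s in F n) ((a + 1) * s `^ a)%:E @[n --> \oo] -->
    \int[mu]_(s in \bigcup_n F n) ((a + 1) * s `^ a)%:E)%classic.
  apply: (@ge0_nondecreasing_set_cvg_integral _ (measurableTypeR R)) => //.
  - move=> m n mn; rewrite subsetEset => s; rewrite /F/= !in_itv/= => /andP[h1 ->].
    rewrite andbT; apply: le_trans h1; rewrite ler_pM2l// lef_pV2 ?posrE//.
    by rewrite ler_nat.
  - by move=> i; exact: measurable_itv.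
  - by move=> i; exact: mpow.
apply: (cvg_unique _ cv) => //.
have FE n : \int[mu]_(s in F n) ((a + 1) * s `^ a)%:E =
    (y `^ (a + 1) - (y / n.+2%:R) `^ (a + 1))%:E.
  have yn0 : (0 < y / n.+2%:R)%R by rewrite divr_gt0.
  rewrite EFinB.
  apply: (@FTC2_is_derive R (fun s => (a + 1) * s `^ a)%R (fun s => s `^ (a + 1))%R).
  - by rewrite ltr_pdivrMr// ltr_pMr// ltr1n.
  - move=> x /andP[h _]; have x0 : (0 < x)%R by exact: lt_le_trans h.
    apply: DeriveDef; first by apply: derivable_powR; rewrite in_itv/= x0.
    by rewrite -derive1E powR_derive1 ?in_itv/= ?x0// addrK.
  - move=> x /andP[h _]; have x0 : (0 < x)%R by exact: lt_le_trans h.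
    apply: continuousM; first exact: cst_continuous.
    apply/differentiable_continuous/derivable1_diffP/derivable_powR.
    by rewrite in_itv/= x0.
rewrite (_ : (fun n => _) = (fun n => (y `^ (a + 1) - (y / n.+2%:R) `^ (a + 1))%:E)); last first.
  by apply/funext => n; exact: FE.
apply: cvg_EFin; first exact: nearW.
rewrite -[X in _ --> X]subr0; apply: cvgB; first exact: cvg_cst.
apply: (cvg_at_rightP _ _ _).1 (powR_cvg0 _) _ _; first by lra.
split => [n|]; first by rewrite divr_gt0.
rewrite -[X in _ --> X](mulr0 y); apply: cvgM; first exact: cvg_cst.
by rewrite (cvg_shiftS (fun n => n.+1%:R^-1 : R)%R); exact: cvg_harmonic.
Qed.

Lemma integral_expRN_tail (s : R) :
  \int[mu]_(y in `]s, +oo[) (expR (- y))%:E = (expR (- s))%:E.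
Proof.
rewrite ge0_integral_shift; [|by meas|by move=> x _; rewrite lee_fin expR_ge0].
transitivity ((expR (- s))%:E * \int[mu]_(y in posR) (expR (- (1 * y)))%:E).
  rewrite -ge0_integralZl_EFin ?expR_ge0//;
    try solve [by meas|by move=> x _; rewrite lee_fin expR_ge0].
  by apply: eq_integral => y _; rewrite -EFinM mul1r opprD expRD.
by rewrite integral_expRN_posR// invr1 mule1.
Qed.

(** Integration by parts in Tonelli form: [y^(a+1)] is written as an integral over [s < y], and
    integrating [e^(-y)] over [y > s] first gives [e^(-s)]. No finiteness of [gam] is assumed. *)
Lemma gamS (a : R) : (-1 < a)%R -> gam (a + 1) = (a + 1)%:E * gam a.
Proof.
move=> a1; have a0 : (0 <= a + 1)%R by lra.
pose f (p : R * R) : \bar R :=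
  (if (p.1 < p.2)%R then ((a + 1) * p.1 `^ a * expR (- p.2))%R else 0%R)%:E.
have mf : measurable_fun setT f by rewrite /f; meas.
have f0 p : 0 <= f p.
  by rewrite /f; case: ifP => //; rewrite lee_fin ?mulr_ge0 ?powR_ge0 ?expR_ge0.
rewrite /gam -ge0_integralZl_EFin//;
  try solve [by meas|by move=> y _; rewrite lee_fin mulr_ge0 ?powR_ge0 ?expR_ge0].
transitivity (\int[mu]_(y in posR) \int[mu]_(s in posR) f (s, y)).
  apply: eq_integral => y /[!inE]; rewrite posRE => y0.
  rewrite EFinM -integral_powR_itv//.
  rewrite muleC -ge0_integralZl_EFin ?expR_ge0//;
    try solve [by meas|by move=> s _; rewrite lee_fin mulr_ge0 ?powR_ge0].
  rewrite [LHS]integral_mkcond [RHS]integral_mkcond; apply: eq_integral => s _.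
  rewrite !patchE !mem_setE/= !in_itv/= andbT /f/=.
  case: (ltrP 0 s) => //= s0; case: (ltrP s y) => _ //.
  by rewrite -EFinM mulrC.
rewrite -tonelli_in//.
apply: eq_integral => s /[!inE]; rewrite posRE => s0.
transitivity (((a + 1) * s `^ a)%:E * \int[mu]_(y in `]s, +oo[) (expR (- y))%:E).
  rewrite -ge0_integralZl_EFin ?mulr_ge0 ?powR_ge0//;
    try solve [by meas|by move=> y _; rewrite lee_fin expR_ge0].
  rewrite [LHS]integral_mkcond [RHS]integral_mkcond; apply: eq_integral => y _.
  rewrite !patchE !mem_setE/= !in_itv/= !andbT /f/=.
  case: (ltrP 0 y) => //= y0; last by case: (ltrP s y) => // /(lt_trans s0); rewrite ltNge y0.
  by case: (ltrP s y).
by rewrite integral_expRN_tail -!EFinM mulrA.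
Qed.

Lemma gam0 : gam 0 = 1.
Proof.
rewrite /gam; under eq_integral => y _ do rewrite powRr0 mul1r -[y in expR (- y)]mul1r.
by rewrite integral_expRN_posR// invr1.
Qed.

Lemma gam1 : gam 1 = 1.
Proof. by rewrite -[1%R]add0r gamS ?gam0 ?add0r ?mule1//; lra. Qed.

Lemma gam2 : gam 2 = 2%:E.
Proof. by rewrite -[2%R]/(1 + 1)%R gamS ?gam1 ?mule1//; lra. Qed.

(** Turns a pointwise inequality between sums of two powers into a linear inequality between values
    of [gam]. Nonnegative coefficients make it valid even for infinite values. *)
Lemma gamD (a b c d : R) : (0 <= c)%R -> (0 <= d)%R ->
  \int[mu]_(y in posR) ((c * y `^ a + d * y `^ b) * expR (- y))%:E =
  c%:E * gam a + d%:E * gam b.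
Proof.
move=> c0 d0; rewrite /gam -!ge0_integralZl_EFin//;
  try solve [by meas|by move=> y _; rewrite lee_fin mulr_ge0 ?powR_ge0 ?expR_ge0].
rewrite -ge0_integralD//;
  try solve [by meas|by move=> y _; rewrite -EFinM lee_fin !mulr_ge0 ?powR_ge0 ?expR_ge0
    |by under eq_fun do rewrite -EFinM; meas].
by apply: eq_integral => y _; rewrite -!EFinM -EFinD; congr EFin; ring.
Qed.

(** Integrates [y^x <= 1 - x + x y] against [e^(-y)]. *)
Lemma gam_le1 x : (0 <= x <= 1)%R -> gam x <= 1.
Proof.
move=> x01; apply: (@le_trans _ _ ((1 - x)%:E * gam 0 + x%:E * gam 1)).
  rewrite -gamD; [|lra..]; apply: ge0_le_integral => //.
  - by move=> y _; rewrite lee_fin mulr_ge0 ?powR_ge0 ?expR_ge0.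
  - by meas.
  - by meas.
  - move=> y; rewrite posRE => y0; rewrite lee_fin ler_wpM2r ?expR_ge0//.
    by have := powR_le_tangent x01 y0; rewrite powRr0 (powRr1 (ltW y0)); lra.
by rewrite gam0 gam1 !mule1 -EFinD lee_fin; lra.
Qed.

(** Jensen's inequality for the density [y e^(-y)], whose mean is 2, and the convex power [x - 1]:
    the tangent at [y = 2] is integrated. Its negative [y^2] term is moved to the other side to keep
    both integrands nonnegative. *)
Lemma gam_ge_pow2 x : (0 < x <= 1)%R -> (2 `^ (x - 1))%:E <= gam x.
Proof.
move=> x01; have p0 : (0 <= 2 `^ (x - 1) :> R)%R by exact: powR_ge0.
suff : (2 `^ (x - 1) * (2 - x))%:E * gam 1 + 0%:E * gam 0 <=
    1%:E * gam x + (2 `^ (x - 1) * (1 - x) / 2)%:E * gam 2.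
  rewrite gam1 gam0 gam2 mul0e adde0 mule1 mul1e.
  case: (gam x) (gam_ge0 x) => [r _|_ _|//]; last by rewrite leey.
  by rewrite -EFinM -EFinD !lee_fin; lra.
have x2 : (0 <= 2 - x)%R by lra.
have x1 : (0 <= 1 - x)%R by lra.
rewrite -!gamD ?mulr_ge0//.
apply: ge0_le_integral => //; try by meas.
  by move=> y _; rewrite lee_fin mulr_ge0 ?expR_ge0// mul0r addr0 !mulr_ge0 ?powR_ge0.
move=> y; rewrite posRE => y0; rewrite lee_fin ler_wpM2r ?expR_ge0//.
have y2 : (y `^ 2 = y * y)%R by rewrite (powR_mulrn 2 (ltW y0)) expr2.
rewrite mul0r addr0 mul1r (powRr1 (ltW y0)) y2.
have h : (1 + (x - 1) * (y / 2 - 1) <= (y / 2) `^ (x - 1))%R.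
  by apply: powR_ge_tangent_le0; lra.
have e : (y `^ x = y * (2 `^ (x - 1) * (y / 2) `^ (x - 1)))%R.
  rewrite -powRM; [|lra|lra]; rewrite mulrCA divff ?mulr1//.
  by rewrite mulr_powRB1; lra.
rewrite e; have := ler_wpM2l (mulr_ge0 (ltW y0) p0) h; nra.
Qed.

(** The same Jensen argument for the convex power [1 + x]. Combined with [gamS] it is sharp as [x]
    tends to 0, where [gam_ge_pow2] only gives about 1/2. *)
Lemma gam_ge_pow2S x : (0 <= x)%R -> (2 `^ (1 + x))%:E <= gam (2 + x).
Proof.
move=> x0; have p0 : (0 <= 2 `^ (1 + x) :> R)%R by exact: powR_ge0.
suff : (2 `^ (1 + x) * (1 + x) / 2)%:E * gam 2 + 0%:E * gam 0 <=
    1%:E * gam (2 + x) + (2 `^ (1 + x) * x)%:E * gam 1.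
  rewrite gam1 gam0 gam2 mul0e adde0 mule1 mul1e.
  case: (gam (2 + x)) (gam_ge0 (2 + x)) => [r _|_ _|//]; last by rewrite leey.
  by rewrite -EFinM -EFinD !lee_fin; lra.
have x1 : (0 <= 1 + x)%R by lra.
rewrite -!gamD ?mulr_ge0//.
apply: ge0_le_integral => //; try by meas.
  by move=> y _; rewrite lee_fin mulr_ge0 ?expR_ge0// mul0r addr0 !mulr_ge0 ?powR_ge0.
move=> y; rewrite posRE => y0; rewrite lee_fin ler_wpM2r ?expR_ge0//.
have y2 : (y `^ 2 = y * y)%R by rewrite (powR_mulrn 2 (ltW y0)) expr2.
rewrite mul0r addr0 mul1r (powRr1 (ltW y0)) y2.
have h : (1 + (1 + x) * (y / 2 - 1) <= (y / 2) `^ (1 + x))%R.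
  by apply: powR_ge_tangent_ge1; lra.
have e : (y `^ (2 + x) = y * (2 `^ (1 + x) * (y / 2) `^ (1 + x)))%R.
  rewrite -powRM; [|lra|lra]; rewrite mulrCA divff ?mulr1//.
  rewrite -[in RHS](_ : 2 + x - 1 = 1 + x)%R; last by ring.
  by rewrite mulr_powRB1; lra.
rewrite e; have := ler_wpM2l (mulr_ge0 (ltW y0) p0) h; nra.
Qed.

Lemma gam_fin x : (0 <= x <= 1)%R -> gam x \is a fin_num.
Proof. by move=> x01; rewrite ge0_fin_numE ?gam_ge0// (le_lt_trans (gam_le1 x01))// ltry. Qed.

End gamma_integral.

(** * Numerical inequalities behind the constant 2.56 *)

Section moment_inequality.
Context {R : realType}.
Implicit Types x m eta : R.

(** Divided by [50 x^(1+eta)], with [eta = x / (2 (1 - x))], the conclusion reads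
    [2/x <= 2.56 (m/x)^(1+eta)]. The tangent bound on [(x/m)^eta] removes the real powers; the
    remaining quadratic in [m] is increasing in the relevant range, so it is tested at the smallest
    admissible value [4 / D]. *)
Lemma moment_ineq_small x m : 0 < x <= 1 / 2 ->
  4 <= (1 + x) * (4 - x ^+ 2) * m -> 0 < m ->
  x `^ (x / (2 * (1 - x))) * 100 <= 128 * m `^ (1 + x / (2 * (1 - x))).
Proof.
move=> x01 hm m0; set eta := x / _.
have eta01 : 0 <= eta <= 1.
  apply/andP; split; first by rewrite divr_ge0//; lra.
  by rewrite ler_pdivrMr; lra.
have etaE : eta * (2 * (1 - x)) = x by rewrite /eta divfK//; apply/eqP; lra.
have xm0 : 0 < x / m by rewrite divr_gt0//; lra.
have -> : x `^ eta = m `^ eta * (x / m) `^ eta.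
  by rewrite -powRM ?(ltW m0) ?(ltW xm0)//; congr (_ `^ _); rewrite mulrC divfK ?gt_eqF.
have -> : m `^ (1 + eta) = m * m `^ eta.
  by rewrite powRD ?(gt_eqF m0) ?implybT// (powRr1 (ltW m0)).
have h := powR_le_tangent eta01 xm0.
have me0 : 0 < m `^ eta by exact: powR_gt0.
suff key : 100 * ((1 - eta) * m + eta * x) <= 128 * m * m.
  have k2 : (1 + eta * (x / m - 1)) * 100 <= 128 * m.
    rewrite -(ler_pM2r m0); apply: le_trans key.
    rewrite le_eqVlt; apply/orP; left; apply/eqP.
    by field; rewrite gt_eqF.
  have := ler_wpM2l (ltW me0) (le_trans (ler_wpM2r (ler0n R 100) h) k2); lra.
pose D := (1 + x) * (4 - x ^+ 2).
have D0 : 0 < D by rewrite /D; nra.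
have DU : D <= 4 + 4 * x - x * x by rewrite /D; nra.
have mD : 4 / D <= m by rewrite ler_pdivrMr// mulrC.
have e1 : 1 - eta = (2 - 3 * x) / (2 * (1 - x)).
  by rewrite /eta; field; rewrite gt_eqF//; lra.
(* This cubic is what remains of [poly] once [D] is replaced by [4 + 4x - x^2] and the terms [b4],
   [b5] are split off. Subtracting [100/3] times [t1] leaves an affine function that is positive on
   [[0, 1/2]]. *)
have U0 : 0 <= 224 - 624 * x + 1000 * x ^+ 2 - 1200 * x ^+ 3.
  have t1 : 0 <= (1 / 2 - x) * (6 * x - 1) ^+ 2.
    by apply: mulr_ge0; [lra|exact: sqr_ge0].
  lra.
have poly : 0 <= 1024 * (1 - x) - 100 * (2 - 3 * x) * D - 25 * x ^+ 2 * D ^+ 2.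
  have U4 : 0 <= 4 + 4 * x - x * x by nra.
  have a1 : (2 - 3 * x) * D <= (2 - 3 * x) * (4 + 4 * x - x * x).
    by apply: ler_wpM2l => //; lra.
  have a2 : x ^+ 2 * D ^+ 2 <= x ^+ 2 * (4 + 4 * x - x * x) ^+ 2.
    by rewrite ler_wpM2l ?sqr_ge0// ler_sqr ?nnegrE// ltW.
  have b5 : 0 <= x ^+ 5 * (8 - x) by apply: mulr_ge0; [apply: exprn_ge0|]; lra.
  have b4 : 0 <= x ^+ 3 * (1 - 2 * x) by apply: mulr_ge0; [apply: exprn_ge0|]; lra.
  lra.
have ms0 : 0 < 4 / D by rewrite divr_gt0.
have base : 0 <= 4 / D * (128 * (4 / D) - 100 * (1 - eta)) - 100 * eta * x.
  rewrite (_ : _ - _ = (1024 * (1 - x) - 100 * (2 - 3 * x) * D - 25 * x ^+ 2 * D ^+ 2) *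
     (2 / ((1 - x) * D ^+ 2))).
    by rewrite mulr_ge0// divr_ge0// mulr_ge0 ?sqr_ge0//; lra.
  by rewrite e1 /eta; field; rewrite !gt_eqF//; lra.
have : 4 / D * (128 * (4 / D) - 100 * (1 - eta)) <= m * (128 * m - 100 * (1 - eta)).
  have A0 : 0 <= 128 * (4 / D) - 100 * (1 - eta).
    rewrite -(pmulr_rge0 _ ms0).
    have ex : 0 <= eta * x by apply: mulr_ge0; lra.
    lra.
  by apply: ler_pM => //; [exact: ltW|lra].
lra.
Qed.

(** Reduces a decimal bound on a real power to a comparison of rationals. *)
Lemma powR_ge_root (n : nat) (a b p : R) : 0 <= b -> 1 <= a -> (0 < n)%N ->
  n%:R^-1 <= p -> b ^+ n <= a -> b <= a `^ p.
Proof.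
move=> b0 a1 n0 np bna; apply: le_trans (ler_powR a1 np).
rewrite -[leLHS](powRr1 b0) -[X in b `^ X](@divff _ n%:R) ?pnatr_eq0 -?lt0n//.
rewrite powRrM powR_mulrn//; apply: ge0_ler_powR => //.
- by rewrite nnegrE exprn_ge0.
- by rewrite nnegrE (le_trans _ a1).
Qed.

Lemma powR_le_root (n : nat) (a b : R) : 0 <= b -> 0 <= a -> (0 < n)%N ->
  a <= b ^+ n -> a `^ n%:R^-1 <= b.
Proof.
move=> b0 a0 n0 anb.
rewrite -[leRHS](powRr1 b0) -[X in b `^ X](@divff _ n%:R) ?pnatr_eq0 -?lt0n//.
by rewrite powRrM powR_mulrn//; apply: ge0_ler_powR; rewrite ?nnegrE ?exprn_ge0.
Qed.

(** Because [eta (x - 1) = - x/2], the tangent bound gives [x^eta <= 1 - x/2], while [m^(1+eta)] is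
    at least [2^(x/2) / 2]. At [x >= 1/2] it then suffices that [2^(1/4) >= 1.18]. *)
Lemma moment_ineq_large x m : 1 / 2 <= x <= 2 / 3 -> 2 `^ (x - 1) <= m ->
  x `^ (x / (2 * (1 - x))) * 100 <= 128 * m `^ (1 + x / (2 * (1 - x))).
Proof.
move=> x01 hm; set eta := x / _.
have eta01 : 0 <= eta <= 1.
  apply/andP; split; first by rewrite divr_ge0//; lra.
  by rewrite ler_pdivrMr; lra.
have x0 : 0 < x by lra.
have h := powR_le_tangent eta01 x0.
have etaE : eta * (x - 1) = - (x / 2).
  by rewrite /eta; field; rewrite gt_eqF//; lra.
apply: (@le_trans _ _ (128 * (2 `^ (x / 2) * 2^-1))); last first.
  rewrite ler_pM2l//; apply: (@le_trans _ _ ((2 `^ (x - 1)) `^ (1 + eta))).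
    rewrite -powRrM (_ : (x - 1) * (1 + eta) = x / 2 + (-1)); last first.
      by rewrite mulrDr mulr1 [_ * eta]mulrC etaE; lra.
    by rewrite powRD ?pnatr_eq0 ?implybT// powRN powRr1.
  apply: ge0_ler_powR => //; [lra|by rewrite nnegrE powR_ge0|].
  by rewrite nnegrE (le_trans _ hm)// powR_ge0.
have : 118 / 100 <= 2 `^ (x / 2) :> R.
  by apply: (@powR_ge_root 4) => //; lra.
rewrite -/eta; lra.
Qed.

(** The case [eta = 1]: the conclusion is [1 / (2x - 1) <= 2.56 (m/x)^2], and
    [m >= 2^(-1/3) >= 0.79]. *)
Lemma moment_ineq_eta1 x m : 2 / 3 <= x < 1 -> 2 `^ (x - 1) <= m ->
  x ^+ 2 * 100 <= 256 * (2 * x - 1) * m ^+ 2.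
Proof.
move=> x01 hm.
have m79 : 79 / 100 <= m.
  apply: le_trans hm; rewrite -[x - 1]opprK powRN.
  have h0 : 0 < 79 / 100 :> R by lra.
  have h1 : 0 < 2 `^ (- (x - 1)) :> R by exact: powR_gt0.
  rewrite -[leLHS]invrK lef_pV2 ?posrE ?invr_gt0//.
  apply: (@le_trans _ _ (2 `^ (1 / 3))).
    by apply: ler_powR; lra.
  by rewrite div1r invf_div; apply: (@powR_le_root 3) => //; lra.
have m2 : 62 / 100 <= m ^+ 2 by nra.
have p1 : 0 <= (2 * x - 1) * (m ^+ 2 - 62 / 100) by apply: mulr_ge0; lra.
(* Bounds [x^2] by its chord over [[2/3, 1]], which makes the rest linear. *)
have p2 : 0 <= (x - 2 / 3) * (1 - x) by apply: mulr_ge0; lra.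
lra.
Qed.

End moment_inequality.

(** By [gamS] and [gam_le1] the left side is at most [1 / (1 - (1 + eta)/alpha)], which is [2/x] for
    [alpha < 3], where [x = 1 - 1/alpha]. The witness is [c = g/x] with [g = gam x], so only a lower
    bound on [g] is missing. *)
Lemma gam_moment (R : realType) (alpha : R) : 1 < alpha ->
  let eta := Num.min ((alpha - 1) / 2) 1 in
  exists c : R, [/\ 0 < c, gam (- alpha^-1) = c%:E &
    (gam (- (alpha^-1 * (1 + eta))) <= (256 / 100 * c `^ (1 + eta))%:E)%E].
Proof.
move=> a1 eta; have a0 : 0 < alpha by lra.
pose b := alpha^-1; pose x := 1 - b.
have bE : alpha * b = 1 by rewrite /b divff ?gt_eqF.
have b0 : 0 < b by rewrite invr_gt0.
have b1 : b < 1 by rewrite invf_lt1.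
have x01 : 0 <= x <= 1 by rewrite /x; lra.
have x0 : 0 < x by rewrite /x; lra.
have xn0 : x != 0 by rewrite gt_eqF.
have [g gE] : exists g, gam x = g%:E.
  by exists (fine (gam x)); rewrite fineK// gam_fin.
have g2 : 2 `^ (x - 1) <= g.
  by rewrite -lee_fin -gE gam_ge_pow2//; lra.
have g0 : 0 < g by apply: lt_le_trans g2; rewrite powR_gt0.
have gx0 : 0 < g / x by rewrite divr_gt0.
have gamV (s : R) : 0 < s -> gam (1 - s) \is a fin_num -> s < 1 ->
    gam (- s) = (fine (gam (1 - s)) / (1 - s))%:E.
  move=> s0 fs s1; have s1' : - s + 1 != 0 by rewrite gt_eqF//; lra.
  rewrite EFinM fineK// (_ : 1 - s = - s + 1); last by rewrite addrC.
  rewrite gamS; last lra.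
  by rewrite muleC muleA -EFinM mulVf ?mul1e.
have gam_le (s : R) : 0 < s < 1 -> (gam (- s) <= (1 - s)^-1%:E)%E.
  move=> s01; have h : 0 <= 1 - s <= 1 by lra.
  rewrite gamV ?gam_fin//; [|lra|lra].
  rewrite lee_fin ler_pdivrMr ?mulVf ?gt_eqF//; [|lra|lra].
  by rewrite -lee_fin fineK ?gam_fin ?gam_le1.
exists (g / x); split => //.
  by rewrite gamV// ?gE// -/x gE.
rewrite -/b.
(* The minimum that defines [eta] switches at [alpha = 3], that is at [x = 2/3]. *)
have [a3|a3] := leP 3 alpha.
  have -> : eta = 1 by rewrite /eta; apply/min_idPr; lra.
  have b3 : b <= 1 / 3 by rewrite /b div1r lef_pV2 ?posrE.
  have s01 : 0 < b * (1 + 1) < 1 by lra.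
  apply: (le_trans (gam_le _ s01)).
  rewrite lee_fin (_ : 1 + 1 = 2%:R)// powR_mulrn ?(ltW gx0)//.
  have hx : 0 < 2 * x - 1 by rewrite /x; lra.
  rewrite (_ : 1 - b * 2%:R = 2 * x - 1); last by rewrite /x; ring.
  have := @moment_ineq_eta1 R x g; rewrite expr_div_n.
  move=> h; rewrite -[(2 * x - 1)^-1]div1r ler_pdivrMr// mulrA mulrAC.
  rewrite ler_pdivlMr ?exprn_gt0// mul1r.
  have : x ^+ 2 * 100 <= 256 * (2 * x - 1) * g ^+ 2 by apply: h => //; rewrite /x; lra.
  lra.
have etaE : eta = x / (2 * (1 - x)).
  rewrite /eta min_l; last lra.
  rewrite /x /b; field; rewrite gt_eqF//=; lra.
have e0 : 0 <= eta by rewrite etaE divr_ge0//; rewrite /x; lra.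
have sE : 1 - b * (1 + eta) = x / 2.
  rewrite etaE /x; field; rewrite gt_eqF//; lra.
have s01 : 0 < b * (1 + eta) < 1.
  by apply/andP; split; [apply: mulr_gt0; lra|lra].
apply: (le_trans (gam_le _ s01)).
rewrite sE lee_fin.
have xe0 : 0 < x `^ (1 + eta) by exact: powR_gt0.
have key : x `^ eta * 100 <= 128 * g `^ (1 + eta).
  (* For small [x] the bound [g2] is too weak, and [gam_ge_pow2S] is used after raising the argument
     twice with [gamS]. *)
  rewrite etaE; have [x2|x2] := leP x (1 / 2).
    apply: moment_ineq_small => //; first lra.
    have : ((2 `^ (1 + x))%:E <= ((2 + x) * (1 + x) * g)%:E)%E.
      rewrite (le_trans (gam_ge_pow2S (ltW x0)))//.
      have -> : 2 + x = x + 1 + 1 by ring.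
      by rewrite gamS ?gamS ?gE; [rewrite muleA EFinM (addrC 1 x)|lra|lra].
    rewrite lee_fin => h1.
    (* [2^(-x) <= 1 - x/2] turns [h1] into the polynomial hypothesis of [moment_ineq_small]. *)
    have h2 : (2^-1) `^ x <= 1 + x * (2^-1 - 1) by apply: powR_le_tangent => //; lra.
    have e2 : 2 `^ (1 + x) * (2^-1) `^ x = 2.
      rewrite powRD ?pnatr_eq0 ?implybT// powRr1// -mulrA -powRM//.
      by rewrite divff ?powR1 ?mulr1.
    have p1 : 0 < 2 `^ (1 + x) by rewrite powR_gt0.
    have : 2 <= (2 + x) * (1 + x) * g * (1 - x / 2).
      rewrite -[leLHS]e2 ler_pM ?powR_ge0//; lra.
    nra.
  have xE : x = 1 - b by [].
  apply: moment_ineq_large => //.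
  have : 1 / 3 < b by rewrite /b div1r ltf_pV2 ?posrE.
  lra.
have e1 : x `^ (1 + eta) = x * x `^ eta.
  by rewrite powRD ?xn0 ?implybT// (powRr1 (ltW x0)).
have e2 : (g / x) `^ (1 + eta) * (x * x `^ eta) = g `^ (1 + eta).
  rewrite -e1 -powRM ?divfK//; exact: ltW.
have xe1 : 0 < x `^ eta by exact: powR_gt0.
rewrite invf_div ler_pdivrMr// -(ler_pM2r xe1).
move: key; rewrite -e2; set G := (g / x) `^ _; set X := x `^ eta; lra.
Qed.

(** * Cumulative Laplace exponent *)

Lemma ge0_integral_bigcup_le d (T : measurableType d) (R : realType)
    (m : {measure set T -> \bar R}) (F : (set T)^nat) (h : T -> \bar R) (M : \bar R) :
  (forall n, F n `<=` F n.+1) -> (forall n, measurable (F n)) ->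
  measurable_fun setT h -> (forall x, (\bigcup_n F n) x -> 0 <= h x)%E ->
  (forall n, \int[m]_(x in F n) h x <= M)%E ->
  (\int[m]_(x in \bigcup_n F n) h x <= M)%E.
Proof.
move=> ndF mF mh h0 hM.
have ndF' : {homo F : n m / (n <= m)%N >-> (n <= m)%O}.
  by apply: homo_leq => [A|A B C|n]; [exact: lexx|exact: le_trans|rewrite subsetEset].
have cv := @ge0_nondecreasing_set_cvg_integral _ _ R F h m ndF' mF
  (fun i => measurable_funTS mh) (fun i x Fx => h0 x (ex_intro2 _ _ i Logic.I Fx)).
rewrite -(cvg_lim _ cv)//; apply: lime_le; first by apply/cvg_ex; eexists; exact: cv.
exact: nearW.
Qed.

Section renewal.
Context {R : realType}.
Local Notation mu := (@lebesgue_measure R).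
Variables (g : R -> R).
Hypotheses (mg : measurable_fun setT g) (g01 : forall t, 0 <= g t <= 1).
Hypothesis cg : forall t : R, 0 < t -> {for t, continuous g}.

Definition cumul t := (\int[mu]_(s in `[0%R, t]) g s)%R.

Let g0 t : 0 <= g t. Proof. by have /andP[] := g01 t. Qed.
Let g1 t : g t <= 1. Proof. by have /andP[] := g01 t. Qed.

Let integrable_g (a b : R) : mu.-integrable `[a, b] (EFin \o g).
Proof.
apply: measurable_bounded_integrable => //.
- by apply: compact_finite_measure; exact: segment_compact.
- exact: measurable_funTS.
- exists 1; split => // M M1 x _ /=; rewrite ger0_norm ?g0//.
  by rewrite (le_trans (g1 x))// ltW.
Qed.

Lemma cumulE (t : R) : ((cumul t)%:E = \int[mu]_(s in `[0%R, t]) (g s)%:E)%E.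
Proof.
rewrite /cumul /Rintegral fineK//; apply: integrable_fin_num.
- exact: measurable_itv.
- exact: integrable_g.
Qed.

Lemma cumul_ge0 (t : R) : 0 <= cumul t.
Proof. by rewrite -lee_fin cumulE integral_ge0// => s _; rewrite lee_fin. Qed.

Lemma cumulD (s t : R) : 0 <= s <= t ->
  ((cumul t)%:E = (cumul s)%:E + \int[mu]_(x in `]s, t]) (g x)%:E)%E.
Proof.
move=> /andP[s0 st]; rewrite !cumulE -ge0_integral_setU//.
- by rewrite -itv_bndbnd_setU.
- by apply/measurable_EFinP; exact: measurable_funTS.
- by move=> x _; rewrite lee_fin.
- apply/disj_setPS => x [] /=; rewrite !in_itv/= => /andP[_ xs] /andP[sx _].
  by move: sx; rewrite ltNge xs.
Qed.

Lemma cumul_nd (s t : R) : 0 <= s <= t -> cumul s <= cumul t.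
Proof.
by move=> st; rewrite -lee_fin (cumulD st) leeDl// integral_ge0// => x _; rewrite lee_fin.
Qed.

Lemma integral1_itv (s t : R) : 0 <= s <= t ->
  (\int[mu]_(x in `]s, t]) 1 = (t - s)%:E)%E.
Proof.
move=> /andP[s0 st]; rewrite integral_cst// mul1e.
have : lebesgue_measure (`]s, t]%classic : set R) = (t - s)%:E.
  rewrite lebesgue_measure_itv/= lte_fin EFinB.
  by case: ltgtP st => //= -> _; rewrite subee.
exact.
Qed.

Lemma cumul_le_sub (s t : R) : 0 <= s <= t -> s - cumul s <= t - cumul t.
Proof.
move=> st; suff : cumul t <= cumul s + (t - s) by lra.
rewrite -lee_fin (cumulD st) EFinD leeD2l//.
rewrite -(integral1_itv st).
apply: ge0_le_integral => //; try by move=> x _; rewrite lee_fin.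
by apply/measurable_EFinP; exact: measurable_funTS.
Qed.

Lemma cumul0 : cumul 0 = 0.
Proof. by rewrite /cumul /Rintegral set_itv1 integral_set1. Qed.

Lemma cumul_le (t : R) : 0 <= t -> cumul t <= t.
Proof. by move=> t0; have := @cumul_le_sub 0 t; rewrite lexx t0 cumul0 => /(_ isT); lra. Qed.

Lemma is_derive_cumul (t : R) : 0 < t -> is_derive t 1 cumul (g t).
Proof.
move=> t0; have tt1 : t < t + 1 by lra.
have [d1 d2] := continuous_FTC1_closed tt1 (integrable_g 0 (t + 1)) t0 (cg t0).
by apply: DeriveDef => //; rewrite -derive1E.
Qed.

Lemma continuous_cumul (t : R) : 0 < t -> {for t, continuous cumul}.
Proof.
move=> t0; have [d1 _] := is_derive_cumul t0.
exact/differentiable_continuous/derivable1_diffP.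
Qed.

Lemma measurable_cumul D : measurable D -> measurable_fun D cumul.
Proof.
move=> mD; apply: nondecreasing_measurable => //; move=> s t st.
have [s0|s0] := leP 0 s; first by apply: cumul_nd; rewrite s0.
apply: le_trans (cumul_ge0 t); rewrite /cumul /Rintegral.
by rewrite set_itv_ge ?integral_set0// bnd_simp -ltNge.
Qed.

Lemma integral_cumul_comp (phi dphi : R -> R) (a b : R) : 0 < a -> a < b ->
  (forall y : R, is_derive y 1 phi (dphi y)) -> continuous dphi ->
  (\int[mu]_(s in `[a, b]) (g s * dphi (cumul s))%:E =
    (phi (cumul b))%:E - (phi (cumul a))%:E)%E.
Proof.
move=> a0 ab dp cp.
apply: (@FTC2_is_derive R (fun s => g s * dphi (cumul s)) (phi \o cumul)) => //.
- move=> x /andP[ax _]; have x0 : 0 < x by exact: lt_le_trans ax.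
  rewrite mulrC; apply: is_derive1_comp; exact: is_derive_cumul.
- move=> x /andP[ax _]; have x0 : 0 < x by exact: lt_le_trans ax.
  apply: continuousM; first exact: cg.
  by apply: continuous_comp; [exact: continuous_cumul|exact: cp].
Qed.

(** The integrand is the derivative of [cumul^(k+1) / (k+1)!]. Asking only for an upper bound lets
    the boundary term near 0 be dropped, so [cumul] need not be studied at 0. *)
Lemma integral_cumul_pow (k : nat) (t : R) : 0 < t ->
  (\int[mu]_(s in `]0%R, t[) (g s * (cumul s ^+ k / k`!%:R))%:E <=
   (cumul t ^+ k.+1 / (k.+1)`!%:R)%:E)%E.
Proof.
move=> t0.
have mh D : measurable D -> measurable_fun D (fun s => (g s * (cumul s ^+ k / k`!%:R))%:E).
  move=> mD; apply/measurable_EFinP; apply: measurable_funM; first exact: measurable_funTS.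
  by apply: measurable_funM => //; apply: measurable_funX; exact: measurable_cumul.
rewrite (@integral_itv_bndo_bndc R (BRight 0%R) t); last exact: mh.
rewrite -bigcup_itv_oc//; apply: ge0_integral_bigcup_le.
- move=> n s; rewrite /= !in_itv/= => /andP[h1 ->].
  rewrite andbT; apply: le_trans h1; rewrite ler_pM2l// lef_pV2 ?posrE//.
  by rewrite ler_nat.
- by move=> n; exact: measurable_itv.
- exact: mh.
- by move=> s _; rewrite lee_fin mulr_ge0// divr_ge0 ?exprn_ge0 ?cumul_ge0.
- move=> n; have tn0 : 0 < t / n.+2%:R by rewrite divr_gt0.
  pose phi (y : R) := y ^+ k.+1 / (k.+1)`!%:R; pose dphi (y : R) := y ^+ k / k`!%:R.
  have dp (y : R) : is_derive y 1 phi (dphi y).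
    rewrite (_ : phi = (k.+1)`!%:R^-1 \*: (id ^+ k.+1)); last first.
      by apply/funext => z; rewrite /phi/= exprfctE mulrC.
    apply: is_derive_eq; rewrite /dphi factS natrM /GRing.scale/= mulr1.
    by field; rewrite pnatr_eq0 -lt0n fact_gt0/= gt_eqF// ltr_pwDl.
  have cp : continuous dphi.
    move=> y; rewrite /dphi; apply: cvgM; last exact: cvg_cst.
    exact: exprn_continuous.
  have tn1 : t / n.+2%:R < t by rewrite ltr_pdivrMr// ltr_pMr// ltr1n.
  apply: (@le_trans _ _ ((phi (cumul t))%:E - (phi (cumul (t / n.+2%:R)))%:E)%E).
    rewrite le_eqVlt; apply/orP; left; apply/eqP.
    exact: (integral_cumul_comp tn0 tn1 dp cp).
  rewrite -EFinB lee_fin lerBlDr lerDl.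
  by rewrite divr_ge0 ?exprn_ge0 ?cumul_ge0.
Qed.

(** Here the integrand is the derivative of [- e^(- cumul)], and the boundary term at infinity is
    dropped. *)
Lemma integral_cumul_exp (t : R) : 0 < t ->
  (\int[mu]_(s in `]t, +oo[) (g s * expR (- cumul s))%:E <= (expR (- cumul t))%:E)%E.
Proof.
move=> t0.
have mh D : measurable D -> measurable_fun D (fun s => (g s * expR (- cumul s))%:E).
  move=> mD; apply/measurable_EFinP; apply: measurable_funM; first exact: measurable_funTS.
  apply: (measurableT_comp (@measurable_expR R)); apply: measurable_funN.
  exact: measurable_cumul.
rewrite integral_itv_obnd_cbnd; last exact: mh.
rewrite itv_bndy_bigcup_BRight; apply: ge0_integral_bigcup_le.
- move=> n s; rewrite /= !in_itv/= => /andP[-> h1]/=.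
  by rewrite (le_trans h1)// lerD2l ler_nat.
- by move=> n; exact: measurable_itv.
- exact: mh.
- by move=> s _; rewrite lee_fin mulr_ge0// expR_ge0.
- case=> [|n].
    by rewrite addr0 set_itv1 integral_set1 lee_fin expR_ge0.
  pose phi (y : R) := - expR (- y); pose dphi (y : R) := expR (- y).
  have dp (y : R) : is_derive y 1 phi (dphi y).
    rewrite (_ : phi = - (expR \o -%R)); last by apply/funext.
    have h : is_derive y 1 (expR \o -%R) (expR (- y) * (-1)) by apply: is_derive1_comp.
    by have := is_deriveN h; rewrite mulrN1 opprK.
  have cp : continuous dphi.
    move=> y; apply: continuous_comp; last exact: continuous_expR.
    exact: continuousN.
  have tn1 : t < t + n.+1%:R by rewrite ltrDl.
  apply: (@le_trans _ _ ((phi (cumul (t + n.+1%:R)))%:E - (phi (cumul t))%:E)%E).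
    rewrite le_eqVlt; apply/orP; left; apply/eqP.
    exact: (integral_cumul_comp t0 tn1 dp cp).
  rewrite -EFinB lee_fin opprK addrC lerBlDr lerDl.
  exact: expR_ge0.
Qed.

Variable B : R.
Hypothesis hB : (\int[mu]_(t in posR) (1 - g t)%:E = B%:E)%E.

Let m1g D : measurable_fun D (fun t => (1 - g t)%:E).
Proof. by apply/measurable_EFinP/measurable_funB => //; exact: measurable_funTS. Qed.

Let g1' t : (0 <= (1 - g t)%:E)%E. Proof. by rewrite lee_fin subr_ge0. Qed.

Lemma integral_compl (t : R) : 0 <= t ->
  (\int[mu]_(s in `]0%R, t]) (1 - g s)%:E = (t - cumul t)%:E)%E.
Proof.
move=> t0; have t00 : 0 <= (0 : R) <= t by rewrite lexx.
have := cumulD t00; rewrite cumul0 add0e => ct.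
have h : (\int[mu]_(s in `]0%R, t]) (1 - g s)%:E + (cumul t)%:E = t%:E)%E.
  rewrite ct -ge0_integralD//; try solve [by move=> x _; rewrite lee_fin
    |exact: m1g|by apply/measurable_EFinP; exact: measurable_funTS].
  rewrite -[t in RHS]subr0 -(integral1_itv t00); apply: eq_integral => s _.
  by rewrite -EFinD subrK.
move: h; case: (\int[mu]_(s in _) _)%E => [r| |]//.
by rewrite -EFinD => -[rt]; congr EFin; lra.
Qed.

Lemma cumul_compl (t : R) : 0 <= t -> t - cumul t <= B.
Proof.
move=> t0; rewrite -lee_fin -hB -integral_compl//.
apply: ge0_subset_integral => //; first exact: m1g.
by move=> x; rewrite posRE/= in_itv/= => /andP[].
Qed.

(** Monotone convergence gives the limit along the integers; monotonicity of [t - cumul t] and the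
    bound [B] extend it to real [t]. *)
Lemma cvg_cumul_compl : t - cumul t @[t --> +oo] --> B.
Proof.
have cv : (\int[mu]_(s in `]0%R, n%:R]) (1 - g s)%:E @[n --> \oo] -->
    \int[mu]_(s in (\bigcup_n `]0%R, n%:R]%classic)) (1 - g s)%:E)%E.
  apply: (@ge0_nondecreasing_set_cvg_integral _ (measurableTypeR R)) => //;
    try solve [by move=> i; exact: measurable_itv|by move=> i; exact: m1g].
  move=> m n mn; rewrite subsetEset => s; rewrite /= !in_itv/= => /andP[-> h1]/=.
  by rewrite (le_trans h1)// ler_nat.
have pU : \bigcup_n `]0%R, n%:R]%classic = posR :> set R.
  apply/seteqP; split => s; first by case=> n _; rewrite posRE/= in_itv/= => /andP[].
  rewrite posRE => s0; exists (Num.truncn s).+1 => //.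
  by rewrite /= in_itv/= s0 ltW// truncnS_gt.
rewrite pU hB in cv.
have {}cv : n%:R - cumul n%:R @[n --> \oo] --> B.
  move: cv; under eq_fun do rewrite integral_compl//.
  by move/fine_cvg.
apply/cvgrPdist_le => e e0.
move/cvgrPdist_le : cv => /(_ e e0)[N _ hN].
near=> t; have tN : N%:R <= t by near: t; exact: nbhs_pinfty_ge.
have t0 : 0 <= t by apply: le_trans tN.
rewrite ger0_norm ?subr_ge0 ?cumul_compl//.
have := hN N (leqnn N); rewrite /= ger0_norm ?subr_ge0 ?cumul_compl// => h.
have : N%:R - cumul N%:R <= t - cumul t by apply: cumul_le_sub; rewrite ler0n.
lra.
Unshelve. all: by end_near. Qed.

End renewal.

(* Jensen's inequality for the Poisson law of mean [x], through the tangent line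
   of [ln] at [1 + x]. *)
Lemma sum_ln_poisson_le (R : realType) (x : R) : 0 <= x ->
  (\sum_(0 <= k <oo) (ln k.+1%:R * (x ^+ k / k`!%:R))%:E <= (expR x * ln (1 + x))%:E)%E.
Proof.
move=> x0.
have x10 : 0 < 1 + x by lra.
pose s (n : nat) : R := \sum_(0 <= k < n) (x ^+ k / k`!%:R).
have snd m n : (m <= n)%N -> s m <= s n.
  move=> mn; rewrite /s (@big_cat_nat _ _ _ m 0 n)//= lerDl sumr_ge0// => i _.
  by rewrite divr_ge0 ?exprn_ge0.
have sle n : s n <= expR x.
  rewrite /expR; have -> : s n = series (exp_coeff x) n by [].
  apply: nondecreasing_cvgn_le; last exact: is_cvg_series_exp_coeff.
  by move=> m p mp; exact: snd.
(* First moment of the Poisson law on partial sums; cancelling [k] against [k!] shifts the index and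
   loses one term, hence an inequality. *)
have s1 n : \sum_(0 <= k < n) (k%:R * (x ^+ k / k`!%:R)) <= x * s n.
  case: n => [|n]; first by rewrite /s !big_geq// mulr0.
  rewrite big_nat_recl// mul0r add0r.
  apply: (@le_trans _ _ (x * s n)); last by rewrite ler_wpM2l// snd.
  rewrite /s mulr_sumr le_eqVlt; apply/orP; left; apply/eqP.
  apply: eq_bigr => i _; rewrite factS natrM exprS; field.
  by rewrite pnatr_eq0 -lt0n fact_gt0/= gt_eqF// ltr_pwDl.
apply: lime_le.
  apply: is_cvg_nneseries => k _ _.
  by rewrite lee_fin mulr_ge0 ?ln_ge0 ?ler1n// divr_ge0// exprn_ge0.
apply: nearW => n; rewrite sumEFin lee_fin.
have lnk k : ln k.+1%:R <= ln (1 + x) + (k%:R - x) / (1 + x).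
  have k0 : 0 < k.+1%:R :> R by [].
  have -> : k.+1%:R = (1 + x) * (k.+1%:R / (1 + x)) :> R.
    by rewrite mulrC divfK// gt_eqF.
  rewrite lnM ?posrE ?divr_gt0// lerD2l.
  have -> : k.+1%:R / (1 + x) = 1 + (k%:R - x) / (1 + x).
    by rewrite -natr1; field; rewrite gt_eqF.
  apply: le_ln1Dx; rewrite ltr_pdivlMr//; have := ler0n R k; lra.
apply: (@le_trans _ _ (\sum_(0 <= k < n) ((ln (1 + x) - x / (1 + x)) * (x ^+ k / k`!%:R)
    + (1 + x)^-1 * (k%:R * (x ^+ k / k`!%:R))))).
  apply: ler_sum => k _.
  have := ler_wpM2r (divr_ge0 (exprn_ge0 k x0) (ler0n R k`!)) (lnk k).
  move/le_trans; apply; rewrite le_eqVlt; apply/orP; left; apply/eqP; ring.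
(* By [s1] the two multiples of [x / (1 + x)] cancel, leaving [ln (1 + x) * s n]. *)
rewrite big_split/= -!mulr_sumr -/(s n).
have ln0 : 0 <= ln (1 + x) by apply: ln_ge0; lra.
have := ler_wpM2l (_ : 0 <= (1 + x)^-1) (s1 n); rewrite invr_ge0 (ltW x10) => /(_ isT) h.
have := ler_wpM2l ln0 (sle n); lra.
Qed.

(** * Weights and their Laplace transform *)

Lemma is_derive_NexpRN (R : realType) (y : R) :
  is_derive y 1 (fun y : R => - expR (- y)) (expR (- y)).
Proof.
have h : is_derive y 1 (expR \o -%R) (expR (- y) * (-1)) by apply: is_derive1_comp.
by have := is_deriveN h; rewrite mulrN1 opprK.
Qed.

Lemma integral_expRN_lt (R : realType) (a : R) : 0 <= a ->
  (\int[lebesgue_measure]_(y in posR) (if y < a then expR (- y) else 0)%:E =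
   (1 - expR (- a))%:E)%E.
Proof.
rewrite le_eqVlt => /predU1P[<-|a0].
  rewrite oppr0 expR0 subrr integral0_eq// => y.
  by rewrite posRE => y0; rewrite ltNge (ltW y0).
transitivity (\int[lebesgue_measure]_(y in `[0%R, a]) (expR (- y))%:E)%E; last first.
  rewrite (_ : 1 - expR (- a) = - expR (- a) - (- expR (- 0))); last first.
    by rewrite oppr0 expR0 opprK addrC.
  rewrite EFinB; apply: (@FTC2_is_derive R (fun y => expR (- y)) (fun y => - expR (- y))) => //.
  - by move=> x _; exact: is_derive_NexpRN.
  - move=> x _; apply: continuous_comp; last exact: continuous_expR.
    exact: continuousN.
rewrite -integral_itv_bndo_bndc; last by meas.
rewrite -integral_itv_obnd_cbnd; last by meas.
rewrite [LHS]integral_mkcond [RHS]integral_mkcond; apply: eq_integral => y _.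
rewrite !patchE !mem_setE/= !in_itv/= andbT.
by case: (ltrP 0 y) => //= y0; case: (ltrP y a).
Qed.

Lemma integral_lt_posR (R : realType) (a : R) : 0 <= a ->
  (\int[lebesgue_measure]_(t in posR) (if t < a then 1 else 0)%:E = a%:E)%E.
Proof.
move=> a0; transitivity (\int[lebesgue_measure]_(t in `]0%R, a]) 1)%E; last first.
  by have := @integral1_itv R 0 a; rewrite lexx a0 subr0 => /(_ isT).
rewrite -integral_itv_bndo_bndc; last by meas.
rewrite [LHS]integral_mkcond [RHS]integral_mkcond; apply: eq_integral => y _.
rewrite !patchE !mem_setE/= !in_itv/= andbT.
by case: (ltrP 0 y) => //= y0; case: (ltrP y a).
Qed.

Section kernel.
Context {R : realType} dZ (Z : measurableType dZ).
Local Notation mu := (@lebesgue_measure R).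
Variables (Q : probability Z R) (f : Z -> R) (alpha c : R).
Hypotheses (mf : measurable_fun setT f) (f0 : forall z, 0 <= f z).
Hypotheses (alpha1 : 1 < alpha) (c0 : 0 < c) (cE : gam (- alpha^-1) = c%:E).

Definition pweight (z : Z) (t : R) : R := (f z / t) `^ alpha.

Lemma pweight_ge0 z t : 0 <= pweight z t. Proof. exact: powR_ge0. Qed.

Lemma measurable_pweight d (T : measurableType d) (h : T -> Z) (k : T -> R) :
  measurable_fun setT h -> measurable_fun setT k ->
  measurable_fun setT (fun x => pweight (h x) (k x)).
Proof.
move=> mh mk; rewrite /pweight.
have mfh : measurable_fun setT (fun x => f (h x)) by exact: measurableT_comp.
by meas.
Qed.

Definition lap (u t : R) : R := (\int[Q]_z expR (- (u * pweight z t)))%R.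

Let mE u t : measurable_fun setT (fun z => expR (- (u * pweight z t))).
Proof. by have mW := @measurable_pweight _ _ id (cst t) (@measurable_id _ _ _) (@measurable_cst _ _ _ _ _ _); meas. Qed.

Lemma integrable_lap (u t : R) : 0 <= u ->
  Q.-integrable setT (EFin \o (fun z => expR (- (u * pweight z t)))).
Proof.
move=> u0; apply: measurable_bounded_integrable => //.
- by apply: (le_lt_trans (probability_le1 Q measurableT)); exact: ltry.
- exists 1; split => // M M1 x _ /=; rewrite ger0_norm ?expR_ge0//.
  by rewrite (le_trans _ (ltW M1))// -expR0 ler_expR oppr_le0 mulr_ge0 ?pweight_ge0.
Qed.

Lemma lapE (u t : R) : 0 <= u ->
  ((lap u t)%:E = \int[Q]_z (expR (- (u * pweight z t)))%:E)%E.
Proof.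
by move=> u0; rewrite /lap /Rintegral fineK//; apply: integrable_fin_num => //; exact: integrable_lap.
Qed.

Lemma lap01 (u t : R) : 0 <= u -> 0 <= lap u t <= 1.
Proof.
move=> u0; rewrite -!lee_fin lapE// integral_ge0/=; last by move=> z _; rewrite lee_fin expR_ge0.
rewrite -(@probability_setT _ _ _ Q) -[leRHS]mul1e -integral_cst//.
apply: ge0_le_integral => //.
- by apply/measurable_EFinP; exact: mE.
- by move=> z _; rewrite lee_fin -expR0 ler_expR oppr_le0 mulr_ge0 ?pweight_ge0.
Qed.

Let mEzt u : measurable_fun setT (fun p : R * Z => (expR (- (u * pweight p.2 p.1)))%:E).
Proof.
have mW := @measurable_pweight _ _ _ _ (@measurable_snd _ _ R Z) (@measurable_fst _ _ R Z).
by meas.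
Qed.

Lemma measurable_lap (u : R) : measurable_fun setT (lap u).
Proof.
rewrite /lap /Rintegral; apply: (measurableT_comp (fine_measurable measurableT)).
by apply: (@measurable_fun_fubini_tonelli_F _ _ _ _ R Q (fun p : R * Z => (expR (- (u * pweight p.2 p.1)))%:E)) => //;
  move=> ?; rewrite lee_fin expR_ge0.
Qed.

Lemma continuous_pweight z (t : R) : 0 < t -> {for t, continuous (pweight z)}.
Proof.
move=> t0; have := f0 z; rewrite le_eqVlt => /predU1P[fz|fz].
  rewrite (_ : pweight z = cst 0); first exact: cst_continuous.
  by apply/funext => s; rewrite /pweight -fz mul0r powR0// gt_eqF// (lt_trans ltr01 alpha1).
rewrite (_ : pweight z = (fun s => s `^ alpha) \o (fun s => f z / s))//.
apply: continuous_comp.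
  by apply: continuousM; [exact: cst_continuous|apply: inv_continuous; rewrite gt_eqF].
apply/differentiable_continuous/derivable1_diffP/derivable_powR.
by rewrite in_itv/= andbT divr_gt0.
Qed.

Lemma continuous_lap (u t : R) : 0 <= u -> 0 < t -> {for t, continuous (lap u)}.
Proof.
move=> u0 t0.
apply: (@continuity_under_integral R _ Z Q (fun t z => expR (- (u * pweight z t)))
  setT measurableT 0 (t + 1) _ _ (cst 1)) => //.
- by move=> x _; exact: integrable_lap.
- apply: aeW => z _ s; rewrite inE/= in_itv/= => /andP[s0 _].
  apply: continuous_comp; last exact: continuous_expR.
  apply: (@continuousN _ R^o); apply: continuousM; first exact: cst_continuous.
  exact: continuous_pweight.
- by apply: finite_measure_integrable_cst.
- move=> s _; apply: aeW => z _; rewrite ger0_norm ?expR_ge0//.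
  by rewrite -expR0 ler_expR oppr_le0 mulr_ge0 ?pweight_ge0.
- by rewrite inE/= in_itv/= t0/=; lra.
Qed.

(** Inverts the decreasing map from [t] to [u W(z,t)], so that a level set in [t] becomes an
    interval of explicit length. When [f z = 0] both sides are false. *)
Lemma pweight_gt (u y t : R) z : 0 < u -> 0 < y -> 0 < t ->
  (y < u * pweight z t) = (t < f z * u `^ alpha^-1 * y `^ (- alpha^-1)).
Proof.
move=> u0 y0 t0; have a0 : 0 < alpha by exact: lt_trans alpha1.
have ai0 : 0 < alpha^-1 by rewrite invr_gt0.
have := f0 z; rewrite le_eqVlt => /predU1P[fz|fz].
  rewrite /pweight -fz !mul0r powR0 ?gt_eqF// mulr0.
  by rewrite !ltNge !ltW.
have yp : 0 < y `^ alpha^-1 by rewrite powR_gt0.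
rewrite powRN ltr_pdivlMr// /pweight.
have e1 : (u * (f z / t) `^ alpha) `^ alpha^-1 = u `^ alpha^-1 * (f z / t).
  rewrite powRM ?powR_ge0 ?ltW// -powRrM divff ?gt_eqF// powRr1//.
  by rewrite divr_ge0// ltW.
have -> : (y < u * (f z / t) `^ alpha) = (y `^ alpha^-1 < u `^ alpha^-1 * (f z / t)).
  rewrite -e1; apply/idP/idP => h.
    by apply: gt0_ltr_powR => //; rewrite nnegrE ?mulr_ge0 ?powR_ge0// ltW.
  rewrite ltNge; apply/negP => h2; move: h; rewrite ltNge => /negP; apply.
  by apply: ge0_ler_powR => //; rewrite ?nnegrE ?mulr_ge0 ?powR_ge0// ltW.
by rewrite mulrA ltr_pdivlMr// [y `^ _ * t]mulrC [u `^ _ * _]mulrC.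
Qed.

(** Layer-cake formula: [1 - e^(-a)] is the integral of [e^(-y)] over [y < a]. After Tonelli the
    level [y] contributes the length [f z * u^(1/alpha) * y^(-1/alpha)], whose integral against
    [e^(-y)] is a Gamma value. *)
Lemma integral_1BexpR_pweight (u : R) z : 0 < u ->
  (\int[mu]_(t in posR) (1 - expR (- (u * pweight z t)))%:E =
   (f z * u `^ alpha^-1 * c)%:E)%E.
Proof.
move=> u0.
pose h (p : R * R) : \bar R := (if p.2 < u * pweight z p.1 then expR (- p.2) else 0)%:E.
have mh : measurable_fun setT h.
  rewrite /h; have mW := @measurable_pweight _ _ _ _ (@measurable_cst _ _ (R * R)%type Z setT z) (@measurable_fst _ _ R R).
  by meas.
have h0 p : (0 <= h p)%E by rewrite /h; case: ifP => // _; rewrite lee_fin expR_ge0.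
have fu0 : 0 <= f z * u `^ alpha^-1 by rewrite mulr_ge0 ?powR_ge0.
transitivity (\int[mu]_(t in posR) \int[mu]_(y in posR) h (t, y))%E.
  apply: eq_integral => t _; rewrite /h/= integral_expRN_lt//.
  by rewrite mulr_ge0 ?pweight_ge0// ltW.
rewrite tonelli_in//.
transitivity (\int[mu]_(y in posR) ((f z * u `^ alpha^-1)%:E * (y `^ (- alpha^-1) * expR (- y))%:E))%E.
  apply: eq_integral => y /[!inE]; rewrite posRE => y0.
  pose tau := f z * u `^ alpha^-1 * y `^ (- alpha^-1).
  have tau0 : 0 <= tau by rewrite mulr_ge0 ?powR_ge0.
  rewrite -EFinM mulrA -/tau EFinM -(integral_lt_posR tau0) muleC -ge0_integralZl_EFin ?expR_ge0//;
    try solve [by meas|by move=> t _; case: ifP].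
  apply: eq_integral => t /[!inE]; rewrite posRE => t0.
  by rewrite /h/= pweight_gt// -/tau; case: ifP => _; rewrite -EFinM ?mulr1 ?mulr0.
rewrite ge0_integralZl_EFin//; try solve [by meas|by move=> t _; rewrite lee_fin mulr_ge0 ?powR_ge0 ?expR_ge0].
by rewrite -/(gam _) cE.
Qed.

Hypothesis f1 : (\int[Q]_z (f z)%:E = 1)%E.

(** The pointwise formula is linear in [f], so by [f1] the total exponent is the same for every
    target. *)
Lemma integral_1Blap (u : R) : 0 < u ->
  (\int[mu]_(t in posR) (1 - lap u t)%:E = (c * u `^ alpha^-1)%:E)%E.
Proof.
move=> u0; have u0' := ltW u0.
transitivity (\int[mu]_(t in posR) \int[Q]_z (1 - expR (- (u * pweight z t)))%:E)%E.
  have e1 : (\int[Q]_z (EFin \o cst (1%R : R)) z = 1)%E.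
    transitivity (\int[Q]_z (cst 1 z))%E; first by [].
    by rewrite integral_cst// mul1e; exact: probability_setT.
  have i1 : Q.-integrable setT (EFin \o cst (1%R : R)).
    exact: finite_measure_integrable_cst.
  apply: eq_integral => t _; rewrite EFinB lapE// -e1 -integralB//.
  exact: integrable_lap.
rewrite (@tonelli_in _ _ _ _ R (@lebesgue_measure R) Q posR setT
  (fun p : R * Z => (1 - expR (- (u * pweight p.2 p.1)))%:E))//.
- transitivity (\int[Q]_z ((u `^ alpha^-1 * c)%:E * (f z)%:E))%E.
    apply: eq_integral => z _; rewrite integral_1BexpR_pweight// -EFinM.
    by congr EFin; ring.
  rewrite ge0_integralZl_EFin//; try solve [exact/measurable_EFinP
    |by move=> z _; rewrite lee_fin|by rewrite mulr_ge0 ?powR_ge0// ltW].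
  by rewrite f1 mule1 mulrC.
- apply/measurable_EFinP; apply: measurable_funB => //.
  by apply/measurable_EFinP; exact: mEzt.
- move=> t z _ _; rewrite lee_fin subr_ge0 -expR0 ler_expR oppr_le0.
  by rewrite mulr_ge0 ?pweight_ge0.
Qed.

End kernel.

(** * The mixing density *)

Section mixing_density.
Local Open Scope ereal_scope.
Context {R : realType}.
Local Notation mu := (@lebesgue_measure R).
Variables (b c : R).
Hypotheses (b0 : (0 < b)%R) (c0 : (0 < c)%R) (cE : gam (- b) = c%:E).

(** A mixture of exponential densities of rate [c y^b], where [y] has density [y^(-b) e^(-y) / c];
    [cE] is the normalization of that Gamma law. *)
Definition mixd (x : R) : R :=
  (\int[mu]_(y in posR) (expR (- y) * expR (- (c * y `^ b * x))))%R.

Let mh : measurable_fun setT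
  (fun p : R * R => (expR (- p.2) * expR (- (c * p.2 `^ b * p.1)))%:E).
Proof. by meas. Qed.

Let cy0 (y : R) : (0 <= c * y `^ b)%R. Proof. by rewrite mulr_ge0 ?powR_ge0// ltW. Qed.

Lemma mixdE (x : R) : (0 < x)%R -> (mixd x)%:E =
  \int[mu]_(y in posR) (expR (- y) * expR (- (c * y `^ b * x)))%:E.
Proof.
move=> x0; rewrite /mixd /Rintegral fineK// ge0_fin_numE; last first.
  by apply: integral_ge0 => y _; rewrite lee_fin mulr_ge0 ?expR_ge0.
apply: (@le_lt_trans _ _ (\int[mu]_(y in posR) (expR (- (1 * y)))%:E)).
  apply: ge0_le_integral => //.
  - by meas.
  - by meas.
  - move=> y _; rewrite lee_fin mul1r ler_piMr ?expR_ge0// -expR0 ler_expR oppr_le0.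
    by rewrite mulr_ge0 ?cy0// ltW.
by rewrite integral_expRN_posR// ltry.
Qed.

Lemma mixd_ge0 (x : R) : (0 <= mixd x)%R.
Proof.
rewrite /mixd /Rintegral fine_ge0//.
by apply: integral_ge0 => y _; rewrite lee_fin mulr_ge0 ?expR_ge0.
Qed.

Lemma measurable_mixd : measurable_fun setT mixd.
Proof.
rewrite /mixd /Rintegral; apply: (measurableT_comp (fine_measurable measurableT)).
apply: (@measurable_integral_in _ _ _ _ R lebesgue_measure setT posR
  (fun p : R * R => (expR (- p.2) * expR (- (c * p.2 `^ b * p.1)))%:E)) => //.
Qed.

Lemma integral_mixd (phi : R -> R) : measurable_fun setT phi ->
  (forall x, 0 < x -> 0 <= phi x)%R ->
  \int[mu]_(x in posR) (phi x * mixd x)%:E =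
  \int[mu]_(y in posR) ((expR (- y))%:E *
    \int[mu]_(x in posR) (phi x * expR (- (c * y `^ b * x)))%:E).
Proof.
move=> mphi phi0.
pose h (p : R * R) : \bar R := (phi p.1 * (expR (- p.2) * expR (- (c * p.2 `^ b * p.1))))%:E.
have mhh : measurable_fun setT h.
  rewrite /h; have mp : measurable_fun setT (fun p : R * R => phi p.1).
    exact: measurableT_comp.
  by meas.
transitivity (\int[mu]_(x in posR) \int[mu]_(y in posR) h (x, y)).
  apply: eq_integral => x /[!inE]; rewrite posRE => x0.
  rewrite EFinM mixdE// -ge0_integralZl_EFin ?phi0//; try solve
    [by meas|by move=> y _; rewrite lee_fin mulr_ge0 ?expR_ge0].
rewrite tonelli_in//; last first.
  by move=> x y; rewrite posRE => x0 _; rewrite lee_fin !mulr_ge0 ?expR_ge0 ?phi0.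
apply: eq_integral => y _.
rewrite -ge0_integralZl_EFin ?expR_ge0//; try solve [by meas
  |by move=> x; rewrite posRE => x0; rewrite lee_fin mulr_ge0 ?expR_ge0 ?phi0].
by apply: eq_integral => x _; rewrite /h/= -EFinM; congr EFin; ring.
Qed.

Lemma mixd_mass : \int[mu]_(x in posR) (mixd x)%:E = 1.
Proof.
transitivity (\int[mu]_(x in posR) (1 * mixd x)%:E).
  by apply: eq_integral => x _; rewrite mul1r.
rewrite (@integral_mixd (cst 1%R))//.
transitivity (\int[mu]_(y in posR) (c^-1%:E * (y `^ (- b) * expR (- y))%:E)).
  apply: eq_integral => y /[!inE]; rewrite posRE => y0.
  have a0 : (0 < c * y `^ b)%R by rewrite mulr_gt0 ?powR_gt0.
  under eq_integral do rewrite mul1r.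
  rewrite integral_expRN_posR// -!EFinM; congr EFin.
  by rewrite invfM powRN; ring.
rewrite ge0_integralZl_EFin//; try solve [by meas
  |by move=> t _; rewrite lee_fin mulr_ge0 ?powR_ge0 ?expR_ge0|by rewrite invr_ge0 ltW].
by rewrite -/(gam _) cE -EFinM mulVf// gt_eqF.
Qed.

(** Rescaling by [a] gives the exact value [gam eta * a^(-(1 + eta))]; [gam_le1] discards the Gamma
    factor. *)
Lemma integral_powR_expRN_le (eta a : R) : (0 <= eta <= 1)%R -> (0 < a)%R ->
  \int[mu]_(x in posR) (x `^ eta * expR (- (a * x)))%:E <= (a `^ (- (1 + eta)))%:E.
Proof.
move=> eta01 a0; have ai0 : (0 < a^-1)%R by rewrite invr_gt0.
rewrite (ge0_integral_scale ai0); [|by meas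
  |by move=> x _; rewrite lee_fin mulr_ge0 ?powR_ge0 ?expR_ge0].
have -> : \int[mu]_(x in posR) ((a^-1 * x) `^ eta * expR (- (a * (a^-1 * x))))%:E =
    (a^-1 `^ eta)%:E * gam eta.
  rewrite /gam -ge0_integralZl_EFin ?powR_ge0//; try solve [by meas
    |by move=> x _; rewrite lee_fin mulr_ge0 ?powR_ge0 ?expR_ge0].
  apply: eq_integral => x /[!inE]; rewrite posRE => x0.
  by rewrite -EFinM mulVKf ?gt_eqF// powRM ?(ltW ai0) ?(ltW x0)// mulrA.
rewrite muleA -EFinM; apply: (@le_trans _ _ ((a^-1 * a^-1 `^ eta)%:E * 1)).
  by apply: lee_wpmul2l; rewrite ?gam_le1// lee_fin mulr_ge0 ?powR_ge0 ?(ltW ai0).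
rewrite mule1 lee_fin le_eqVlt; apply/orP; left; apply/eqP.
rewrite -{1}(powRr1 (ltW ai0)) -powRD ?(gt_eqF ai0) ?implybT//.
by rewrite -[a^-1%R in LHS]powR_inv1 ?(ltW a0)// -powRrM mulN1r.
Qed.

Lemma mixd_moment (eta M : R) : (0 <= eta <= 1)%R ->
  gam (- (b * (1 + eta))) <= (M * c `^ (1 + eta))%:E ->
  \int[mu]_(x in posR) (x `^ eta * mixd x)%:E <= M%:E.
Proof.
move=> eta01 hM; rewrite (@integral_mixd (fun x => x `^ eta)%R); [|by meas|by move=> *; exact: powR_ge0].
apply: (@le_trans _ _ (\int[mu]_(y in posR) ((c `^ (- (1 + eta)))%:E *
    (y `^ (- (b * (1 + eta))) * expR (- y))%:E))).
  apply: ge0_le_integral => //.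
  - move=> y _; rewrite mule_ge0 ?lee_fin ?expR_ge0//.
    by apply: integral_ge0 => x _; rewrite lee_fin mulr_ge0 ?powR_ge0 ?expR_ge0.
  - apply: emeasurable_funM; first by meas.
    apply: (@measurable_integral_in _ _ _ _ R lebesgue_measure posR posR
      (fun p : R * R => (p.2 `^ eta * expR (- (c * p.1 `^ b * p.2)))%:E)) => //.
      by meas.
    by move=> x y _ _; rewrite lee_fin mulr_ge0 ?powR_ge0 ?expR_ge0.
  - by under eq_fun do rewrite -EFinM; meas.
  - move=> y; rewrite posRE => y0.
    have a0 : (0 < c * y `^ b)%R by rewrite mulr_gt0 ?powR_gt0.
    rewrite muleC -EFinM mulrA EFinM lee_pmul2r ?fin_num_lte ?lte_fin ?expR_gt0//.
    have -> : (c `^ (- (1 + eta)) * y `^ (- (b * (1 + eta))) = (c * y `^ b) `^ (- (1 + eta)))%R.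
      by rewrite powRM ?powR_ge0 ?(ltW c0)// -powRrM mulrN.
    exact: integral_powR_expRN_le.
rewrite ge0_integralZl_EFin ?powR_ge0//; try solve [by meas
  |by move=> t _; rewrite lee_fin mulr_ge0 ?powR_ge0 ?expR_ge0].
rewrite -/(gam _); apply: le_trans (lee_pmul _ _ (lexx _) hM) _.
- by rewrite lee_fin powR_ge0.
- exact: gam_ge0.
rewrite -EFinM lee_fin mulrCA -powRD; last by rewrite (gt_eqF c0) implybT.
by rewrite addNr powRr0 mulr1.
Qed.

End mixing_density.

(** Here [x] stands for the density [f z] and [theta] for the mixing variable. Two tangent bounds
    for [ln] are combined, with [ln x] split into its positive and negative parts and negative terms
    moved across, so that both sides can be integrated as nonnegative functions. *)
Lemma ln_mix_bound (R : realType) (x theta eta c1 : R) : 0 < x -> 0 < theta ->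
  0 < eta <= 1 -> 1 < c1 ->
  ln (1 + x * theta) + Num.max (- ln x) 0 + (1 + theta)^-1 <=
  Num.max (ln x) 0 + x^-1 * (1 + theta)^-1 +
    eta^-1 * (ln c1 - 1 + c1^-1 + c1^-1 * theta `^ eta).
Proof.
move=> x0 t0 /andP[e0 e1] c1l; have c10 : 0 < c1 by lra.
have t1 : 0 < 1 + theta by lra.
have xi0 : 0 < x^-1 by rewrite invr_gt0.
have ti0 : 0 < (1 + theta)^-1 by rewrite invr_gt0.
have maxE : Num.max (ln x) 0 - Num.max (- ln x) 0 = ln x.
  by case: (lerP (ln x) 0) => h1; case: (lerP (- ln x) 0) => h2; lra.
(* The ratio of [1 + x theta] to [x (1 + theta)] is [1 + (1/x - 1) / (1 + theta)]. Multiplied by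
   [x = f z], the correction is proportional to [1 - f z], whose [Q]-integral is zero. *)
have l1 : ln (1 + x * theta) <= ln x + ln (1 + theta) + (x^-1 - 1) * (1 + theta)^-1.
  have -> : 1 + x * theta = x * ((1 + theta) * (1 + (x^-1 - 1) * (1 + theta)^-1)).
    by field; rewrite !gt_eqF.
  have p0 : 0 < 1 + (x^-1 - 1) * (1 + theta)^-1.
    rewrite (_ : _ + _ = (x^-1 + theta) / (1 + theta)); last by field; rewrite !gt_eqF.
    by rewrite divr_gt0//; lra.
  rewrite !lnM ?posrE ?mulr_gt0// addrA lerD2l.
  by apply: le_ln1Dx; lra.
have l2 : ln (1 + theta) <= eta^-1 * (ln c1 - 1 + c1^-1 + c1^-1 * theta `^ eta).
  rewrite mulrC ler_pdivlMr// mulrC -ln_powR.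
  have te0 : 0 < theta `^ eta by exact: powR_gt0.
  (* Subadditivity [(1 + theta)^eta <= 1 + theta^eta]: the fractions [1 / (1 + theta)] and
     [theta / (1 + theta)] lie in [[0, 1]], so raising them to [eta <= 1] does not decrease them. *)
  apply: (@le_trans _ _ (ln (1 + theta `^ eta))).
    rewrite ler_ln ?posrE ?powR_gt0//; last by lra.
    have s1 : (1 + theta) `^ eta * (1 + theta)^-1 `^ eta = 1.
      by rewrite -powRM ?(ltW t1) ?(ltW ti0)// divff ?gt_eqF// powR1.
    have h1 : (1 + theta)^-1 <= (1 + theta)^-1 `^ eta.
      by apply: ger1_powR => //; rewrite ti0/= invf_le1//; lra.
    have h2 : theta * (1 + theta)^-1 <= theta `^ eta * (1 + theta)^-1 `^ eta.
      rewrite -powRM ?(ltW t0) ?(ltW ti0)//; apply: ger1_powR => //.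
      by rewrite divr_gt0//= ler_pdivrMr// mul1r; lra.
    have h3 : (1 + theta)^-1 + theta * (1 + theta)^-1 = 1.
      by rewrite -{1}(mul1r (1 + theta)^-1) -mulrDl divff// gt_eqF.
    have sp : 0 <= (1 + theta) `^ eta by exact: powR_ge0.
    have := ler_wpM2l sp (lerD h1 h2); rewrite h3; nra.
  (* Tangent of [ln] at [c1], the bound on the mean of [1 + theta^eta]; this is Jensen's inequality
     written pointwise. *)
  have -> : 1 + theta `^ eta = c1 * (1 + ((1 + theta `^ eta) / c1 - 1)).
    by field; rewrite gt_eqF.
  rewrite lnM ?posrE//; last first.
    by rewrite addrC subrK divr_gt0//; lra.
  rewrite -!addrA lerD2l; apply: le_trans (le_ln1Dx _) _.
    by rewrite ltrBrDr addrC subrr divr_gt0//; lra.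
  rewrite le_eqVlt; apply/orP; left; apply/eqP; ring.
lra.
Qed.

(** * From the kernel integral to the divergence *)

Section analytic_bound.
Local Open Scope ereal_scope.
Context {R : realType} dZ (Z : measurableType dZ).
Local Notation mu := (@lebesgue_measure R).
Variables (Q : probability Z R) (f : Z -> R) (alpha c : R).
Hypotheses (mf : measurable_fun setT f) (f0 : forall z, (0 <= f z)%R).
Hypotheses (alpha1 : (1 < alpha)%R) (c0 : (0 < c)%R) (cE : gam (- alpha^-1) = c%:E).
Hypothesis f1 : \int[Q]_z (f z)%:E = 1.
Local Notation b := (alpha^-1)%R.
Local Notation p := (mixd b c).
Local Notation W := (pweight f alpha).

Let a0 : (0 < alpha)%R. Proof. exact: lt_trans alpha1. Qed.
Let b0 : (0 < b)%R. Proof. by rewrite invr_gt0. Qed.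

(** Substitute [y = u W], then [t = f z * x]. As [W^(-1/alpha) = t / f z], the exponent [c u^b]
    becomes [c y^b x], and integrating over [y] produces [mixd]. *)
Lemma integral_kernel z :
  \int[mu]_(t in posR) \int[mu]_(u in posR)
    (W z t * expR (- (u * W z t)) * expR (- (c * u `^ b)) * ln (1 + t))%:E =
  \int[mu]_(x in posR) ((f z * ln (1 + f z * x)) * p x)%:E.
Proof.
have mp := measurable_mixd b c.
have := f0 z; rewrite le_eqVlt => /predU1P[fz|fz].
  rewrite integral0_eq; last first.
    move=> t _; rewrite integral0_eq// => u _.
    by rewrite /pweight -fz mul0r powR0 ?gt_eqF// !mul0r.
  by rewrite integral0_eq// => x _; rewrite -fz !mul0r.
transitivity (\int[mu]_(t in posR) (ln (1 + t) * p (t / f z))%:E).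
  apply: eq_integral => t /[!inE]; rewrite posRE => t0.
  have W0 : (0 < W z t)%R by rewrite powR_gt0// divr_gt0.
  have Wi0 : (0 < (W z t)^-1)%R by rewrite invr_gt0.
  have ln0 : (0 <= ln (1 + t))%R by apply: ln_ge0; lra.
  rewrite (ge0_integral_scale Wi0); [|by meas|]; last first.
    by move=> u _; rewrite lee_fin !mulr_ge0 ?expR_ge0// ltW.
  rewrite EFinM mixdE//; last by rewrite divr_gt0.
  rewrite -!ge0_integralZl_EFin ?(ltW Wi0)//; try solve [by meas
    |by move=> u _; rewrite lee_fin ?mulr_ge0 ?expR_ge0// ltW].
  apply: eq_integral => y /[!inE]; rewrite posRE => y0.
  rewrite -!EFinM; congr EFin.
  have -> : ((W z t)^-1 * y * W z t = y)%R by rewrite mulrAC mulVf ?mul1r// gt_eqF.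
  have -> : (c * ((W z t)^-1 * y) `^ b = c * y `^ b * (t / f z))%R.
    rewrite powRM ?(ltW Wi0) ?(ltW y0)// -mulrA [(y `^ _ * _)%R]mulrC; congr (_ * (_ * _))%R.
    rewrite /pweight -powRN -powRrM mulNr divff ?gt_eqF//.
    by rewrite powR_inv1 ?invf_div// divr_ge0// ltW.
  by field; rewrite gt_eqF.
rewrite (ge0_integral_scale fz); last 2 first.
- have mp2 : measurable_fun setT (fun t : R => p (t / f z)%R).
    by apply: (measurableT_comp mp); meas.
  by meas.
- move=> t t0; rewrite lee_fin mulr_ge0 ?mixd_ge0//; apply: ln_ge0; lra.
rewrite -ge0_integralZl_EFin ?(ltW fz)//; last 2 first.
- move=> t; rewrite posRE => t0; rewrite lee_fin mulr_ge0 ?mixd_ge0//; apply: ln_ge0.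
  by have := mulr_gt0 fz t0; lra.
- have mp2 : measurable_fun setT (fun t : R => p (f z * t / f z)%R).
    by apply: (measurableT_comp mp); meas.
  by meas.
by apply: eq_integral => x _; rewrite -EFinM mulrA [(f z * x)%R in X in p X]mulrC mulfK ?gt_eqF.
Qed.

Let I (phi : R -> R) := \int[mu]_(x in posR) (phi x * p x)%:E.

Let mp D : measurable_fun D p. Proof. by apply: measurable_funTS; exact: measurable_mixd. Qed.

Let mIp (phi : R -> R) : measurable_fun setT phi ->
  measurable_fun posR (fun x => (phi x * p x)%:E).
Proof.
move=> mphi; apply/measurable_EFinP; apply: measurable_funM; last exact: mp.
exact: measurable_funTS.
Qed.

Let ID (phi psi : R -> R) : measurable_fun setT phi -> measurable_fun setT psi ->
  (forall x, 0 < x -> 0 <= phi x)%R -> (forall x, 0 < x -> 0 <= psi x)%R ->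
  I (fun x => phi x + psi x)%R = I phi + I psi.
Proof.
move=> m1 m2 h1 h2; rewrite /I -ge0_integralD//.
- by apply: eq_integral => x _; rewrite -EFinD mulrDl.
- by move=> x; rewrite posRE => x0; rewrite lee_fin mulr_ge0 ?mixd_ge0 ?h1.
- exact: mIp.
- by move=> x; rewrite posRE => x0; rewrite lee_fin mulr_ge0 ?mixd_ge0 ?h2.
- exact: mIp.
Qed.

Let IZ (k : R) (phi : R -> R) : measurable_fun setT phi -> (0 <= k)%R ->
  (forall x, 0 < x -> 0 <= phi x)%R -> I (fun x => k * phi x)%R = k%:E * I phi.
Proof.
move=> m1 k0 h1; rewrite /I -ge0_integralZl_EFin//.
- by apply: eq_integral => x _; rewrite -EFinM mulrA.
- by move=> x; rewrite posRE => x0; rewrite lee_fin mulr_ge0 ?mixd_ge0 ?h1.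
- exact: mIp.
Qed.

Let I1 (k : R) : (0 <= k)%R -> I (fun=> k) = k%:E.
Proof.
move=> k0; transitivity (k%:E * I (fun=> 1%R)).
  by rewrite -IZ//; apply: eq_integral => x _; rewrite mulr1.
rewrite /I; under eq_integral do rewrite mul1r.
by rewrite (mixd_mass c0 cE) mule1.
Qed.

Variables (eta c1 : R).
Hypotheses (eta0 : (0 < eta <= 1)%R) (c11 : (1 < c1)%R)
  (hM : gam (- (b * (1 + eta))) <= ((c1 - 1) * c `^ (1 + eta))%:E).

Let mJ : measurable_fun setT (fun x : R => (1 + x)^-1)%R. Proof. by meas. Qed.
Let J0 (x : R) : (0 < x -> 0 <= (1 + x)^-1)%R. Proof. by move=> x0; rewrite invr_ge0; lra. Qed.

(** Finiteness matters: [j] appears on both sides of the integrated bound and is cancelled there. *)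
Let IJ : exists2 j : R, (0 <= j)%R & I (fun x => (1 + x)^-1)%R = j%:E.
Proof.
exists (fine (I (fun x => (1 + x)^-1)%R)).
  apply: fine_ge0; apply: integral_ge0 => x; rewrite posRE => x0.
  by rewrite lee_fin mulr_ge0 ?mixd_ge0 ?J0.
rewrite fineK// ge0_fin_numE; last first.
  by apply: integral_ge0 => x; rewrite posRE => x0; rewrite lee_fin mulr_ge0 ?mixd_ge0 ?J0.
apply: (@le_lt_trans _ _ (I (fun=> 1%R))); last by rewrite I1 ?ltry.
apply: ge0_le_integral => //.
- by move=> x; rewrite posRE => x0; rewrite lee_fin mulr_ge0 ?mixd_ge0 ?J0.
- exact: mIp.
- exact: mIp.
- move=> x; rewrite posRE => x0; rewrite lee_fin ler_wpM2r ?mixd_ge0// invf_le1; lra.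
Qed.

Let A z := I (fun x => f z * ln (1 + f z * x))%R.
Let lnp (x : R) := Num.max (ln x) 0%R.
Let lnm (x : R) := Num.max (- ln x)%R 0%R.
Let lnp0 x : (0 <= lnp x)%R. Proof. by rewrite le_max lexx orbT. Qed.
Let lnm0 x : (0 <= lnm x)%R. Proof. by rewrite le_max lexx orbT. Qed.

Let A0 z : 0 <= A z.
Proof.
apply: integral_ge0 => x; rewrite posRE => x0; rewrite lee_fin !mulr_ge0 ?mixd_ge0//.
by apply: ln_ge0; rewrite lerDl mulr_ge0// ltW.
Qed.

(** [ln_mix_bound] times [f z], integrated against [mixd]. The terms [j * f z] and [j] stay separate
    because their [Q]-integrals agree. Where [f z = 0] the claim reduces to [0 <= j]. *)
Let Abound z (j : R) : I (fun x => (1 + x)^-1)%R = j%:E -> (0 <= j)%R ->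
  A z + (f z * lnm (f z))%:E + (j * f z)%:E <=
  (f z * lnp (f z))%:E + j%:E + (eta^-1 * ln c1 * f z)%:E.
Proof.
move=> jE j0; have := f0 z; rewrite le_eqVlt => /predU1P[fz|fz].
  rewrite /A /I integral0_eq; last by move=> x _; rewrite -fz !mul0r.
  by rewrite -fz !mulr0 !mul0r !adde0 add0e lee_fin.
have fn0 := ltW fz.
have c11' := c11; have eta0' := eta0.
have c10 : (0 < c1)%R by lra.
have e0 : (0 <= eta^-1)%R by rewrite invr_ge0; lra.
have k0 : (0 <= ln c1 - 1 + c1^-1)%R.
  have := @le_ln1Dx R (c1^-1 - 1); rewrite addrCA subrr addr0 lnV ?posrE//.
  have ci : (0 < c1^-1)%R by rewrite invr_gt0.
  by move=> h; have := h ltac:(lra); lra.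
have mE : measurable_fun setT (fun x : R => x `^ eta)%R by meas.
have mL : measurable_fun setT (fun x : R => f z * ln (1 + f z * x))%R by meas.
have L0 (x : R) : (0 < x -> 0 <= f z * ln (1 + f z * x))%R.
  by move=> x0; rewrite mulr_ge0//; apply: ln_ge0; rewrite lerDl mulr_ge0// ltW.
have fl0 : (0 <= f z * lnm (f z))%R by rewrite mulr_ge0.
have fp0 : (0 <= f z * lnp (f z))%R by rewrite mulr_ge0.
have lhs : I (fun x => f z * ln (1 + f z * x) + f z * lnm (f z) + f z * (1 + x)^-1)%R =
    A z + (f z * lnm (f z))%:E + (j * f z)%:E.
  rewrite ID; [|by meas|by meas|by move=> x x0; rewrite addr_ge0 ?L0|by move=> x x0; rewrite mulr_ge0 ?J0].
  rewrite ID//.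
  by rewrite [I (fun x => f z / (1 + x))%R]IZ// (I1 fl0) jE -EFinM [(f z * j)%R]mulrC.
have rhs : I (fun x => f z * lnp (f z) + (1 + x)^-1 +
     f z * eta^-1 * (ln c1 - 1 + c1^-1) + f z * eta^-1 * c1^-1 * x `^ eta)%R =
    (f z * lnp (f z))%:E + j%:E + (f z * eta^-1 * (ln c1 - 1 + c1^-1))%:E +
    (f z * eta^-1 * c1^-1)%:E * I (fun x => x `^ eta)%R.
  have ci : (0 <= c1^-1)%R by rewrite invr_ge0 ltW.
  have k1 : (0 <= f z * eta^-1 * (ln c1 - 1 + c1^-1))%R by rewrite !mulr_ge0.
  rewrite ID; [|by meas|by meas|by move=> x x0; rewrite !addr_ge0 ?J0|by move=> x x0; rewrite !mulr_ge0 ?powR_ge0].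
  rewrite ID; [|by meas|by meas|by move=> x x0; rewrite !addr_ge0 ?J0|by move=> x x0].
  rewrite ID; [|by meas|by meas|by move=> x x0|by move=> x x0; rewrite J0].
  by rewrite !I1// jE IZ ?mulr_ge0// => x _; exact: powR_ge0.
rewrite -lhs; apply: (@le_trans _ _ (I (fun x => f z * lnp (f z) + (1 + x)^-1 +
     f z * eta^-1 * (ln c1 - 1 + c1^-1) + f z * eta^-1 * c1^-1 * x `^ eta)%R)).
  apply: ge0_le_integral => //.
  - move=> x; rewrite posRE => x0; rewrite lee_fin mulr_ge0 ?mixd_ge0//.
    by rewrite !addr_ge0 ?L0// mulr_ge0// J0.
  - by apply: mIp; meas.
  - by apply: mIp; meas.
  - move=> x; rewrite posRE => x0; rewrite lee_fin ler_wpM2r ?mixd_ge0//.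
    have h := ler_wpM2l fn0 (ln_mix_bound fz x0 eta0 c11).
    have e : (f z * (f z)^-1 = 1)%R by rewrite divff ?gt_eqF.
    move: h; rewrite /lnm /lnp !mulrDr [(f z * ((f z)^-1 * _))%R]mulrA e mul1r.
    lra.
rewrite rhs -!addeA !leeD2l//.
(* The moment bound [c1 - 1] makes the bracket [ln c1 - 1 + 1/c1 + (c1 - 1)/c1] collapse to
   [ln c1]. *)
apply: (@le_trans _ _ ((f z * eta^-1 * (ln c1 - 1 + c1^-1))%:E +
   (f z * eta^-1 * c1^-1)%:E * (c1 - 1)%:E)).
  rewrite leeD2l//; apply: lee_wpmul2l.
    by rewrite lee_fin !mulr_ge0// invr_ge0 ltW.
  by apply: (mixd_moment c0 _ hM); lra.
rewrite -EFinM -EFinD lee_fin le_eqVlt; apply/orP; left; apply/eqP.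
by field; rewrite !gt_eqF//; lra.
Qed.

Lemma analytic_bound :
  \int[Q]_z (\int[mu]_(t in posR) \int[mu]_(u in posR)
    (W z t * expR (- (u * W z t)) * expR (- (c * u `^ b)) * ln (1 + t))%:E)
  + \int[Q]_z (f z * lnm (f z))%:E <=
  \int[Q]_z (f z * lnp (f z))%:E + (eta^-1 * ln c1)%:E.
Proof.
have [j j0 jE] := IJ.
have c11' := c11; have eta0' := eta0.
under eq_integral do rewrite integral_kernel.
have mA : measurable_fun setT A.
  apply: (@measurable_integral_in _ _ _ _ R lebesgue_measure setT posR
    (fun q : Z * R => ((f q.1 * ln (1 + f q.1 * q.2)) * p q.2)%:E)) => //.
  - have mf1 : measurable_fun setT (fun q : Z * R => f q.1) by exact: measurableT_comp.
    have mp2 : measurable_fun setT (fun q : Z * R => p q.2).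
      by apply: (measurableT_comp (measurable_mixd b c)); exact: measurable_snd.
    by meas.
  - move=> z x _; rewrite posRE => x0; rewrite lee_fin !mulr_ge0 ?mixd_ge0//.
    by apply: ln_ge0; rewrite lerDl mulr_ge0// ltW.
have mm : measurable_fun setT (fun z => (f z * lnm (f z))%:E) by rewrite /lnm; meas.
have mmp : measurable_fun setT (fun z => (f z * lnp (f z))%:E) by rewrite /lnp; meas.
have lnc0 : (0 <= eta^-1 * ln c1)%R.
  by rewrite mulr_ge0 ?invr_ge0 ?ln_ge0//; lra.
have cst (k : R) : (0 <= k)%R -> \int[Q]_z (k * f z)%:E = k%:E.
  move=> k0; under eq_integral do rewrite EFinM.
  rewrite ge0_integralZl_EFin//; try solve [exact/measurable_EFinP|by move=> z _; rewrite lee_fin].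
  by rewrite f1 mule1.
have l1 : \int[Q]_z (A z + (f z * lnm (f z))%:E + (j * f z)%:E) =
   \int[Q]_z A z + \int[Q]_z (f z * lnm (f z))%:E + j%:E.
  rewrite ge0_integralD//; last 4 first.
  - by move=> z _; rewrite adde_ge0 ?A0// lee_fin mulr_ge0.
  - exact: emeasurable_funD.
  - by move=> z _; rewrite lee_fin mulr_ge0.
  - by meas.
  rewrite cst//; congr (_ + _); rewrite ge0_integralD//.
  by move=> z _; rewrite lee_fin mulr_ge0.
have l2 : \int[Q]_z ((f z * lnp (f z))%:E + j%:E + (eta^-1 * ln c1 * f z)%:E) =
   \int[Q]_z (f z * lnp (f z))%:E + j%:E + (eta^-1 * ln c1)%:E.
  rewrite ge0_integralD//; last 4 first.
  - by move=> z _; rewrite adde_ge0// lee_fin mulr_ge0.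
  - exact: emeasurable_funD.
  - by move=> z _; rewrite lee_fin mulr_ge0.
  - by meas.
  rewrite cst//; congr (_ + _); rewrite ge0_integralD//.
  - by rewrite integral_cst// [X in _ * X](@probability_setT _ _ _ Q) mule1.
  - by move=> z _; rewrite lee_fin mulr_ge0.
(* Adding the finite [j] on both sides reduces the claim to the pointwise [Abound]. *)
rewrite -(@leeD2rE _ j%:E)// -l1 addeAC -l2.
apply: ge0_le_integral => //.
- move=> z _; apply: adde_ge0; last by rewrite lee_fin mulr_ge0.
  by apply: adde_ge0; [exact: A0|rewrite lee_fin mulr_ge0].
- by apply: emeasurable_funD; [exact: emeasurable_funD|meas].
- by apply: emeasurable_funD; [exact: emeasurable_funD|meas].
- by move=> z _; exact: Abound.
Qed.

End analytic_bound.

(** * Densities, freezing and Poisson arrivals *)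

Lemma ge0_integral_density d (T : measurableType d) (R : realType)
    (nu : {finite_measure set T -> \bar R}) (mu : {sigma_finite_measure set T -> \bar R})
    (g : T -> R) (k : T -> \bar R) :
  measurable_fun setT g -> (forall x, 0 <= g x) ->
  (forall A, measurable A -> nu A = \int[mu]_(x in A) (g x)%:E)%E ->
  measurable_fun setT k -> (forall x, 0 <= k x)%E ->
  (\int[nu]_x k x = \int[mu]_x (k x * (g x)%:E))%E.
Proof.
move=> mg g0 nuE mk k0.
have nm : nu `<< mu.
  apply/null_content_dominatesP => A mA A0; rewrite nuE//.
  apply: null_set_integral => //.
  by apply/measurable_EFinP; exact: measurable_funTS.
rewrite -(Radon_Nikodym_SigmaFinite.change_of_variables nm k0)//.
have mRN := Radon_Nikodym_SigmaFinite.f_integrable nm.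
apply: ae_eq_integral => //.
- by apply: emeasurable_funM => //; exact: measurable_int mRN.
- by apply: emeasurable_funM => //; exact/measurable_EFinP.
apply: ae_eqe_mul2l; apply: integral_ae_eq => //.
- exact/measurable_EFinP.
- by move=> A _ mA; rewrite -Radon_Nikodym_SigmaFinite.f_integral// nuE.
Qed.

Lemma ge0_integral_exponential (R : realType) (k : R -> \bar R) :
  measurable_fun setT k -> (forall x, 0 <= k x)%E ->
  (\int[exponential_prob (1 : R)]_x k x =
   \int[lebesgue_measure]_(x in posR) ((expR (- x))%:E * k x))%E.
Proof.
move=> mk k0.
have p10 (x : R) : 0 <= exponential_pdf 1 x by exact: exponential_pdf_ge0.
rewrite (@ge0_integral_density _ _ R (exponential_prob (1 : R)) lebesgue_measure (exponential_pdf 1))//; last first.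
  exact: measurable_exponential_pdf.
rewrite /posR integral_itv_obnd_cbnd; last first.
  by apply: emeasurable_funM; [meas|exact: measurable_funTS].
rewrite [RHS]integral_mkcond; apply: eq_integral => x _.
rewrite /exponential_pdf !patchE; case: ifPn => _; rewrite ?mule0//.
by rewrite mulN1r mul1r muleC.
Qed.

Lemma eq_finite_measure_rect d1 d2 (T1 : measurableType d1) (T2 : measurableType d2)
    (R : realType) (m1 m2 : {measure set (T1 * T2) -> \bar R}) :
  (m1 setT < +oo)%E ->
  (forall A B, measurable A -> measurable B -> m1 (A `*` B) = m2 (A `*` B)) ->
  forall D, measurable D -> m1 D = m2 D.
Proof.
move=> m1oo m12 D mD.
pose C : set (set (T1 * T2)) :=
  [set C | exists A, measurable A /\ exists B, measurable B /\ C = A `*` B].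
apply: (measure_unique C (fun=> setT)) => //.
- rewrite measurable_prod_measurableType //; congr (<<s _ >>).
  rewrite predeqE; split => [[A mA [B mB <-]]|[A [mA [B [mB ->]]]]].
    by exists A; split => //; exists B.
  by exists A => //; exists B.
- move=> _ _ [X1 [mX1 [X2 [mX2 ->]]]] [Y1 [mY1 [Y2 [mY2 ->]]]].
  rewrite -setXI; exists (X1 `&` Y1); split; first exact: measurableI.
  by exists (X2 `&` Y2); split => //; exact: measurableI.
- by move=> i; exists setT; split => //; exists setT; split => //; rewrite setXTT.
- by rewrite bigcup_const.
- by move=> A [A1 [mA1 [A2 [mA2 ->]]]]; exact: m12.
Qed.

(** * Integrating out a variable independent of a pi-system *)

Section freezing.
Local Open Scope ereal_scope.
Context d dT (Omega : measurableType d) (T : measurableType dT) (R : realType).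
Variables (Pr : probability Omega R) (nu : probability T R) (G : set (set Omega)).
Hypotheses (GI : setI_closed G) (GT : G setT) (Gm : G `<=` measurable).
Variable V : Omega -> T.
Hypotheses (mV : measurable_fun setT V)
  (indep : forall A B, G A -> measurable B -> Pr (A `&` V @^-1` B) = Pr A * nu B).
Local Notation Og := (g_sigma_algebraType G).

Let sGm (A : set Omega) : <<s G >> A -> measurable A.
Proof. by apply: smallest_sub => //; exact: sigma_algebra_measurable. Qed.

Lemma measurable_fun_sub d' (U : measurableType d') (h : Omega -> U) :
  measurable_fun (T := Og) setT h -> measurable_fun setT h.
Proof. by move=> mh _ Y mY; apply: sGm; exact: mh. Qed.

Let mid : measurable_fun setT (id : Omega -> Og).
Proof. by move=> _ Y mY; rewrite setTI; exact: sGm. Qed.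

Let indep_sub A B : <<s G >> A -> measurable B ->
  Pr (A `&` V @^-1` B) = Pr A * nu B.
Proof.
move=> sA mB.
have mVB : measurable (V @^-1` B) by rewrite -[X in measurable X]setTI; exact: mV.
have nuB0 : (0 <= fine (nu B))%R by exact: fine_ge0.
have nuBE : (fine (nu B))%:E = nu B by rewrite fineK// fin_num_measure.
rewrite muleC -nuBE.
apply: (@g_sigma_algebra_measure_unique _ R Omega G Gm (fun=> setT) (fun=> GT) _
  (mrestr Pr mVB) (mscale (NngNum nuB0) Pr) GI) => //.
- by rewrite bigcup_const.
- move=> C GC; change (Pr (C `&` V @^-1` B) = (fine (nu B))%:E * Pr C).
  by rewrite indep// nuBE muleC.
- move=> _; change (Pr (setT `&` V @^-1` B) < +oo).
  by rewrite setTI (le_lt_trans (probability_le1 Pr mVB))// ltry.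
Qed.

Let pairV (w : Omega) : Og * T := (w, V w).

Let mpairV : measurable_fun setT pairV.
Proof. by apply: measurable_fun_pair; [exact: mid|exact: mV]. Qed.

(** Under independence [(w, V w)] is distributed as the product of [Pr] and [nu]. The past is
    encoded as the identity of [Omega] into the coarser sigma-algebra [Og], so [h] may depend on [w]
    in any way measurable for it. *)
Lemma integral_freeze (h : Og * T -> \bar R) : measurable_fun setT h ->
  (forall x, 0 <= h x) ->
  \int[Pr]_w h (w, V w) = \int[Pr]_w \int[nu]_v h (w, v).
Proof.
move=> mh h0.
pose X : {mfun Omega >-> Og} := mfun_Sub (mem_set mid).
pose P' := distribution Pr X.
transitivity (\int[pushforward Pr pairV]_x h x).
  by rewrite ge0_integral_pushforward.
transitivity (\int[P' \x nu]_x h x).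
  apply: eq_measure_integral => //= D mD _; apply/esym.
  apply: product_measure_unique => // A B mA mB.
rewrite fubini_tonelli1// ge0_integral_pushforward//.
- exact: measurable_fun_fubini_tonelli_F.
- by move=> w _; apply: integral_ge0.
Qed.

End freezing.

Definition expo1 (R : realType) : probability (measurableTypeR R) R.
Proof. by unshelve refine (exponential_prob (1 : R) : probability _ _). Defined.

(** * Sequential exploration of the i.i.d. inputs *)

Section poisson_inputs.
Local Open Scope ereal_scope.
Context d dZ (Omega : measurableType d) (Z : measurableType dZ) (R : realType).
Local Notation mu := (@lebesgue_measure R).
Variables (Pr : probability Omega R) (Q : probability Z R).
Variables (Zs : nat -> Omega -> Z) (E : nat -> Omega -> R).
Hypothesis iid : iid_ppr_inputs Pr Q Zs E.

Let mZs i : measurable_fun setT (Zs i). Proof. by case: iid. Qed.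
Let mEs i : measurable_fun setT (E i). Proof. by case: iid => _ []. Qed.

(* A pi-system generating the sigma-algebra of the first [n] inputs. *)
Definition past (n : nat) : set (set Omega) :=
  [set S | exists A : nat -> set Z, exists B : nat -> set R,
    [/\ forall i, measurable (A i), forall i, measurable (B i) &
     S = \bigcap_(i in `I_n) (Zs i @^-1` A i `&` E i @^-1` B i)]].
Local Notation Opast n := (g_sigma_algebraType (past n)).

Lemma past_setI n : setI_closed (past n).
Proof.
move=> _ _ [A [B [mA mB ->]]] [A' [B' [mA' mB' ->]]].
exists (fun i => A i `&` A' i), (fun i => B i `&` B' i); split.
- by move=> i; exact: measurableI.
- by move=> i; exact: measurableI.
- apply/seteqP; split => w.
    by move=> [h h'] i ni; have [h1 h2] := h i ni; have [h3 h4] := h' i ni.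
  by move=> h; split => i ni; have [[h1 h2] [h3 h4]] := h i ni.
Qed.

Lemma past_setT n : past n setT.
Proof.
by exists (fun=> setT), (fun=> setT); split => //; apply/seteqP; split.
Qed.

Lemma past_measurable n : past n `<=` measurable.
Proof.
move=> _ [A [B [mA mB ->]]]; apply: bigcap_measurableType => i _.
apply: measurableI.
- by rewrite -[X in measurable X]setTI; exact: mZs.
- by rewrite -[X in measurable X]setTI; exact: mEs.
Qed.

Let V n (w : Omega) : Z * measurableTypeR R := (Zs n w, E n w).

Let mV n : measurable_fun setT (V n).
Proof. by apply: measurable_fun_pair; [exact: mZs|exact: mEs]. Qed.

Let past_rect n S (C : set Z) (D : set R) : past n S -> measurable C -> measurable D ->
  Pr (S `&` (Zs n @^-1` C `&` E n @^-1` D)) = Pr S * (Q C * exponential_prob 1 D).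
Proof.
move=> [A [B [mA mB ->]]] mC mD.
pose A' i := if i == n then C else A i; pose B' i := if i == n then D else B i.
have [_ [_ pr]] := iid.
have -> : \bigcap_(i in `I_n) (Zs i @^-1` A i `&` E i @^-1` B i) `&`
    (Zs n @^-1` C `&` E n @^-1` D) =
    \bigcap_(i in `I_n.+1) (Zs i @^-1` A' i `&` E i @^-1` B' i).
  apply/seteqP; split => w.
    move=> [h h'] i /=; rewrite ltnS leq_eqVlt /A' /B' => /predU1P[->|ni].
      by rewrite eqxx.
    by rewrite (ltn_eqF ni); exact: h.
  move=> h; split.
    move=> i ni; have := h i; rewrite /A' /B' (ltn_eqF ni); apply.
    by rewrite /= ltnS ltnW.
  by have := h n; rewrite /A' /B' eqxx; apply; rewrite /= ltnS.
rewrite !pr//.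
- rewrite big_ord_recr/= /A' /B' eqxx; congr (_ * _).
  by apply: eq_bigr => i _; rewrite (ltn_eqF (ltn_ord i)).
- by move=> i; rewrite /A'; case: ifP.
- by move=> i; rewrite /B'; case: ifP.
Qed.

Let past_indep n S D : past n S -> measurable D ->
  Pr (S `&` V n @^-1` D) = Pr S * (Q \x expo1 R) D.
Proof.
move=> pS mD; have mS := past_measurable pS.
have PS0 : (0 <= fine (Pr S))%R by exact: fine_ge0.
have PSE : (fine (Pr S))%:E = Pr S by rewrite fineK// fin_num_measure.
rewrite -PSE setIC.
apply: (@eq_finite_measure_rect _ _ Z (measurableTypeR R) R
  (pushforward (mrestr Pr mS) (V n)) (mscale (NngNum PS0) (Q \x expo1 R))) => //.
- change (Pr (V n @^-1` setT `&` S) < +oo).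
  by rewrite preimage_setT setTI (le_lt_trans (probability_le1 Pr mS))// ltry.
- move=> A B mA mB.
  change (Pr (V n @^-1` (A `*` B) `&` S) = (fine (Pr S))%:E * (Q \x expo1 R) (A `*` B)).
  rewrite product_measure1E// PSE setIC.
  exact: past_rect.
Qed.

Lemma measurable_past_Zs n i : (i < n)%N -> measurable_fun (T := Opast n) setT (Zs i).
Proof.
move=> ni _ Y mY; rewrite setTI; apply: sub_sigma_algebra.
exists (fun j => if j == i then Y else setT), (fun=> setT); split => //.
- by move=> j; case: ifP.
- apply/seteqP; split => w.
    by move=> h j _; split => //; case: ifPn => // /eqP ->.
  by move=> /(_ i ni)[]; rewrite eqxx.
Qed.

Lemma measurable_past_E n i : (i < n)%N -> measurable_fun (T := Opast n) setT (E i).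
Proof.
move=> ni _ Y mY; rewrite setTI; apply: sub_sigma_algebra.
exists (fun=> setT), (fun j => if j == i then Y else setT); split => //.
- by move=> j; case: ifP.
- apply/seteqP; split => w.
    by move=> h j _; split => //; case: ifPn => // /eqP ->.
  by move=> /(_ i ni)[_]; rewrite eqxx.
Qed.

Lemma measurable_past_sum n k (h : nat -> Omega -> R) : (k <= n)%N ->
  (forall i, (i < k)%N -> measurable_fun (T := Opast n) setT (h i)) ->
  measurable_fun (T := Opast n) setT (fun w => \sum_(i < k) h i w)%R.
Proof.
elim: k => [|k ih] kn mh.
  by under eq_fun do rewrite big_ord0; exact: measurable_cst.
under eq_fun do rewrite big_ord_recr/=.
apply: measurable_funD; last exact: mh.
by apply: ih; [exact: ltnW|move=> i ik; apply: mh; exact: ltnW].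
Qed.

Lemma measurable_past_arrival n i : (i < n)%N ->
  measurable_fun (T := Opast n) setT (arrival E i).
Proof.
move=> ni; apply: measurable_past_sum => // j ji.
by apply: measurable_past_E; exact: leq_trans ji _.
Qed.

Lemma measurable_arrival i : measurable_fun setT (arrival E i).
Proof. by apply: measurable_sum => j; exact: mEs. Qed.

(** One exploration step: [past n] involves the indices below [n], so the pair of index [n] is
    independent of it and is integrated out against its law, with the past-measurable [Phi] and
    [tau] frozen. *)
Lemma integral_peel n (Phi : Omega -> \bar R) (tau : Omega -> R) (H : Z * R -> \bar R) :
  measurable_fun (T := Opast n) setT Phi -> (forall w, 0 <= Phi w) ->
  measurable_fun (T := Opast n) setT tau ->
  measurable_fun setT H -> (forall x, 0 <= H x) ->
  \int[Pr]_w (Phi w * H (Zs n w, (tau w + E n w)%R)) =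
  \int[Pr]_w (Phi w * \int[mu]_(r in posR) ((expR (- r))%:E *
     \int[Q]_z H (z, (tau w + r)%R))).
Proof.
move=> mPhi Phi0 mtau mH H0.
pose h (x : Opast n * (Z * measurableTypeR R)) : \bar R :=
  Phi x.1 * H (x.2.1, (tau x.1 + x.2.2)%R).
have mh : measurable_fun setT h.
  apply: emeasurable_funM.
    by apply: (measurableT_comp mPhi); exact: measurable_fst.
  apply: (measurableT_comp mH); apply: measurable_fun_pair.
    apply: (measurableT_comp (@measurable_fst _ _ Z (measurableTypeR R))).
    exact: measurable_snd.
  apply: measurable_funD.
    by apply: (measurableT_comp mtau); exact: measurable_fst.
  apply: (measurableT_comp (@measurable_snd _ _ Z (measurableTypeR R))).
  exact: measurable_snd.
have h0 x : 0 <= h x by rewrite mule_ge0.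
have := @integral_freeze _ _ _ _ R Pr (Q \x expo1 R) (past n) (@past_setI n)
  (past_setT n) (@past_measurable n) (V n) (mV n) (@past_indep n) h mh h0.
rewrite /h/= => ->; apply: eq_integral => w _.
have mHw : measurable_fun setT (fun v : Z * measurableTypeR R => H (v.1, (tau w + v.2)%R)).
  apply: (measurableT_comp mH); apply: measurable_fun_pair; first exact: measurable_fst.
  by apply: measurable_funD => //; exact: measurable_snd.
rewrite ge0_integralZl//; congr (_ * _).
rewrite fubini_tonelli2//.
apply: ge0_integral_exponential.
- exact: (measurable_fun_fubini_tonelli_G (fun v : Z * measurableTypeR R => H (v.1, (tau w + v.2)%R))).
- by move=> r; apply: integral_ge0.
Qed.

Lemma integral_peel_arrival n (Phi : Omega -> \bar R) (H : Z * R -> \bar R) :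
  measurable_fun (T := Opast n.+1) setT Phi -> (forall w, 0 <= Phi w) ->
  measurable_fun setT H -> (forall x, 0 <= H x) ->
  \int[Pr]_w (Phi w * H (Zs n.+1 w, arrival E n.+1 w)) =
  \int[Pr]_w (Phi w * \int[mu]_(r in posR) ((expR (- r))%:E *
     \int[Q]_z H (z, (arrival E n w + r)%R))).
Proof.
move=> mPhi Phi0 mH H0; rewrite -(@integral_peel n.+1 Phi (arrival E n) H)//; last first.
  exact: measurable_past_arrival.
by apply: eq_integral => w _; rewrite /arrival big_ord_recr.
Qed.

Lemma integral_peel0 (H : Z * R -> \bar R) :
  measurable_fun setT H -> (forall x, 0 <= H x) ->
  \int[Pr]_w (H (Zs 0 w, arrival E 0 w)) =
  \int[mu]_(r in posR) ((expR (- r))%:E * \int[Q]_z H (z, r)).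
Proof.
move=> mH H0.
transitivity (\int[Pr]_w (1 * H (Zs 0 w, (0 + E 0%N w)%R))).
  by apply: eq_integral => w _; rewrite mul1e add0r /arrival big_ord1.
rewrite (@integral_peel 0 (fun=> 1) (fun=> 0%R))//.
under eq_integral do rewrite mul1e.
rewrite integral_cst// [X in _ * X](@probability_setT _ _ _ Pr) mule1.
by apply: eq_integral => r _; rewrite add0r.
Qed.

(** [arrival E n] is a sum of [n + 1] unit exponentials, so the mean of [e^(- arrival)] is
    [2^(-(n+1))]. These means are summable, hence almost surely the series of [e^(- arrival)]
    converges and its terms tend to 0. *)
Lemma arrival_cvgy : {ae Pr, forall w, arrival E n w @[n --> \oo] --> +oo%R}.
Proof.
have mexp n : measurable_fun setT (fun w => (expR (- arrival E n w))%:E).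
  by have := measurable_arrival n => ma; meas.
have int2 : \int[mu]_(r in posR) (expR (- (2 * r)))%:E = (2^-1)%:E.
  exact: integral_expRN_posR.
have Qc (k : R) : \int[Q]_z k%:E = k%:E.
  transitivity (\int[Q]_z (cst k%:E z)) => //.
  by rewrite integral_cst// [X in _ * X](@probability_setT _ _ _ Q) mule1.
have E2 n : \int[Pr]_w (expR (- arrival E n w))%:E = (1 / (2 ^ n.+1)%:R)%:E.
  elim: n => [|n ih].
    rewrite (@integral_peel0 (fun x => (expR (- x.2))%:E))//;
      try solve [by meas|by move=> x; rewrite lee_fin expR_ge0].
    rewrite expn1 div1r -int2; apply: eq_integral => r _.
    rewrite [\int[Q]_z _](Qc (expR (- r))) -EFinM -expRD.
    by congr (expR _)%:E; lra.
  transitivity (\int[Pr]_w (1 * (fun x : Z * R => (expR (- x.2))%:E) (Zs n.+1 w, arrival E n.+1 w))).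
    by apply: eq_integral => w _; rewrite mul1e.
  rewrite (@integral_peel_arrival n (fun=> 1) (fun x => (expR (- x.2))%:E))//; try solve [by meas|by move=> x; rewrite lee_fin expR_ge0].
  transitivity (\int[Pr]_w ((2^-1)%:E * (expR (- arrival E n w))%:E)).
    apply: eq_integral => w _; rewrite mul1e -int2 muleC -ge0_integralZl_EFin ?expR_ge0//;
      try solve [by meas|by move=> r _; rewrite lee_fin expR_ge0].
    apply: eq_integral => r _ /=.
    rewrite [\int[Q]_z _](Qc (expR (- (arrival E n w + r)))) -!EFinM -!expRD.
    by congr (expR _)%:E; lra.
  rewrite ge0_integralZl_EFin//; try solve [by move=> w _; rewrite lee_fin expR_ge0].
  by rewrite ih -EFinM [(2 ^ n.+2)%N]expnS natrM !div1r invfM.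
have fin : \int[Pr]_w (\sum_(0 <= n <oo) (expR (- arrival E n w))%:E) < +oo.
  rewrite integral_nneseries//; try solve [by move=> n w _; rewrite lee_fin expR_ge0].
  under eq_eseriesr do rewrite E2.
  by apply: (le_lt_trans (epsilon_trick0 xpredT ler01)); exact: ltry.
have ints : Pr.-integrable setT (fun w => \sum_(0 <= n <oo) (expR (- arrival E n w))%:E).
  apply/integrableP; split.
    by apply: ge0_emeasurable_sum => // n w _ _; rewrite lee_fin expR_ge0.
  under eq_integral do rewrite gee0_abs ?nneseries_ge0// => //.
  exact: fin.
have := integrable_ae measurableT ints.
apply: filterS => w /(_ Logic.I) wfin.
have e0 n : 0 <= (expR (- arrival E n w))%:E by rewrite lee_fin expR_ge0.
have tail := @nneseries_tail_cvg R (fun n => (expR (- arrival E n w))%:E) xpredT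
  ltac:(by rewrite -ge0_fin_numE// nneseries_ge0) (fun k _ => e0 k).
have c0 : (expR (- arrival E n w))%:E @[n --> \oo] --> 0%:E.
  apply: (squeeze_cvge _ (cvg_cst 0) tail); apply: nearW => n; rewrite e0/=.
  apply: le_trans (@nneseries_lim_ge R (fun n => (expR (- arrival E n w))%:E) xpredT n n.+1 _) => //.
  by rewrite big_nat1.
have c1 : (expR (- arrival E n w) @[n --> \oo] --> 0)%R by exact: (fine_cvg c0).
apply/cvgryPgt => M; near=> n; rewrite -ltrN2 -ltr_expR; near: n.
by move/cvgr_lt : c1; apply; exact: expR_gt0.
Unshelve. all: by end_near. Qed.

End poisson_inputs.

(** * One-point estimates *)

Section weighted_points.
Local Open Scope ereal_scope.
Context d dZ (Omega : measurableType d) (Z : measurableType dZ) (R : realType).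
Local Notation mu := (@lebesgue_measure R).
Variables (Pr : probability Omega R) (Q : probability Z R).
Variables (Zs : nat -> Omega -> Z) (E : nat -> Omega -> R).
Hypothesis iid : iid_ppr_inputs Pr Q Zs E.
Variables (f : Z -> R) (alpha c : R).
Hypotheses (mf : measurable_fun setT f) (f0 : forall z, (0 <= f z)%R).
Hypotheses (alpha1 : (1 < alpha)%R) (c0 : (0 < c)%R) (cE : gam (- alpha^-1) = c%:E).
Hypothesis f1 : \int[Q]_z (f z)%:E = 1.
Local Notation W := (pweight f alpha).
Local Notation Opast n := (g_sigma_algebraType (past Zs E n)).

Definition wt (k : nat) (w : Omega) : R := W (Zs k w) (arrival E k w).
Definition wtsum (n : nat) (w : Omega) : R := (\sum_(i < n) wt i w)%R.

Lemma wt_ge0 k w : (0 <= wt k w)%R. Proof. exact: pweight_ge0. Qed.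

Lemma measurable_past_wt n k : (k < n)%N -> measurable_fun (T := Opast n) setT (wt k).
Proof.
move=> kn; apply: (@measurable_pweight R _ Z f alpha mf _ (Opast n)).
- exact: measurable_past_Zs.
- exact: measurable_past_arrival.
Qed.

Lemma measurable_past_wtsum n : measurable_fun (T := Opast n) setT (wtsum n).
Proof. by apply: measurable_past_sum => // i ni; exact: measurable_past_wt. Qed.

Lemma measurable_wt k : measurable_fun setT (wt k).
Proof.
apply: (@measurable_pweight R _ Z f alpha mf); first by case: iid.
exact: (measurable_arrival iid).
Qed.

Lemma measurable_wtsum n : measurable_fun setT (wtsum n).
Proof. by apply: measurable_sum => i; exact: measurable_wt. Qed.

Variable u : R.
Hypothesis u0 : (0 < u)%R.
Local Notation g := (lap Q f alpha u).
Local Notation Gam := (cumul g).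
Local Notation B := (c * u `^ alpha^-1)%R.

Let u0' : (0 <= u)%R. Proof. exact: ltW. Qed.
Let mg : measurable_fun setT g. Proof. exact: measurable_lap. Qed.
Let g01 t : (0 <= g t <= 1)%R. Proof. exact: lap01. Qed.
Let g0 t : (0 <= g t)%R. Proof. by have /andP[] := g01 t. Qed.
Let g1 t : (g t <= 1)%R. Proof. by have /andP[] := g01 t. Qed.
Let cg (t : R) : (0 < t)%R -> {for t, continuous g}.
Proof. by move=> t0; exact: continuous_lap. Qed.
Let hB : \int[mu]_(t in posR) (1 - g t)%:E = B%:E.
Proof. exact: integral_1Blap. Qed.
Let mGam D : measurable D -> measurable_fun D Gam.
Proof. exact: measurable_cumul. Qed.
Let Gam0 t : (0 <= Gam t)%R. Proof. exact: cumul_ge0. Qed.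

Let mW2 : measurable_fun setT (fun x : Z * R => W x.1 x.2).
Proof. exact: (@measurable_pweight R _ Z f alpha mf _ _ _ _ (@measurable_fst _ _ Z R) (@measurable_snd _ _ Z R)). Qed.

Let mW1 t : measurable_fun setT (fun z => expR (- (u * W z t))).
Proof.
have mW := @measurable_pweight R _ Z f alpha mf _ _ id (cst t) (@measurable_id _ _ _) (@measurable_cst _ _ _ _ _ _).
by meas.
Qed.

Section one_point.
Variable H : Z * R -> \bar R.
Hypotheses (mH : measurable_fun setT H) (H0 : forall x, 0 <= H x).
Let Hbar (t : R) := \int[Q]_z H (z, t).
Let Hbar0 t : 0 <= Hbar t. Proof. exact: integral_ge0. Qed.
Let mHbar : measurable_fun setT Hbar.
Proof. exact: (measurable_fun_fubini_tonelli_G H). Qed.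
(** Mean of [H] at the next point when the current arrival time is [s]. *)
Let K (s : R) := \int[mu]_(r in posR) ((expR (- r))%:E * Hbar (s + r)%R).

Let eHbar0 (r s : R) : 0 <= (expR (- r))%:E * Hbar s.
Proof. by rewrite mule_ge0// lee_fin expR_ge0. Qed.

Let meHbar D : measurable_fun D (fun t : R => (expR (- t))%:E * Hbar t).
Proof. by apply: measurable_funTS; apply: emeasurable_funM => //; meas. Qed.

Lemma shift_measurable : measurable_fun setT K.
Proof.
apply: (@measurable_integral_in _ _ _ _ R lebesgue_measure setT posR
  (fun p : R * R => (expR (- p.2))%:E * Hbar (p.1 + p.2)%R)) => //.
apply: emeasurable_funM; first by meas.
by apply: (measurableT_comp mHbar); meas.
Qed.

Lemma shift_ge0 s : 0 <= K s.
Proof. by apply: integral_ge0 => r _; exact: eHbar0. Qed.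

Lemma shift_tail s : (expR (- s))%:E * K s =
  \int[mu]_(t in `]s, +oo[) ((expR (- t))%:E * Hbar t).
Proof.
rewrite ge0_integral_shift//.
rewrite -ge0_integralZl_EFin ?expR_ge0//; last first.
  apply: emeasurable_funM; first by meas.
  have ms : measurable_fun setT (fun r : R => s + r)%R by meas.
  exact: (measurable_funTS (measurableT_comp mHbar ms)).
by apply: eq_integral => r _; rewrite muleA -EFinM -expRD opprD.
Qed.

(** After Tonelli over [s < t], the inner integral is [integral_cumul_pow]: one more ordered point
    raises the power of [Gam] and the factorial. *)
Lemma one_point_step k :
  \int[mu]_(s in posR) ((expR (- s) * (Gam s ^+ k / k`!%:R))%:E * ((g s)%:E * K s)) <=
  \int[mu]_(t in posR) ((expR (- t) * (Gam t ^+ k.+1 / (k.+1)`!%:R))%:E * Hbar t).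
Proof.
pose a (s : R) : R := (g s * (Gam s ^+ k / k`!%:R))%R.
have a0 (s : R) : (0 <= a s)%R by rewrite /a mulr_ge0// divr_ge0// exprn_ge0.
have ma : measurable_fun setT a.
  apply: measurable_funM => //; apply: measurable_funM => //.
  by apply: measurable_funX; exact: mGam.
pose q (p : R * R) : \bar R :=
  if (p.1 < p.2)%R then (a p.1)%:E * ((expR (- p.2))%:E * Hbar p.2) else 0.
have mq : measurable_fun setT q.
  apply: measurable_fun_ifT; [by meas| |exact: measurable_cst].
  apply: emeasurable_funM.
    by apply/measurable_EFinP; apply: (measurableT_comp ma); exact: measurable_fst.
  apply: emeasurable_funM; first by meas.
  by apply: (measurableT_comp mHbar); exact: measurable_snd.
have q0 p : 0 <= q p by rewrite /q; case: ifP => // _; rewrite mule_ge0// lee_fin.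
apply: (@le_trans _ _ (\int[mu]_(s in posR) \int[mu]_(t in posR) q (s, t))).
  rewrite le_eqVlt; apply/orP; left; apply/eqP.
  apply: eq_integral => s /[!inE]; rewrite posRE => s0.
  have -> : (expR (- s) * (Gam s ^+ k / k`!%:R))%:E * ((g s)%:E * K s) =
      (a s)%:E * ((expR (- s))%:E * K s).
    by rewrite !muleA -!EFinM; congr (_%:E * _); rewrite /a; ring.
  rewrite shift_tail -ge0_integralZl_EFin//; last exact: meHbar.
  rewrite [LHS]integral_mkcond [RHS]integral_mkcond; apply: eq_integral => t _.
  rewrite !patchE !mem_setE/= !in_itv/= !andbT /q/=.
  case: (ltrP 0 t) => t0; case: (ltrP s t) => st //.
  by have := lt_trans s0 st; rewrite ltNge t0.
rewrite tonelli_in//; apply: ge0_le_integral => //.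
- by move=> t _; apply: integral_ge0.
- apply: (@measurable_integral_in _ _ _ _ R lebesgue_measure posR posR (fun p => q (p.2, p.1))) => //.
  by apply: (measurableT_comp mq); meas.
- apply: measurable_funTS; apply: emeasurable_funM => //.
  apply/measurable_EFinP; apply: measurable_funM; first by meas.
  by apply: measurable_funM => //; apply: measurable_funX; exact: mGam.
move=> t; rewrite posRE => t0.
have -> : \int[mu]_(s in posR) q (s, t) =
    (\int[mu]_(s in `]0%R, t[) (a s)%:E) * ((expR (- t))%:E * Hbar t).
  rewrite -ge0_integralZr//; try solve [by move=> s _; rewrite lee_fin
    |by apply/measurable_EFinP; exact: measurable_funTS].
  rewrite [LHS]integral_mkcond [RHS]integral_mkcond; apply: eq_integral => s _.
  rewrite !patchE !mem_setE/= !in_itv/= !andbT /q/=.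
  by case: (ltrP 0 s) => s0 //=; case: (ltrP s t).
apply: (@le_trans _ _ ((Gam t ^+ k.+1 / (k.+1)`!%:R)%:E * ((expR (- t))%:E * Hbar t))).
  by apply: lee_wpmul2r => //; exact: integral_cumul_pow.
by rewrite muleA -EFinM mulrC.
Qed.

End one_point.

(** [arrival E k] has density [e^(-t) t^k / k!], and the Laplace factors of the [k] earlier points
    turn [t^k] into [Gam t ^ k]. [H] is arbitrary because peeling off the last point yields the new
    test function [H'] for the induction. *)
Lemma one_point_bound k (H : Z * R -> \bar R) :
  measurable_fun setT H -> (forall x, 0 <= H x) ->
  \int[Pr]_w ((expR (- (u * wtsum k w)))%:E * H (Zs k w, arrival E k w)) <=
  \int[mu]_(t in posR) ((expR (- t) * (Gam t ^+ k / k`!%:R))%:E * \int[Q]_z H (z, t)).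
Proof.
elim: k H => [|k ih] H mH H0.
  under eq_integral do rewrite /wtsum big_ord0 mulr0 oppr0 expR0 mul1e.
  rewrite (integral_peel0 iid)// le_eqVlt; apply/orP; left; apply/eqP.
  by apply: eq_integral => t _; rewrite expr0 fact0 divr1 mulr1.
rewrite (integral_peel_arrival iid)//; last first.
  apply/measurable_EFinP; apply: (measurableT_comp (@measurable_expR R)).
  apply: measurable_funN; apply: measurable_funM => //.
  exact: measurable_past_wtsum.
pose K (s : R) := \int[mu]_(r in posR) ((expR (- r))%:E * \int[Q]_z H (z, (s + r)%R)).
have K0 s : 0 <= K s by exact: shift_ge0.
have mK : measurable_fun setT K by exact: shift_measurable.
pose H' (x : Z * R) := (expR (- (u * W x.1 x.2)))%:E * K x.2.
have mH' : measurable_fun setT H'.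
  apply: emeasurable_funM; first by meas.
  by apply: (measurableT_comp mK); exact: measurable_snd.
have H'0 x : 0 <= H' x by rewrite mule_ge0// lee_fin expR_ge0.
have -> : \int[Pr]_w ((expR (- (u * wtsum k.+1 w)))%:E * K (arrival E k w)) =
  \int[Pr]_w ((expR (- (u * wtsum k w)))%:E * H' (Zs k w, arrival E k w)).
  apply: eq_integral => w _; rewrite /H'/= muleA -EFinM -expRD -/(wt k w).
  by rewrite /wtsum big_ord_recr/= mulrDr opprD.
apply: (le_trans (ih H' mH' H'0)).
apply: le_trans (one_point_step mH H0 k).
rewrite le_eqVlt; apply/orP; left; apply/eqP; apply: eq_integral => s _.
congr (_ * _); rewrite /H'/= ge0_integralZr//.
- by rewrite -lapE.
- by apply/measurable_EFinP; exact: mW1.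
Qed.

(* Laplace factor of the points arriving after [s]; the branch [s <= 0] only
   makes the function total. *)
Definition tailw (s : R) : R := if (0 < s)%R then expR (s - Gam s - B) else 1%R.

Lemma tailw_ge0 s : (0 <= tailw s)%R.
Proof. by rewrite /tailw; case: ifP => // _; exact: expR_ge0. Qed.

Lemma tailw_le1 s : (tailw s <= 1)%R.
Proof.
rewrite /tailw; case: ifP => // s0; rewrite -expR0 ler_expR subr_le0.
exact: (cumul_compl mg g01 hB (ltW s0)).
Qed.

Lemma measurable_tailw : measurable_fun setT tailw.
Proof.
have m0 : measurable_fun setT (fun s : R => (0 < s)%R) by meas.
apply: measurable_fun_ifT; [exact: m0| |exact: measurable_cst].
apply: (measurableT_comp (@measurable_expR R)); apply: measurable_funB => //.
by apply: measurable_funB => //; exact: mGam.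
Qed.

(* [tailw] is a supersolution of the one-step recursion for the points after [s]. *)
Lemma tailw_super s :
  \int[mu]_(r in posR) ((expR (- r))%:E *
    \int[Q]_z (expR (- (u * W z (s + r))) * tailw (s + r))%:E) <= (tailw s)%:E.
Proof.
have mtg (D : set R) : measurable D -> measurable_fun D (fun r : R => (expR (- r) * (g (s + r) * tailw (s + r)))%:E).
  move=> mD; apply: measurable_funTS; apply/measurable_EFinP.
  apply: measurable_funM; first by meas.
  have ms : measurable_fun setT (fun r : R => s + r)%R by meas.
  exact: (measurable_funM (measurableT_comp mg ms) (measurableT_comp measurable_tailw ms)).
rewrite [leLHS](_ : _ = \int[mu]_(r in posR) (expR (- r) * (g (s + r) * tailw (s + r)))%:E); last first.
  apply: eq_integral => r _; under eq_integral do rewrite EFinM.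
  rewrite ge0_integralZr//; try solve [by move=> z _; rewrite lee_fin expR_ge0|by rewrite lee_fin tailw_ge0
    |by apply/measurable_EFinP; exact: mW1].
  by rewrite -lapE// -!EFinM.
(* For [s <= 0] it suffices that [g] and [tailw] are at most 1, since [e^(-r)] has mass one. *)
have [s0|s0] := ltP 0%R s; last first.
  rewrite {2}/tailw ltNge s0/=; apply: (@le_trans _ _ (\int[mu]_(r in posR) (expR (- (1 * r)))%:E)).
    apply: ge0_le_integral.
    - exact: measurable_posR.
    - by move=> r _; rewrite lee_fin !mulr_ge0 ?expR_ge0 ?tailw_ge0.
    - exact: mtg.
    - by meas.
    - move=> r _; rewrite lee_fin mul1r ler_piMr ?expR_ge0//.
      by rewrite mulr_ile1 ?tailw_ge0 ?tailw_le1.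
  by rewrite integral_expRN_posR// invr1.
(* The variable [r] cancels in the exponents outside [Gam], leaving [e^(s - B)] times the integrand
   of [integral_cumul_exp]. *)
rewrite [leLHS](_ : _ = \int[mu]_(r in posR) ((expR (s - B))%:E * (g (s + r) * expR (- Gam (s + r)))%:E)); last first.
  apply: eq_integral => r /[!inE]; rewrite posRE => r0; rewrite -EFinM; congr EFin.
  rewrite /tailw (addr_gt0 s0 r0) mulrCA [RHS]mulrCA; congr (_ * _)%R.
  by rewrite -!expRD; congr expR; ring.
have mge (D : set R) : measurable D -> measurable_fun D (fun t : R => (g t * expR (- Gam t))%:E).
  move=> mD; apply/measurable_EFinP; apply: measurable_funM; first exact: measurable_funTS.
  by apply: (measurableT_comp (@measurable_expR R)); apply: measurable_funN; exact: mGam.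
have ms : measurable_fun setT (fun r : R => s + r)%R by meas.
rewrite ge0_integralZl_EFin ?expR_ge0//; last 2 first.
- by move=> r _; rewrite lee_fin mulr_ge0 ?expR_ge0.
- exact: (measurable_funTS (measurableT_comp (mge setT measurableT) ms)).
rewrite -(ge0_integral_shift (f := fun t : R => (g t * expR (- Gam t))%:E));
  try solve [exact: mge|by move=> t; rewrite lee_fin mulr_ge0 ?expR_ge0
    |by move=> t _; rewrite lee_fin mulr_ge0 ?expR_ge0].
apply: (@le_trans _ _ ((expR (s - B))%:E * (expR (- Gam s))%:E)).
  by apply: lee_wpmul2l; [rewrite lee_fin expR_ge0|exact: integral_cumul_exp].
by rewrite -EFinM -expRD /tailw s0 lee_fin ler_expR; lra.
Qed.

(** By [tailw_super], integrating out the newest point replaces its weight factor and [tailw] by at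
    most [tailw] at the previous arrival; the left side therefore does not increase with [n]. *)
Lemma integral_tailw_super k n :
  \int[Pr]_w (wt k w * expR (- (u * wtsum (k + n).+1 w)) * tailw (arrival E (k + n) w))%:E <=
  \int[Pr]_w (wt k w * expR (- (u * wtsum k.+1 w)) * tailw (arrival E k w))%:E.
Proof.
elim: n => [|n ih]; first by rewrite addn0.
apply: le_trans ih; rewrite addnS; set N := (k + n)%N.
have kN : (k < N.+1)%N by rewrite ltnS leq_addr.
pose Phi w := (wt k w * expR (- (u * wtsum N.+1 w)))%:E.
have mPhi : measurable_fun (T := Opast N.+1) setT Phi.
  apply/measurable_EFinP; apply: measurable_funM; first exact: measurable_past_wt.
  apply: (measurableT_comp (@measurable_expR R)).
  by apply: measurable_funN; apply: measurable_funM => //; exact: measurable_past_wtsum.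
have Phi0 w : 0 <= Phi w by rewrite lee_fin mulr_ge0 ?wt_ge0 ?expR_ge0.
pose H (x : Z * R) := (expR (- (u * W x.1 x.2)) * tailw x.2)%:E.
have mH : measurable_fun setT H.
  apply/measurable_EFinP; apply: measurable_funM; first by meas.
  by apply: (measurableT_comp measurable_tailw); exact: measurable_snd.
have H0 x : 0 <= H x by rewrite lee_fin mulr_ge0 ?expR_ge0 ?tailw_ge0.
have -> : \int[Pr]_w (wt k w * expR (- (u * wtsum N.+2 w)) * tailw (arrival E N.+1 w))%:E =
   \int[Pr]_w (Phi w * H (Zs N.+1 w, arrival E N.+1 w)).
  apply: eq_integral => w _; rewrite /Phi /H/= -EFinM; congr EFin.
  rewrite /wtsum big_ord_recr/= -/(wtsum N.+1 w) -/(wt N.+1 w) mulrDr opprD expRD; ring.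
have Om (h : Omega -> \bar R) : measurable_fun (T := Opast N.+1) setT h -> measurable_fun (T := Omega) setT h.
  by move=> mw; apply: (measurable_fun_sub (@past_measurable _ _ _ _ _ _ _ _ _ iid N.+1)) mw.
rewrite (integral_peel_arrival iid)//; apply: ge0_le_integral => //.
- move=> w _; rewrite mule_ge0//; apply: integral_ge0 => r _.
  by rewrite mule_ge0 ?lee_fin ?expR_ge0// integral_ge0.
- apply: emeasurable_funM; first exact: Om.
  have mK := shift_measurable mH H0.
  by apply: (measurableT_comp mK); exact: (measurable_arrival iid).
- apply/measurable_EFinP; apply: measurable_funM.
    by apply/measurable_EFinP; exact: Om.
  by apply: (measurableT_comp measurable_tailw); exact: (measurable_arrival iid).
- move=> w _; rewrite EFinM -/(Phi w); apply: lee_wpmul2l => //.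
  exact: tailw_super.
Qed.

End weighted_points.

(** * Laplace representation of the index law *)

Section fixed_u.
Local Open Scope ereal_scope.
Context d dZ (Omega : measurableType d) (Z : measurableType dZ) (R : realType).
Local Notation mu := (@lebesgue_measure R).
Variables (Pr : probability Omega R) (Q : probability Z R).
Variables (Zs : nat -> Omega -> Z) (E : nat -> Omega -> R).
Hypothesis iid : iid_ppr_inputs Pr Q Zs E.
Variables (f : Z -> R) (alpha c : R).
Hypotheses (mf : measurable_fun setT f) (f0 : forall z, (0 <= f z)%R).
Hypotheses (alpha1 : (1 < alpha)%R) (c0 : (0 < c)%R) (cE : gam (- alpha^-1) = c%:E).
Hypothesis f1 : \int[Q]_z (f z)%:E = 1.
Local Notation W := (pweight f alpha).
Local Notation wt := (wt Zs E f alpha).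
Local Notation wtsum := (wtsum Zs E f alpha).

Definition wtot (w : Omega) : R := fine (\sum_(0 <= i <oo) (wt i w)%:E).

(* The test [0 < wtot w] also discards a divergent sum, for which [fine] gives 0. *)
Definition wlap (k : nat) (w : Omega) (u : R) : R :=
  if (0 < wtot w)%R then (wt k w * expR (- (wtot w * u)))%R else 0%R.

Lemma wtot_ge0 w : (0 <= wtot w)%R.
Proof. by apply: fine_ge0; apply: nneseries_ge0 => k _ _; rewrite lee_fin wt_ge0. Qed.

Lemma wlap_ge0 k w u : (0 <= wlap k w u)%R.
Proof. by rewrite /wlap; case: ifP => // _; rewrite mulr_ge0 ?wt_ge0 ?expR_ge0. Qed.

Lemma measurable_wtot : measurable_fun setT wtot.
Proof.
apply: (measurableT_comp (fine_measurable measurableT)).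
apply: (@ge0_emeasurable_sum _ _ _ _ (fun i w => (wt i w)%:E) xpredT).
- by move=> k x _ _; rewrite lee_fin wt_ge0.
- by move=> k _; apply/measurable_EFinP; exact: (measurable_wt iid alpha mf).
Qed.

Lemma measurable_wlap k : measurable_fun setT (fun p : Omega * R => wlap k p.1 p.2).
Proof.
have m1 : measurable_fun setT (fun p : Omega * R => wtot p.1).
  by apply: (measurableT_comp measurable_wtot); exact: measurable_fst.
have m2 : measurable_fun setT (fun p : Omega * R => wt k p.1).
  by apply: (measurableT_comp (measurable_wt iid alpha mf k)); exact: measurable_fst.
by rewrite /wlap; meas.
Qed.

Lemma wtsum_cvg w : (0 < wtot w)%R -> (wtsum n w @[n --> \oo] --> wtot w)%R.
Proof.
move=> w0.
have sE : \sum_(0 <= i <oo) (wt i w)%:E = (wtot w)%:E.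
  by move: w0; rewrite /wtot; case: (\sum_(0 <= i <oo) (wt i w)%:E) => [r| |]; rewrite /= ?ltxx.
have cs : (wtsum n w)%:E @[n --> \oo] --> (wtot w)%:E.
  rewrite -sE.
  have -> : (fun n => (wtsum n w)%:E) = (fun n => \sum_(0 <= i < n) (wt i w)%:E).
    by apply/funext => n; rewrite sumEFin big_mkord.
  by apply: is_cvg_nneseries => n _ _; rewrite lee_fin wt_ge0.
exact: (fine_cvg cs).
Qed.

(** When [wtot w = 0] both sides vanish, since division by zero gives 0; this matches the convention
    in [ppr_cond_log]. *)
Lemma integral_wlap k w :
  \int[mu]_(u in posR) (wlap k w u)%:E = (wt k w / wtot w)%:E.
Proof.
rewrite /wlap; have [w0|w0] := ltrP 0%R (wtot w); last first.
  have -> : wtot w = 0%R by apply/eqP; rewrite eq_le w0 wtot_ge0.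
  by rewrite invr0 mulr0 integral0_eq// => u _; rewrite ltxx.
under eq_integral do rewrite EFinM.
rewrite ge0_integralZl_EFin ?wt_ge0//; try solve [by meas|by move=> u _; rewrite lee_fin expR_ge0].
by rewrite integral_expRN_posR.
Qed.

Variable u : R.
Hypothesis u0 : (0 < u)%R.
Local Notation g := (lap Q f alpha u).
Local Notation Gam := (cumul g).
Local Notation B := (c * u `^ alpha^-1)%R.
Local Notation tailw := (tailw Q f alpha c u).

Let mg : measurable_fun setT g. Proof. exact: measurable_lap. Qed.
Let g01 t : (0 <= g t <= 1)%R. Proof. by apply: lap01 => //; exact: ltW. Qed.
Let hB : \int[mu]_(t in posR) (1 - g t)%:E = B%:E.
Proof. exact: integral_1Blap. Qed.
Let Gam0 t : (0 <= Gam t)%R. Proof. exact: cumul_ge0. Qed.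

Lemma tailw_cvg1 : (tailw s @[s --> +oo] --> (1 : R))%R.
Proof.
have h : (expR (s - Gam s - B) @[s --> +oo] --> (1 : R))%R.
  rewrite -expR0 -(subrr B).
  apply: (@cvg_comp _ _ _ (fun s => s - Gam s - B)%R expR); last exact: continuous_expR.
  by apply: cvgB; [exact: (cvg_cumul_compl mg g01 hB)|exact: cvg_cst].
apply: cvg_trans h; apply: near_eq_cvg; near=> s.
by rewrite /tailw; have -> : (0 < s)%R by near: s; exact: nbhs_pinfty_gt.
Unshelve. all: by end_near. Qed.

(** Supplies the constant [1/u], uniform in the weight, that dominates in [integral_wlap_le]. *)
Lemma mul_expRN_le (x : R) : (x * expR (- (u * x)) <= u^-1)%R.
Proof.
rewrite expRN ler_pdivrMr ?expR_gt0// mulrC ler_pdivlMr// mulrC.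
by apply: le_trans (expR_ge1Dx _); lra.
Qed.

(** Limit [n -> oo] in [integral_tailw_super]: partial sums tend to [wtot], arrivals to infinity and
    [tailw] to 1. Where [wtot] is 0 the partial sums need not converge to it, so [h'] is set to 0
    there, which is harmless for an upper bound. *)
Lemma integral_wlap_le k :
  \int[Pr]_w (wlap k w u)%:E <=
  \int[Pr]_w (wt k w * expR (- (u * wtsum k.+1 w)) * tailw (arrival E k w))%:E.
Proof.
pose h n w : R := (wt k w * expR (- (u * wtsum (k + n).+1 w)) * tailw (arrival E (k + n) w))%R.
pose h' n w : \bar R := (if (0 < wtot w)%R then h n w else 0%R)%:E.
have mwtot := measurable_wtot.
have h0 n w : (0 <= h n w)%R.
  by rewrite /h !mulr_ge0 ?wt_ge0 ?expR_ge0 ?tailw_ge0.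
have mh n : measurable_fun setT (h n).
  have m1 := measurable_wt iid alpha mf k.
  have m2 := measurable_wtsum iid alpha mf (k + n).+1.
  have m3 : measurable_fun setT (fun w => tailw (arrival E (k + n) w)).
    by apply: (measurableT_comp (measurable_tailw Q alpha c mf u0)); exact: (measurable_arrival iid).
  by rewrite /h; meas.
have mh' n : measurable_fun setT (h' n).
  by have := mh n => mhn; rewrite /h'; meas.
have mwl : measurable_fun setT (fun w => (wlap k w u)%:E).
  have m1 := measurable_wt iid alpha mf k.
  by rewrite /wlap; meas.
have hu n w : (h n w <= u^-1)%R.
  apply: le_trans (mul_expRN_le (wt k w)); rewrite /h -mulrA ler_wpM2l ?wt_ge0//.
  apply: (@le_trans _ _ (expR (- (u * wtsum (k + n).+1 w)) * 1)%R).
    by rewrite ler_wpM2l ?expR_ge0//; exact: (tailw_le1 mf f0 alpha1 c0 cE f1 u0).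
  rewrite mulr1 ler_expR lerN2 ler_wpM2l ?(ltW u0)//.
  have kn : (k < (k + n).+1)%N by rewrite ltnS leq_addr.
  rewrite /wtsum (bigD1 (Ordinal kn))//= lerDl sumr_ge0// => i _.
  exact: wt_ge0.
have aecv : {ae Pr, forall w, setT w -> h' n w @[n --> \oo] --> (wlap k w u)%:E}.
  have := arrival_cvgy iid; apply: filterS => w aw _.
  rewrite /h' /wlap; case: ifPn => [w0|_]; last exact: cvg_cst.
  apply: cvg_EFin; first by apply: nearW.
  change (h n w @[n --> \oo] --> (wt k w * expR (- (wtot w * u)))%R).
  rewrite -[X in _ --> X]mulr1 [(wtot w * u)%R]mulrC.
  have shift (v : nat -> R) (F : set_system R) : v n @[n --> \oo] --> F -> v (k + n)%N @[n --> \oo] --> F.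
    rewrite -(cvg_shiftn k v); apply: cvg_trans; apply: near_eq_cvg.
    by apply: nearW => n /=; rewrite addnC.
  apply: cvgM.
    apply: cvgM; first exact: cvg_cst.
    apply: (@cvg_comp _ _ _ (fun n => - (u * wtsum (k + n).+1 w))%R expR); last exact: continuous_expR.
    apply: cvgN; apply: cvgM; first exact: cvg_cst.
    have := wtsum_cvg w0; rewrite -(cvg_shiftS (wtsum ^~ w)) => cs.
    exact: (shift (fun n => wtsum n.+1 w)).
  apply: (@cvg_comp _ _ _ (fun n => arrival E (k + n) w) tailw); last exact: tailw_cvg1.
  exact: (shift (fun n => arrival E n w)).
have aebd : {ae Pr, forall w, forall n, setT w -> `|h' n w| <= (EFin \o cst u^-1%R) w}.
  apply: aeW => w n _; rewrite /h' gee0_abs/= ?lee_fin; last by case: ifP.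
  by case: ifP => // _; rewrite invr_ge0 ltW.
have [_ _ cv] := dominated_convergence measurableT mh' mwl aecv
  (finite_measure_integrable_cst Pr _ measurableT) aebd.
rewrite -(cvg_lim _ cv)//; apply: lime_le; first by apply: cvgP cv.
apply: nearW => n.
apply: le_trans (integral_tailw_super iid mf f0 alpha1 c0 cE f1 u0 k n).
apply: ge0_le_integral => //.
- by move=> w _; rewrite lee_fin; case: ifP.
- by apply/measurable_EFinP; exact: (mh n).
- by move=> w _; rewrite /h' lee_fin; case: ifP => // _; exact: h0.
Qed.

Lemma sum_integral_wlap_le :
  \sum_(0 <= k <oo) ((ln k.+1%:R)%:E * \int[Pr]_w (wlap k w u)%:E) <=
  \int[mu]_(t in posR) \int[Q]_z
    (W z t * expR (- (u * W z t)) * expR (- B) * ln (1 + t))%:E.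
Proof.
have lnk0 k : (0 <= ln k.+1%:R :> R)%R by apply: ln_ge0; rewrite ler1n.
have mWz t : measurable_fun setT (fun z => W z t * expR (- (u * W z t)))%R.
  have mW := @measurable_pweight R _ Z f alpha mf _ _ id (cst t) (@measurable_id _ _ _) (@measurable_cst _ _ _ _ _ _).
  by meas.
have mW2 := @measurable_pweight R _ Z f alpha mf _ _ _ _ (@measurable_fst _ _ Z R) (@measurable_snd _ _ Z R).
have We0 z t : (0 <= W z t * expR (- (u * W z t)))%R.
  by rewrite mulr_ge0 ?pweight_ge0 ?expR_ge0.
pose H (x : Z * R) := (W x.1 x.2 * expR (- (u * W x.1 x.2)) * tailw x.2)%:E.
have H0 x : 0 <= H x by rewrite lee_fin mulr_ge0// tailw_ge0.
have mtw : measurable_fun setT tailw := measurable_tailw Q alpha c mf u0.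
have mH : measurable_fun setT H.
  have mt : measurable_fun setT (fun x : Z * R => tailw x.2).
    by apply: (measurableT_comp mtw); exact: measurable_snd.
  by rewrite /H; meas.
have mHbar : measurable_fun setT (fun t => \int[Q]_z H (z, t)).
  exact: (measurable_fun_fubini_tonelli_G H).
pose p k (t : R) : R := (Gam t ^+ k / k`!%:R)%R.
have p0 k t : (0 <= p k t)%R by rewrite divr_ge0// exprn_ge0.
have mp k : measurable_fun setT (p k).
  apply: measurable_funM => //; apply: measurable_funX.
  exact: (measurable_cumul mg g01).
pose F k (t : R) : \bar R := (expR (- t) * p k t)%:E * \int[Q]_z H (z, t).
have F0 k t : 0 <= F k t.
  rewrite /F; apply: mule_ge0; last exact: integral_ge0.
  by rewrite lee_fin mulr_ge0 ?expR_ge0.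
have mF k : measurable_fun setT (F k).
  by apply: emeasurable_funM => //; have := mp k => mpk; meas.
apply: (@le_trans _ _ (\sum_(0 <= k <oo) \int[mu]_(t in posR) ((ln k.+1%:R)%:E * F k t))).
  apply: lee_nneseries => k.
    by move=> _ _; rewrite mule_ge0 ?lee_fin// integral_ge0// => w _; rewrite lee_fin wlap_ge0.
  move=> _; rewrite ge0_integralZl_EFin//; try solve [by move=> t _; exact: F0|apply: measurable_funTS; exact: mF].
  apply: lee_wpmul2l; first by rewrite lee_fin.
  apply: (le_trans (integral_wlap_le k)).
  apply: le_trans (one_point_bound iid mf f0 alpha1 u0 k mH H0).
  rewrite le_eqVlt; apply/orP; left; apply/eqP; apply: eq_integral => w _.
  rewrite /H/= -EFinM -/(wt k w); congr EFin.
  by rewrite /wtsum big_ord_recr/= -/(wtsum k w) mulrDr opprD expRD; ring.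
rewrite -integral_nneseries//; last 2 first.
- by move=> k; apply: emeasurable_funM; [exact: measurable_cst|apply: measurable_funTS; exact: mF].
- by move=> k t _; rewrite mule_ge0// lee_fin.
apply: ge0_le_integral => //.
- by move=> t _; apply: nneseries_ge0 => k _ _; rewrite mule_ge0// lee_fin.
- apply: (@ge0_emeasurable_sum _ _ _ _ (fun k t => (ln k.+1%:R)%:E * F k t) xpredT).
    by move=> k t _ _; rewrite mule_ge0// lee_fin.
  by move=> k _; apply: emeasurable_funM; [exact: measurable_cst|apply: measurable_funTS; exact: mF].
- apply: (@measurable_integral_in _ _ _ _ R Q posR setT
    (fun q : R * Z => (W q.2 q.1 * expR (- (u * W q.2 q.1)) * expR (- B) * ln (1 + q.1))%:E)) => //.
    have mW3 := @measurable_pweight R _ Z f alpha mf _ _ _ _ (@measurable_snd _ _ R Z) (@measurable_fst _ _ R Z).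
    by meas.
  by move=> t z; rewrite posRE => t0 _ /=; rewrite lee_fin !mulr_ge0 ?expR_ge0 ?pweight_ge0// ln_ge0// lerDl ltW.
move=> t; rewrite posRE => t0.
(* The mean over [z] is at most [1/u], hence a real number that can be factored out of the series
   over [k]. *)
have [m m0 mE] : exists2 m : R, (0 <= m)%R & \int[Q]_z (W z t * expR (- (u * W z t)))%:E = m%:E.
  have I0 : 0 <= \int[Q]_z (W z t * expR (- (u * W z t)))%:E by apply: integral_ge0 => z _; rewrite lee_fin.
  have : \int[Q]_z (W z t * expR (- (u * W z t)))%:E <= (u^-1)%:E.
    apply: (@le_trans _ _ (\int[Q]_z (cst (u^-1)%:E z))).
      apply: ge0_le_integral => //; first by move=> z _; rewrite lee_fin.
      - exact/measurable_EFinP.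
      - by move=> z _; rewrite lee_fin mul_expRN_le.
    by rewrite integral_cst// [X in _ * X](@probability_setT _ _ _ Q) mule1.
  move: I0; case: (\int[Q]_z _) => [m m0 _|//|//]; by exists m.
have Qm (k : R) : (0 <= k)%R -> \int[Q]_z (W z t * expR (- (u * W z t)) * k)%:E = (m * k)%:E.
  move=> k0; under eq_integral do rewrite EFinM.
  by rewrite ge0_integralZr// ?mE// ?lee_fin//; [exact/measurable_EFinP|move=> z _; rewrite lee_fin].
have l0 (s : R) : (0 <= s)%R -> (0 <= ln (1 + s))%R by move=> s0; apply: ln_ge0; lra.
have -> : \int[Q]_z (W z t * expR (- (u * W z t)) * expR (- B) * ln (1 + t))%:E =
    (m * (expR (- B) * ln (1 + t)))%:E.
  rewrite -Qm ?mulr_ge0 ?expR_ge0 ?l0 ?(ltW t0)//.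
  by apply: eq_integral => z _; rewrite !mulrA.
rewrite (eq_eseriesr (g := fun k => (expR (- t) * (m * tailw t))%:E * (ln k.+1%:R * p k t)%:E)); last first.
  move=> k _; rewrite /F /H/= Qm ?tailw_ge0// -!EFinM; congr EFin; ring.
rewrite nneseriesZl; last by move=> k _; rewrite lee_fin mulr_ge0.
apply: (@le_trans _ _ ((expR (- t) * (m * tailw t))%:E * (expR (Gam t) * ln (1 + Gam t))%:E)).
  apply: lee_wpmul2l; first by rewrite lee_fin !mulr_ge0 ?expR_ge0 ?tailw_ge0.
  exact: sum_ln_poisson_le.
rewrite -EFinM lee_fin.
have -> : (expR (- t) * (m * tailw t) * (expR (Gam t) * ln (1 + Gam t)) =
    m * (expR (- B) * ln (1 + Gam t)))%R.
  (* The factors of the points before and after [t] recombine into the Laplace factor of the whole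
     half-line, which does not depend on [t]. *)
  have -> : (expR (- B) = expR (- t) * expR (t - Gam t - B) * expR (Gam t))%R.
    by rewrite -!expRD; congr expR; ring.
  by rewrite /tailw t0; ring.
rewrite ler_wpM2l// ler_wpM2l ?expR_ge0// ler_ln ?posrE.
- by have := cumul_le mg g01 (ltW t0); lra.
- by have := Gam0 t; lra.
- lra.
Qed.

End fixed_u.

(** * Assembly for a target given by a density *)

Section ppr_bound.
Local Open Scope ereal_scope.
Context d dZ (Omega : measurableType d) (Z : measurableType dZ) (R : realType).
Local Notation mu := (@lebesgue_measure R).
Variables (Pr : probability Omega R) (Q : probability Z R).
Variables (Zs : nat -> Omega -> Z) (E : nat -> Omega -> R).
Hypothesis iid : iid_ppr_inputs Pr Q Zs E.
Variables (f : Z -> R) (alpha : R).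
Hypotheses (mf : measurable_fun setT f) (f0 : forall z, (0 <= f z)%R).
Hypotheses (alpha1 : (1 < alpha)%R) (f1 : \int[Q]_z (f z)%:E = 1).
Local Notation W := (pweight f alpha).
Local Notation wlap := (wlap Zs E f alpha).
Local Notation wtot := (wtot Zs E f alpha).

Let ln0 k : (0 <= ln k.+1%:R :> R)%R. Proof. by apply: ln_ge0; rewrite ler1n. Qed.

Let mwl k : measurable_fun setT (fun p : Omega * R => (wlap k p.1 p.2)%:E).
Proof. by apply/measurable_EFinP; exact: (measurable_wlap iid alpha mf k). Qed.

Lemma ppr_Elog_wlap : ppr_Elog Pr alpha (fun _ => f) Zs E =
  \int[mu]_(u in posR) \sum_(0 <= k <oo) ((ln k.+1%:R)%:E * \int[Pr]_w (wlap k w u)%:E).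
Proof.
have mI k : measurable_fun posR (fun u => \int[Pr]_w (wlap k w u)%:E).
  apply: (@measurable_integral_in _ _ _ _ R Pr posR setT (fun p : R * Omega => (wlap k p.2 p.1)%:E)) => //.
    by apply: (measurableT_comp (mwl k) (measurable_fun_pair (@measurable_snd _ _ R Omega) (@measurable_fst _ _ R Omega))).
  by move=> u w _ _; rewrite lee_fin wlap_ge0.
have I0 k u : 0 <= \int[Pr]_w (wlap k w u)%:E.
  by apply: integral_ge0 => w _; rewrite lee_fin wlap_ge0.
rewrite integral_nneseries//; last 2 first.
- by move=> k; apply: emeasurable_funM; [exact: measurable_cst|exact: mI].
- by move=> k u _; rewrite mule_ge0// lee_fin.
have J0 k w : 0 <= \int[mu]_(u in posR) (wlap k w u)%:E.
  by apply: integral_ge0 => u _; rewrite lee_fin wlap_ge0.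
have mJ k : measurable_fun setT (fun w => \int[mu]_(u in posR) (wlap k w u)%:E).
  apply: (@measurable_integral_in _ _ _ _ R lebesgue_measure setT posR (fun p : Omega * R => (wlap k p.1 p.2)%:E)).
  - exact: measurableT.
  - exact: measurable_posR.
  - exact: mwl.
  - by move=> w u _ _; rewrite lee_fin wlap_ge0.
transitivity (\int[Pr]_w \sum_(0 <= k <oo) ((ln k.+1%:R)%:E * \int[mu]_(u in posR) (wlap k w u)%:E)).
  apply: eq_integral => w _; apply: eq_eseriesr => k _.
  by rewrite integral_wlap -EFinM.
rewrite integral_nneseries//; last 2 first.
- by move=> k; apply: emeasurable_funM; [exact: measurable_cst|exact: mJ].
- by move=> k w _; rewrite mule_ge0// lee_fin.
apply: eq_eseriesr => k _; rewrite !ge0_integralZl_EFin//; try solve [exact: mI|exact: mJ|by move=> x _; exact: I0|by move=> x _; exact: J0].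
congr (_ * _).
apply: (@tonelli_in _ _ _ _ R Pr (@lebesgue_measure R) setT posR (fun p : Omega * R => (wlap k p.1 p.2)%:E)).
- exact: measurableT.
- exact: measurable_posR.
- exact: mwl.
- by move=> w u _ _; rewrite lee_fin wlap_ge0.
Qed.

Lemma integral_kernel_reorder c :
  \int[mu]_(u in posR) \int[mu]_(t in posR) \int[Q]_z
    (W z t * expR (- (u * W z t)) * expR (- (c * u `^ alpha^-1)) * ln (1 + t))%:E =
  \int[Q]_z \int[mu]_(t in posR) \int[mu]_(u in posR)
    (W z t * expR (- (u * W z t)) * expR (- (c * u `^ alpha^-1)) * ln (1 + t))%:E.
Proof.
pose F z (t u : R) : \bar R :=
  (W z t * expR (- (u * W z t)) * expR (- (c * u `^ alpha^-1)) * ln (1 + t))%:E.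
have F0 z t u : (0 < t)%R -> 0 <= F z t u.
  move=> t0; rewrite lee_fin !mulr_ge0 ?pweight_ge0 ?expR_ge0// ln_ge0//.
  by rewrite lerDl ltW.
have mF d' (T : measurableType d') (a : T -> Z) (b e : T -> R) :
    measurable_fun setT a -> measurable_fun setT b -> measurable_fun setT e ->
    measurable_fun setT (fun x => F (a x) (b x) (e x)).
  move=> ma mb me; have mW := @measurable_pweight R _ Z f alpha mf _ _ _ _ ma mb.
  by rewrite /F; meas.
transitivity (\int[mu]_(u in posR) \int[Q]_z \int[mu]_(t in posR) F z t u).
  apply: eq_integral => u _.
  apply: (@tonelli_in _ _ _ _ R (@lebesgue_measure R) Q posR setT (fun p : R * Z => F p.2 p.1 u)) => //.
    by apply: mF; [exact: measurable_snd|exact: measurable_fst|exact: measurable_cst].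
  by move=> t z; rewrite posRE => t0 _; exact: F0.
transitivity (\int[Q]_z \int[mu]_(u in posR) \int[mu]_(t in posR) F z t u).
  apply: (@tonelli_in _ _ _ _ R (@lebesgue_measure R) Q posR setT
    (fun p : R * Z => \int[mu]_(t in posR) F p.2 t p.1)).
  - exact: measurable_posR.
  - exact: measurableT.
  - apply: (@measurable_integral_in _ _ _ _ R lebesgue_measure setT posR
      (fun p : (R * Z) * R => F p.1.2 p.2 p.1.1)).
    + exact: measurableT.
    + exact: measurable_posR.
    + apply: mF; [|exact: measurable_snd|].
        by apply: (measurableT_comp (@measurable_snd _ _ R Z)); exact: measurable_fst.
      by apply: (measurableT_comp (@measurable_fst _ _ R Z)); exact: measurable_fst.
    + by move=> x t _; rewrite posRE => t0; exact: F0.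
  - by move=> u z _ _; apply: integral_ge0 => t; rewrite posRE => t0; exact: F0.
apply: eq_integral => z _.
apply: (@tonelli_in _ _ _ _ R (@lebesgue_measure R) (@lebesgue_measure R) posR posR
  (fun p : R * R => F z p.2 p.1)) => //.
  by apply: mF; [exact: measurable_cst|exact: measurable_snd|exact: measurable_fst].
by move=> u t _; rewrite posRE => t0; exact: F0.
Qed.

Lemma measurable_kernel c :
  measurable_fun posR (fun u => \int[mu]_(t in posR) \int[Q]_z
    (W z t * expR (- (u * W z t)) * expR (- (c * u `^ alpha^-1)) * ln (1 + t))%:E).
Proof.
(* The truncation makes the integrand nonnegative for all real [t], as the inner integral has to be
   measurable on the whole plane; on [posR] it changes nothing. *)
pose F z (t u : R) : \bar R :=
  (W z t * expR (- (u * W z t)) * expR (- (c * u `^ alpha^-1)) * Num.max (ln (1 + t)) 0)%:E.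
have F0 z t u : 0 <= F z t u.
  by rewrite lee_fin !mulr_ge0 ?pweight_ge0 ?expR_ge0// le_max lexx orbT.
apply: (eq_measurable_fun (fun u => \int[mu]_(t in posR) \int[Q]_z F z t u)).
  move=> u _; apply: eq_integral => t /[!inE]; rewrite posRE => t0.
  by apply: eq_integral => z _; rewrite /F max_l// ln_ge0// lerDl ltW.
apply: (@measurable_integral_in _ _ _ _ R lebesgue_measure posR posR
    (fun p : R * R => \int[Q]_z F z p.2 p.1)) => //; last first.
  by move=> u t _ _; apply: integral_ge0.
apply: (@measurable_integral_in _ _ _ _ R Q setT setT
    (fun p : (R * R) * Z => F p.2 p.1.2 p.1.1)) => //.
have m1 : measurable_fun setT (fun p : (R * R) * Z => p.1.1).
  by apply: (measurableT_comp (@measurable_fst _ _ R R)); exact: measurable_fst.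
have m2 : measurable_fun setT (fun p : (R * R) * Z => p.1.2).
  by apply: (measurableT_comp (@measurable_snd _ _ R R)); exact: measurable_fst.
have mW := @measurable_pweight R _ Z f alpha mf _ _ _ _ (@measurable_snd _ _ (R * R)%type Z) m2.
by rewrite /F; meas.
Qed.

Theorem ppr_Elog_le :
  ppr_Elog Pr alpha (fun _ => f) Zs E + \int[Q]_z (f z * Num.max (- ln (f z)) 0)%:E <=
  \int[Q]_z (f z * Num.max (ln (f z)) 0)%:E + (ppr_const alpha)%:E.
Proof.
have [c [c0 cE hM]] := gam_moment alpha1.
set eta := Num.min _ _ in hM.
have alpha1' := alpha1.
have eta0 : (0 < eta <= 1)%R.
  by rewrite lt_min ltr01 andbT ge_min lexx orbT andbT; lra.
(* [c1 = 3.56] is one plus the moment bound 2.56 of [gam_moment]. *)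
have c11 : (1 < 356 / 100 :> R)%R by lra.
have hM' : gam (- (alpha^-1 * (1 + eta))) <= ((356 / 100 - 1) * c `^ (1 + eta))%:E.
  by rewrite (_ : (356 / 100 - 1 = 256 / 100 :> R)%R)//; lra.
have := analytic_bound mf f0 alpha1 c0 cE f1 eta0 c11 hM'.
rewrite [(eta^-1 * _)%R]mulrC; apply: le_trans; apply: leeD2r.
rewrite ppr_Elog_wlap -integral_kernel_reorder.
have I0 k u : 0 <= \int[Pr]_w (wlap k w u)%:E.
  by apply: integral_ge0 => w _; rewrite lee_fin wlap_ge0.
apply: ge0_le_integral => //.
- by move=> u _; apply: nneseries_ge0 => k _ _; rewrite mule_ge0// lee_fin.
- apply: (@ge0_emeasurable_sum _ _ _ _ (fun k u => (ln k.+1%:R)%:E * \int[Pr]_w (wlap k w u)%:E) xpredT).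
    by move=> k u _ _; rewrite mule_ge0// lee_fin.
  move=> k _; apply: emeasurable_funM; first exact: measurable_cst.
  apply: (@measurable_integral_in _ _ _ _ R Pr posR setT (fun p : R * Omega => (wlap k p.2 p.1)%:E)) => //.
    by apply: (measurableT_comp (mwl k) (measurable_fun_pair (@measurable_snd _ _ R Omega) (@measurable_fst _ _ R Omega))).
  by move=> u w _ _; rewrite lee_fin wlap_ge0.
- exact: measurable_kernel.
- move=> u; rewrite posRE => u0.
  exact: (sum_integral_wlap_le iid mf f0 alpha1 c0 cE f1 u0).
Qed.

End ppr_bound.

(** * Divergence and densities *)

(** From [- ln x <= 1/x - 1]; this keeps the negative part of the divergence finite. *)
Lemma mul_lnm_le1 (R : realType) (x : R) : 0 <= x -> x * Num.max (- ln x) 0 <= 1.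
Proof.
rewrite le_eqVlt => /predU1P[<-|x0]; first by rewrite mul0r.
have [x1|x1] := leP 1 x.
  by rewrite max_r ?mulr0// oppr_le0 ln_ge0.
have xi0 : 0 < x^-1 by rewrite invr_gt0.
have h : - ln x <= x^-1 - 1.
  rewrite -lnV ?posrE//; have := @le_ln1Dx R (x^-1 - 1).
  rewrite addrCA subrr addr0; apply.
  by rewrite ltrBrDl subrr.
have l0 : 0 <= - ln x by rewrite oppr_ge0 ln_le0// ltW.
rewrite max_l//; apply: le_trans (_ : x * (x^-1 - 1) <= 1).
  by rewrite ler_pM2l.
by rewrite mulrBr divff ?gt_eqF// mulr1 lerBlDr lerDl ltW.
Qed.

Section KL_density.
Local Open Scope ereal_scope.
Context d (T : measurableType d) (R : realType).
Variables (P Q : probability T R) (g : T -> R).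
Hypotheses (mg : measurable_fun setT g) (g0 : forall x, (0 <= g x)%R).
Hypothesis Pg : forall A, measurable A -> P A = \int[Q]_(x in A) (g x)%:E.

Let PQ : P `<< Q.
Proof.
apply/null_content_dominatesP => A mA A0; rewrite Pg//.
apply: null_set_integral => //.
by apply/measurable_EFinP; exact: measurable_funTS.
Qed.

(** [g] agrees with the Radon-Nikodym derivative outside a [Q]-null, hence [P]-null, set; the
    positive and negative parts of [ln g] are then moved from [P] to [Q] separately. *)
Lemma KL_div_density : KL_div P Q =
  \int[Q]_x (g x * Num.max (ln (g x)) 0)%:E - \int[Q]_x (g x * Num.max (- ln (g x)) 0)%:E.
Proof.
have iRN := Radon_Nikodym_integrable (nu := charge_of_finite_measure P) PQ.
have RNg : ae_eq P setT (Radon_Nikodym (charge_of_finite_measure P) Q) (EFin \o g).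
  apply: (null_dominates_ae_eq measurableT PQ); apply: integral_ae_eq => //.
    exact/measurable_EFinP.
  by move=> A _ mA; rewrite -Radon_Nikodym_integral//= Pg.
have mln : measurable_fun setT (fun x => (ln (g x))%:E) by meas.
rewrite /KL_div; case: pselect => [a /=|//].
transitivity (\int[P]_x (ln (g x))%:E).
  apply: ae_eq_integral => //.
    apply/measurable_EFinP; apply: (measurableT_comp (@measurable_ln R)).
    by apply: (measurableT_comp (fine_measurable measurableT)); exact: measurable_int iRN.
  by apply: filterS RNg => x h _; rewrite h.
rewrite integralE; congr (_ - _).
  rewrite (ge0_integral_density mg g0 Pg)//; last exact: measurable_funepos.
  by apply: eq_integral => x _; rewrite funeposE -EFin_max -EFinM mulrC.
rewrite (ge0_integral_density mg g0 Pg)//; last exact: measurable_funeneg.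
by apply: eq_integral => x _; rewrite funenegE -EFinN -EFin_max -EFinM mulrC.
Qed.

(** The subtracted integral is at most 1, so it can be moved across even when [a] or the divergence
    is infinite. *)
Lemma le_KL_div (a : \bar R) (C : R) :
  a + \int[Q]_x (g x * Num.max (- ln (g x)) 0)%:E <=
  \int[Q]_x (g x * Num.max (ln (g x)) 0)%:E + C%:E ->
  a <= KL_div P Q + C%:E.
Proof.
have g00 x : (0 <= g x * Num.max (- ln (g x)) 0)%R by rewrite mulr_ge0// le_max lexx orbT.
have mgl : measurable_fun setT (fun x => (g x * Num.max (- ln (g x)) 0)%:E) by meas.
have fin : \int[Q]_x (g x * Num.max (- ln (g x)) 0)%:E \is a fin_num.
  rewrite ge0_fin_numE; last by apply: integral_ge0 => x _; rewrite lee_fin.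
  apply: (@le_lt_trans _ _ (\int[Q]_x (cst 1 x))).
    apply: ge0_le_integral => //; first by move=> x _; rewrite lee_fin.
    by move=> x _; rewrite lee_fin mul_lnm_le1.
  by rewrite integral_cst// [X in _ * X](@probability_setT _ _ _ Q) mule1 ltry.
by move=> h; rewrite KL_div_density addeAC leeBrDr.
Qed.

End KL_density.

(** [T] is arbitrary and only the composites [f w (Zs i w)] need be measurable, so that the lemma
    also covers products of the inputs with a random target. *)
Lemma measurable_ppr_cond_log d (T : measurableType d) (Z : Type) (R : realType) (alpha : R)
    (f : T -> Z -> R) (Zs : nat -> T -> Z) (E : nat -> T -> R) :
  (forall i, measurable_fun setT (fun w => f w (Zs i w))) ->
  (forall i, measurable_fun setT (E i)) ->
  measurable_fun setT (ppr_cond_log alpha f Zs E).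
Proof.
move=> mf mE.
have mw i : measurable_fun setT (ppr_weight alpha f Zs E i).
  have ma : measurable_fun setT (arrival E i) by apply: measurable_sum => j; exact: mE.
  by have := mf i => mfi; rewrite /ppr_weight; meas.
have w0 i w : 0 <= ppr_weight alpha f Zs E i w by exact: powR_ge0.
have mS : measurable_fun setT
    (fun w => fine (\sum_(0 <= i <oo) (ppr_weight alpha f Zs E i w)%:E)%E).
  apply: (measurableT_comp (fine_measurable measurableT)).
  apply: (@ge0_emeasurable_sum _ _ _ _ (fun i w => (ppr_weight alpha f Zs E i w)%:E) xpredT).
    by move=> k x _ _; rewrite lee_fin.
  by move=> k _; exact/measurable_EFinP.
rewrite /ppr_cond_log.
apply: (@ge0_emeasurable_sum _ _ _ _ (fun k w => (ln k.+1%:R * (ppr_weight alpha f Zs E k w /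
  fine (\sum_(0 <= i <oo) (ppr_weight alpha f Zs E i w)%:E)%E))%:E) xpredT).
  move=> k w _ _; rewrite lee_fin mulr_ge0 ?ln_ge0 ?ler1n// divr_ge0// fine_ge0//.
  by apply: nneseries_ge0 => i _ _; rewrite lee_fin.
by move=> k _; have := mw k => mwk; meas.
Qed.

Lemma ppr_cond_log_ge0 (T Z : Type) (R : realType) (alpha : R)
    (f : T -> Z -> R) (Zs : nat -> T -> Z) (E : nat -> T -> R) w :
  (0 <= ppr_cond_log alpha f Zs E w)%E.
Proof.
apply: nneseries_ge0 => k _ _; rewrite lee_fin mulr_ge0 ?ln_ge0 ?ler1n//.
rewrite divr_ge0 ?powR_ge0// fine_ge0//.
by apply: nneseries_ge0 => i _ _; rewrite lee_fin powR_ge0.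
Qed.

Section inputs_law.
Local Open Scope ereal_scope.
Context d dZ (Omega : measurableType d) (Z : measurableType dZ) (R : realType).
Variables (Pr : probability Omega R) (Q : probability Z R).
Variables (Zs : nat -> Omega -> Z) (E : nat -> Omega -> R).
Hypothesis iid : iid_ppr_inputs Pr Q Zs E.

Lemma ppr_input_law i N : measurable N -> Pr (Zs i @^-1` N) = Q N.
Proof.
move=> mN; have [_ [_ pr]] := iid.
pose A j := if j == i then N else setT.
have -> : Zs i @^-1` N = \bigcap_(j in `I_i.+1) (Zs j @^-1` A j `&` E j @^-1` setT).
  apply/seteqP; split => w.
    by move=> h j _; split => //; rewrite /A; case: ifPn => // /eqP ->.
  by move=> /(_ i (ltnSn i))[]; rewrite /A eqxx.
rewrite pr//; last by move=> j; rewrite /A; case: ifP.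
have e1 : exponential_prob (1 : R) setT = 1 := probability_setT (expo1 R).
rewrite big_ord_recr/= /A eqxx e1 mule1 big1 ?mul1e// => j _.
by rewrite (ltn_eqF (ltn_ord j)) mule1; exact: probability_setT.
Qed.

(** Allows the density to be changed on a [Q]-null set: almost surely no [Zs i] falls into it. *)
Lemma ae_ppr_input (S : set Z) : {ae Q, forall z, S z} ->
  {ae Pr, forall w, forall i, S (Zs i w)}.
Proof.
move=> [N [mN QN SN]]; apply: ae_foralln => i.
exists (Zs i @^-1` N); split.
- have [mZ _] := iid.
  by rewrite -[X in measurable X]setTI; exact: mZ.
- exact: (etrans (ppr_input_law i mN) QN).
- by move=> w; exact: SN.
Qed.

End inputs_law.

Section target_bound.
Local Open Scope ereal_scope.
Context d dZ (Omega : measurableType d) (Z : measurableType dZ) (R : realType).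
Variables (P Q : probability Z R) (Pr : probability Omega R).
Variables (Zs : nat -> Omega -> Z) (E : nat -> Omega -> R) (alpha : R).
Hypotheses (PQ : P `<< Q) (iid : iid_ppr_inputs Pr Q Zs E) (alpha1 : (1 < alpha)%R).

Theorem ppr_Elog_le_KL :
  ppr_Elog Pr alpha (fun _ z => fine (Radon_Nikodym (charge_of_finite_measure P) Q z)) Zs E
  <= KL_div P Q + (ppr_const alpha)%:E.
Proof.
(* A version that is finite and nonnegative everywhere replaces the given one, with which it agrees
   [Q]-almost everywhere. *)
pose f z : R := fine (Radon_Nikodym_SigmaFinite.f P Q z).
have fE z : (f z)%:E = Radon_Nikodym_SigmaFinite.f P Q z.
  by rewrite fineK// Radon_Nikodym_SigmaFinite.f_fin_num.
have iRN := Radon_Nikodym_integrable (nu := charge_of_finite_measure P) PQ.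
have mRN : measurable_fun setT (fun z => fine (Radon_Nikodym (charge_of_finite_measure P) Q z)).
  by apply: (measurableT_comp (fine_measurable measurableT)); exact: measurable_int iRN.
have mf : measurable_fun setT f.
  apply: (measurableT_comp (fine_measurable measurableT)).
  exact: measurable_int (Radon_Nikodym_SigmaFinite.f_integrable PQ).
have f0 z : (0 <= f z)%R by apply: fine_ge0; exact: Radon_Nikodym_SigmaFinite.f_ge0.
have Pf A : measurable A -> P A = \int[Q]_(z in A) (f z)%:E.
  move=> mA; rewrite (Radon_Nikodym_SigmaFinite.f_integral PQ mA).
  by apply: eq_integral => z _; rewrite fE.
have f1 : \int[Q]_z (f z)%:E = 1 by rewrite -Pf//; exact: probability_setT.
have [mZ [mE _]] := iid.
have -> : ppr_Elog Pr alpha (fun _ z => fine (Radon_Nikodym (charge_of_finite_measure P) Q z)) Zs E =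
    ppr_Elog Pr alpha (fun _ => f) Zs E.
  apply: ae_eq_integral => //.
  - by apply: measurable_ppr_cond_log => // i; exact: (measurableT_comp mRN).
  - by apply: measurable_ppr_cond_log => // i; exact: (measurableT_comp mf).
  have : {ae Q, forall z, fine (Radon_Nikodym (charge_of_finite_measure P) Q z) = f z}.
    have := ae_eq_Radon_Nikodym_SigmaFinite PQ measurableT.
    by apply: filterS => z /(_ Logic.I) h; rewrite /f h.
  move=> /(ae_ppr_input iid); apply: filterS => w h _.
  have wE i : ppr_weight alpha (fun _ z => fine (Radon_Nikodym (charge_of_finite_measure P) Q z)) Zs E i w =
      ppr_weight alpha (fun _ => f) Zs E i w by rewrite /ppr_weight h.
  rewrite /ppr_cond_log.
  have -> : \sum_(0 <= i <oo) (ppr_weight alpha (fun _ z => fine (Radon_Nikodym (charge_of_finite_measure P) Q z)) Zs E i w)%:E =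
      \sum_(0 <= i <oo) (ppr_weight alpha (fun _ => f) Zs E i w)%:E.
    by apply: eq_eseriesr => i _; rewrite wE.
  by apply: eq_eseriesr => k _; rewrite wE.
by apply: (le_KL_div mf f0 Pf); exact: (ppr_Elog_le iid mf f0 alpha1 f1).
Qed.

End target_bound.

(** * Random target *)

Section kernel_target.
Local Open Scope ereal_scope.
Context d dX dZ (Omega : measurableType d) (Xs : measurableType dX) (Z : measurableType dZ).
Context (R : realType).
Variables (PX : probability Xs R) (Q : probability Z R) (Pr : probability Omega R).
Variables (X : Omega -> Xs) (Zs : nat -> Omega -> Z) (E : nat -> Omega -> R).
Hypothesis iidX : iid_ppr_inputs_X Pr PX Q X Zs E.

Lemma iid_ppr_inputs_of_X : iid_ppr_inputs Pr Q Zs E.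
Proof.
have [_ [mZ [mE pr]]] := iidX; split => //; split => // n A B mA mB.
have := pr setT n A B measurableT mA mB.
by rewrite preimage_setT setTI (@probability_setT _ _ _ PX) mul1e.
Qed.
Let iid := iid_ppr_inputs_of_X.

(** [ppr_cond_log] depends on all inputs, so no single [past n] suffices. The pasts increase with
    [n], hence their union is still a pi-system. *)
Let G : set (set Omega) := [set S | exists n, past Zs E n S].
Local Notation OG := (g_sigma_algebraType G).

Let past_sub n : past Zs E n `<=` G. Proof. by move=> S pS; exists n. Qed.

Let sigma_past_sub n : <<s past Zs E n >> `<=` <<s G >>.
Proof.
apply: smallest_sub; first exact: smallest_sigma_algebra.
by apply: (subset_trans (@past_sub n)); exact: sub_sigma_algebra.
Qed.

Let past_le n m : (n <= m)%N -> past Zs E n `<=` past Zs E m.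
Proof.
move=> nm _ [A [B [mA mB ->]]].
exists (fun i => if (i < n)%N then A i else setT), (fun i => if (i < n)%N then B i else setT).
split; [by move=> i; case: ifP|by move=> i; case: ifP|].
apply/seteqP; split => w h i /=.
  by move=> im; case: ifPn => // ni; exact: h.
by move=> ni; have := h i; rewrite ni; apply; exact: leq_trans nm.
Qed.

Let GI : setI_closed G.
Proof.
move=> S S' [n pS] [m pS']; exists (maxn n m); apply: past_setI.
- by apply: past_le pS; exact: leq_maxl.
- by apply: past_le pS'; exact: leq_maxr.
Qed.

Let GT : G setT. Proof. by exists 0%N; exact: past_setT. Qed.

Let Gm : G `<=` measurable.
Proof. by move=> S [n pS]; exact: (past_measurable iid pS). Qed.

Let indep A B : G A -> measurable B -> Pr (A `&` X @^-1` B) = Pr A * PX B.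
Proof.
move=> [n [C [D [mC mD ->]]]] mB.
have [_ [_ [_ pr]]] := iidX.
by rewrite setIC pr// (iid.2.2)// muleC.
Qed.

Let mGZs i : measurable_fun (T := OG) setT (Zs i).
Proof.
move=> _ Y mY.
have := @measurable_past_Zs _ _ _ _ _ Zs E _ _ (ltnSn i) measurableT _ mY.
exact: sigma_past_sub.
Qed.

Let mGE i : measurable_fun (T := OG) setT (E i).
Proof.
move=> _ Y mY.
have := @measurable_past_E _ _ _ _ _ Zs E _ _ (ltnSn i) measurableT _ mY.
exact: sigma_past_sub.
Qed.

Variables (f : Xs -> Z -> R) (alpha : R).
Hypothesis mf : measurable_fun setT (fun p : Xs * Z => f p.1 p.2).

(** Stated over an abstract [T] to serve both the sigma-algebra of [Omega] and the coarser one
    generated by the inputs. *)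
Let mcond dT (T : measurableType dT) (V : T -> Omega) (x : T -> Xs) :
  (forall i, measurable_fun setT (fun t => Zs i (V t))) ->
  (forall i, measurable_fun setT (fun t => E i (V t))) -> measurable_fun setT x ->
  measurable_fun setT (fun t => ppr_cond_log alpha (fun _ => f (x t)) Zs E (V t)).
Proof.
move=> mZ mE mx.
apply: (@measurable_ppr_cond_log _ T Z R alpha (fun t => f (x t))
  (fun i t => Zs i (V t)) (fun i t => E i (V t))) => // i.
exact: (measurableT_comp mf (measurable_fun_pair mx (mZ i))).
Qed.

Let mOX : measurable_fun setT
  (fun p : Omega * Xs => ppr_cond_log alpha (fun _ => f p.2) Zs E p.1).
Proof.
have [mZ [mE _]] := iid.
apply: (@mcond _ _ fst snd) => [i|i|]; last exact: measurable_snd.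
- exact: (measurableT_comp (mZ i) (@measurable_fst _ _ Omega Xs)).
- exact: (measurableT_comp (mE i) (@measurable_fst _ _ Omega Xs)).
Qed.

Lemma ppr_Elog_freeze :
  ppr_Elog Pr alpha (fun w z => f (X w) z) Zs E =
  \int[PX]_x ppr_Elog Pr alpha (fun _ => f x) Zs E.
Proof.
have [mX _] := iidX.
have mh : measurable_fun setT
    (fun p : OG * Xs => ppr_cond_log alpha (fun _ => f p.2) Zs E p.1).
  apply: (@mcond _ _ (fst : OG * Xs -> Omega) snd) => [i|i|]; last exact: measurable_snd.
  - exact: (measurableT_comp (mGZs i) (@measurable_fst _ _ OG Xs)).
  - exact: (measurableT_comp (mGE i) (@measurable_fst _ _ OG Xs)).
have := integral_freeze GI GT Gm mX indep mh (fun x => ppr_cond_log_ge0 _ _ _ _ _).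
rewrite /= => e; transitivity (\int[Pr]_w ppr_cond_log alpha (fun _ => f (X w)) Zs E w) => //.
rewrite e.
apply: (@fubini_tonelli _ _ _ _ R Pr PX
  (fun p : Omega * Xs => ppr_cond_log alpha (fun _ => f p.2) Zs E p.1)) => //.
by move=> x; exact: ppr_cond_log_ge0.
Qed.

Hypotheses (f0 : forall x z, (0 <= f x z)%R) (alpha1 : (1 < alpha)%R).
Variable k : R.-pker Xs ~> Z.
Hypothesis kf : {ae PX, forall x, forall A, measurable A ->
  k x A = \int[Q]_(z in A) (f x z)%:E}.
Variable PXZ : probability (Xs * Z)%type R.
Hypothesis PXZE : forall A, measurable A -> PXZ A = \int[PX]_x k x (xsection A x).

(** In [kf] the null set of [x] is chosen before the event, so the identity may be applied to the
    section of [A], which varies with [x]. *)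
Lemma joint_density A : measurable A ->
  PXZ A = \int[PX \x Q]_(p in A) (f p.1 p.2)%:E.
Proof.
move=> mA; rewrite PXZE// [RHS]integral_mkcond.
have mfA : measurable_fun setT ((fun p : Xs * Z => (f p.1 p.2)%:E) \_ A).
  by apply/(measurable_restrictT _ _).1 => //; apply: measurable_funTS; exact/measurable_EFinP.
have fA0 p : 0 <= ((fun p : Xs * Z => (f p.1 p.2)%:E) \_ A) p.
  by rewrite patchE; case: ifP => // _; rewrite lee_fin.
rewrite fubini_tonelli1//; apply: ae_eq_integral => //.
- have := @measurable_fun_integral_sfinite_kernel _ _ Xs Z R (fun p => (\1_A p)%:E) k.
  have -> : (fun x => \int[k x]_y (\1_A (x, y))%:E) = (fun x => k x (xsection A x)).
    apply/funext => x; transitivity (\int[k x]_y (\1_(xsection A x) y)%:E); last first.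
      by rewrite integral_indic// ?setIT//; exact: measurable_xsection.
    apply: eq_integral => y _; rewrite !indicE; congr (_%:R)%:E.
    by rewrite mem_xsection.
  apply=> //.
  by apply/measurable_EFinP; exact: measurable_indic.
- exact: measurable_fun_fubini_tonelli_F.
apply: filterS kf => x h _; rewrite h; last exact: measurable_xsection.
rewrite integral_mkcond /fubini_F; apply: eq_integral => z _; rewrite !patchE.
by rewrite mem_xsection.
Qed.

(** The additive bound [ppr_Elog_le] is averaged over [x], and Tonelli identifies the averaged parts
    with those of the joint density; the subtraction happens once, for the joint law, so no
    conditional divergence is formed. *)
Theorem ppr_Elog_le_mutual_information :
  ppr_Elog Pr alpha (fun w z => f (X w) z) Zs E
  <= KL_div PXZ (PX \x Q) + (ppr_const alpha)%:E.
Proof.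
have f0' p : (0 <= f p.1 p.2)%R by exact: f0.
apply: (@le_KL_div _ _ R PXZ (PX \x Q) (fun p => f p.1 p.2)) => //; first exact: joint_density.
rewrite ppr_Elog_freeze.
have m0 (x : Xs) (z : Z) (r : R) : 0 <= (f x z * Num.max r 0)%:E.
  by rewrite lee_fin mulr_ge0// le_max lexx orbT.
have mm : measurable_fun setT (fun p : Xs * Z => (f p.1 p.2 * Num.max (- ln (f p.1 p.2)) 0)%:E) by meas.
have mp : measurable_fun setT (fun p : Xs * Z => (f p.1 p.2 * Num.max (ln (f p.1 p.2)) 0)%:E) by meas.
rewrite !fubini_tonelli1//; try (by move=> p; exact: m0).
rewrite /fubini_F/=.
have mFm : measurable_fun setT (fun x => \int[Q]_z (f x z * Num.max (- ln (f x z)) 0)%:E).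
  exact: (@measurable_fun_fubini_tonelli_F _ _ _ _ R Q _ mm (fun p => m0 p.1 p.2 _)).
have mFp : measurable_fun setT (fun x => \int[Q]_z (f x z * Num.max (ln (f x z)) 0)%:E).
  exact: (@measurable_fun_fubini_tonelli_F _ _ _ _ R Q _ mp (fun p => m0 p.1 p.2 _)).
have mFE : measurable_fun setT (fun x => ppr_Elog Pr alpha (fun _ => f x) Zs E).
  apply: (@measurable_fun_fubini_tonelli_F _ _ _ _ R Pr
    (fun p : Xs * Omega => ppr_cond_log alpha (fun _ => f p.1) Zs E p.2)).
    exact: (measurableT_comp mOX (measurable_fun_pair (@measurable_snd _ _ Xs Omega) (@measurable_fst _ _ Xs Omega))).
  by move=> x; exact: ppr_cond_log_ge0.
have E0 x : 0 <= ppr_Elog Pr alpha (fun _ => f x) Zs E.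
  by apply: integral_ge0 => w _; exact: ppr_cond_log_ge0.
have C0 : (0 <= ppr_const alpha)%R.
  have a1 := alpha1.
  by rewrite /ppr_const divr_ge0 ?ln_ge0// ?le_min ?ler01 ?andbT; lra.
have e1 : \int[PX]_x (ppr_const alpha)%:E = (ppr_const alpha)%:E.
  transitivity (\int[PX]_x (cst (ppr_const alpha)%:E x)) => //.
  by rewrite integral_cst// [X in _ * X](@probability_setT _ _ _ PX) mule1.
rewrite -[X in _ <= _ + X]e1 -!ge0_integralD//; try solve
  [by move=> x _; apply: integral_ge0 => z _; exact: m0
  |by move=> x _; rewrite lee_fin].
apply: ae_ge0_le_integral => //.
- by move=> x _; apply: adde_ge0 => //; apply: integral_ge0 => z _; exact: m0.
- exact: emeasurable_funD.
- by move=> x _; apply: adde_ge0; rewrite ?lee_fin//; apply: integral_ge0 => z _; exact: m0.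
- by apply: emeasurable_funD => //; exact: measurable_cst.
(* Only for [x] outside the null set is [f x] known to have [Q]-integral one, which is what the
   bound for a fixed target requires. *)
apply: filterS kf => x h _.
apply: (@ppr_Elog_le _ _ _ _ R Pr Q Zs E iid (f x) alpha _ (f0 x) alpha1).
- exact: (measurableT_comp mf (measurable_fun_pair (measurable_cst x) (@measurable_id _ Z _))).
- by rewrite -h// prob_kernel.
Qed.

End kernel_target.

Theorem theorem1 (R : realType) (alpha : R) (halpha : 1 < alpha) :
  (* Part 1: PPR with target P and proposal Q, P << Q. *)
  (forall (dZ : measure_display) (Z : measurableType dZ)
          (P Q : probability Z R), P `<< Q ->
   forall (d : measure_display) (Omega : measurableType d)
          (Pr : probability Omega R)
          (Zs : nat -> Omega -> Z) (E : nat -> Omega -> R),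
   iid_ppr_inputs Pr Q Zs E ->
   (ppr_Elog Pr alpha
      (fun _ z => fine (Radon_Nikodym (charge_of_finite_measure P) Q z)) Zs E
    <= KL_div P Q + (ppr_const alpha)%:E)%E)
  /\
  (* Part 2: X ~ PX, kernel P_{Z|X}, Q = P_Z, PPR applied to P_{Z|X}(.|X). *)
  (forall (dX dZ : measure_display) (Xs : measurableType dX)
          (Z : measurableType dZ)
          (PX : probability Xs R) (k : R.-pker Xs ~> Z)
          (Q : probability Z R),
   (forall A, measurable A -> Q A = (\int[PX]_x k x A)%E) ->
   forall (PXZ : probability (Xs * Z)%type R),
   (forall A, measurable A -> PXZ A = (\int[PX]_x k x (xsection A x))%E) ->
   forall (f : Xs -> Z -> R),
   measurable_fun setT (fun p : Xs * Z => f p.1 p.2) ->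
   (forall x z, 0 <= f x z) ->
   {ae PX, forall x, forall A, measurable A ->
                     k x A = (\int[Q]_(z in A) (f x z)%:E)%E} ->
   forall (d : measure_display) (Omega : measurableType d)
          (Pr : probability Omega R) (X : Omega -> Xs)
          (Zs : nat -> Omega -> Z) (E : nat -> Omega -> R),
   iid_ppr_inputs_X Pr PX Q X Zs E ->
   (ppr_Elog Pr alpha (fun w z => f (X w) z) Zs E
    <= KL_div PXZ (PX \x Q) + (ppr_const alpha)%:E)%E).
Proof.
split=> [dZ Z P Q PQ d Omega Pr Zs E iid|]; first exact: ppr_Elog_le_KL.
move=> dX dZ Xs Z PX k Q _ PXZ PXZE f mf f0 kf d Omega Pr X Zs E iid.
exact: (ppr_Elog_le_mutual_information iid mf f0 halpha kf PXZE).
Qed.
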